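(* Let $\Omega\subset\mathbb{R}^n$ be a John domain and let $\rho$ be a density on $\Omega$ satisfying the following condition: for each $x\in\partial_\rho\Omega$ and each $\varepsilon>0$ there is $r>0$ such that for all $y\in B_\rho(x,r)$ there is a curve $\gamma$ joining $x$ to $y$ in $\Omega$ with $h(\gamma)\ge d(x,y)^{1+\varepsilon}$ and $\ell_\rho(\gamma)\le d_\rho(x,y)^{1-\varepsilon}$, where $h(\gamma)=\sup_{z\in\gamma}d(z)$. Then \[ \dim_\rho(\partial_\rho\Omega)\ge\sup_{\beta>-1}\frac{d^+(\beta)}{1+\beta},\qquad \operatorname{Dim}_\rho(\partial_\rho\Omega)\ge\sup_{\beta>-1}\frac{D^+(\beta)}{1+\beta}, \] \[ \dim_\rho\bigl(\partial_\rho\Omega\cap\{x: i^-(x)>-1\}\bigr)\le\sup_{\beta>-1}\frac{d^-(\beta)}{1+\beta},\qquad \operatorname{Dim}_\rho\bigl(\partial_\rho\Omega\cap\{x: i^-(x)>-1\}\bigr)\le\sup_{\beta>-1}\frac{D^-(\beta)}{1+\beta}. \]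
   Context: Internal metric. For a domain $\Omega\subset\mathbb{R}^n$ and $x,y\in\Omega$, $d(x,y)=\inf_\gamma\ell(\gamma)$, the infimum over all rectifiable curves $\gamma$ in $\Omega$ joining $x$ and $y$, where $\ell$ is Euclidean length. $\overline{\Omega}_d$ is the metric completion of $(\Omega,d)$ and $\partial\Omega_d=\overline{\Omega}_d\setminus\Omega$ is the internal boundary; $d$ is extended to $\overline{\Omega}_d$. For $A\subset\overline\Omega_d$, $d(x,A)=\inf_{a\in A}d(x,a)$, and $d(x)=d(x,\partial\Omega_d)$ (the Euclidean distance from $x$ to the boundary of $\Omega$). $\rho$-metric. For a continuous $\rho\colon\Omega\to(0,\infty)$ and a rectifiable curve $\gamma$, $\ell_\rho(\gamma)=\int_\gamma\rho(z)|dz|$ (integration with respect to arclength), and $d_\rho(x,y)=\inf_\gamma\ell_\rho(\gamma)$, the infimum over all rectifiable curves joining $x$ to $y$ in $\Omega$. $\overline\Omega_\rho$ is the metric completion of $(\Omega,d_\rho)$, $\partial_\rho\Omega=\overline\Omega_\rho\setminus\Omega$, and $B_\rho(x,r)=\{z\in\overline\Omega_\rho: d_\rho(z,x)<r\}$. Density. A density on $\Omega$ is a continuous function $\rho\colon\Omega\to(0,\infty)$ with $\partial_\rho\Omega\ne\emptyset$ such that for all sequences $(x_i)$ in $\Omega$: (A1) if $(x_i)$ converges in $\overline\Omega_\rho$, then it converges in $\overline\Omega_d$; (A2) if $(x_i)$ converges in $\overline\Omega_d$, then it has at most one accumulation point in $\partial_\rho\Omega$. Equivalently, the identity map $(\Omega,d_\rho)\to(\Omega,d)$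 extends to a continuous injective map $\overline\Omega_\rho\to\overline\Omega_d$; via this map $\overline\Omega_\rho$ is identified with a subset of $\overline\Omega_d$, and $\partial_\rho\Omega$ with a subset of $\partial\Omega_d$. Curves are rectifiable, arc-length parametrized, with $\gamma(t)\in\Omega$ for $0<t<\ell(\gamma)$ (endpoints may lie in $\partial\Omega_d$). For $0<\alpha\le1$, $\Omega$ is an $\alpha$-John domain if there is $x_0\in\Omega$ such that every $x\in\Omega$ can be joined to $x_0$ by a curve $\gamma$ starting at $x$ with $d(\gamma(t))\ge\alpha t$ for all $0\le t\le\ell(\gamma)$. A John domain is an $\alpha$-John domain for some $\alpha$. Dimensions. For a separable metric space $(X,d_X)$ and $A\subset X$, $\dim_X(A)$ is the usual Hausdorff dimension. The packing dimension $\operatorname{Dim}_X(A)=\inf\{s\ge0:\mathcal P^s_X(A)=0\}$ is defined from $P^{s,\varepsilon}_X(A)=\sup\{\sum_i r_i^s\}$, the supremum over disjoint families of balls $B_X(x_i,r_i)$ with $x_i\in A$, $r_i\le\varepsilon$; $P^s_X(A)=\lim_{\varepsilon\downarrow0}P^{s,\varepsilon}_X(A)$; $\mathcal P^s_X(A)=\inf\{\sum_i P^s_X(A_i): A\subset\bigcup_i A_i\}$ (countable covers). Conventions: $\sup\emptyset=0$, $\inf\emptyset=\infty$. $\dim_d,\operatorname{Dim}_d$ denote these dimensions with respect to $d$, and $\dim_\rho,\operatorname{Dim}_\rho$ with respect to $d_\rho$. Limits. For $x\in\partial\Omega_d$, \[ i^-(x)=\liminf_{y\in\Omega,\,y\to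 x}\frac{\log\rho(y)}{\log d(y)},\qquad i^+(x)=\limsup_{y\in\Omega,\,y\to x}\frac{\log\rho(y)}{\log d(y)}, \] the limits being with respect to the internal metric. For $\beta>-1$, $d^\pm(\beta)=\dim_d\{x\in\partial_\rho\Omega: i^\pm(x)\le\beta\}$ and $D^\pm(\beta)=\operatorname{Dim}_d\{x\in\partial_\rho\Omega: i^\pm(x)\le\beta\}$. *)

(* Defs.v *)
From HB Require Import structures.
From mathcomp Require Import all_boot all_order all_algebra.
From mathcomp Require Import all_classical all_reals all_analysis.

Set Implicit Arguments.
Unset Strict Implicit.
Unset Printing Implicit Defensive.

Import Order.TTheory GRing.Theory Num.Theory.
Import numFieldNormedType.Exports.

Local Open Scope classical_set_scope.
Local Open Scope ring_scope.

(* Only reflexivity is recorded: the distances below are infima over curves,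
   and are metrics when the underlying set is a domain. *)
Record distance (R : realType) (X : Type) := Distance {
  dist :> X -> X -> R;
  distxx : forall x, dist x x = 0 }.

Section completion.
Context {R : realType} {X : Type} (d : distance R X).

Definition cauchy_seq (u : nat -> X) : Prop :=
  forall e : R, 0 < e -> \forall i & j \near \oo, d (u i) (u j) < e.

Definition cauchy_class (u : nat -> X) : set (nat -> X) :=
  [set v | cauchy_seq v /\ d (u i) (v i) @[i --> \oo] --> (0 : R)].

(* A point of the completion is an equivalence class of Cauchy sequences. *)
Record completion := Completion {
  class_of : set (nat -> X);
  class_ofP : exists2 u, cauchy_seq u & class_of = cauchy_class u }.

HB.instance Definition _ := gen_eqMixin completion.
HB.instance Definition _ := gen_choiceMixin completion.

Definition rep (xi : completion) : nat -> X := s2val (cid2 (class_ofP xi)).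

Definition cdist (xi eta : completion) : R :=
  limn (fun i => d (rep xi i) (rep eta i)).

Lemma cauchy_seq_cst (x : X) : cauchy_seq (fun=> x).
Proof.
move=> e e0; near=> i j; by rewrite distxx.
Unshelve. all: by end_near. Qed.

Definition embed (x : X) : completion :=
  Completion (ex_intro2 _ _ (fun=> x) (cauchy_seq_cst x) erefl).

Definition bdry : set completion := ~` range embed.

Definition converges_to (u : nat -> X) (xi : completion) : Prop :=
  cdist (embed (u i)) xi @[i --> \oo] --> (0 : R).

Definition clusters_at (u : nat -> X) (xi : completion) : Prop :=
  forall (e : R) (N : nat), 0 < e ->
    exists2 i, (N <= i)%N & cdist (embed (u i)) xi < e.

End completion.

Section dimensions.
Context {R : realType} {T : choiceType} (d : T -> T -> R).
Local Open Scope ereal_scope.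

(* [diam set0] is -oo; the empty set is treated apart in [diam_pow]. *)
Definition diam (U : set T) : \bar R :=
  ereal_sup [set (d z.1 z.2)%:E | z in U `*` U].

Definition diam_pow (s : R) (U : set T) : \bar R :=
  if U == set0 then 0 else poweR (diam U) s.

Definition hausdorff_premeasure (s delta : R) (A : set T) : \bar R :=
  ereal_inf [set \sum_(0 <= i <oo) diam_pow s (U i) | U in
    [set U : nat -> set T |
      A `<=` \bigcup_i U i /\ forall i, diam (U i) <= delta%:E]].

Definition hausdorff_measure (s : R) (A : set T) : \bar R :=
  ereal_sup [set hausdorff_premeasure s delta A | delta in
    [set delta : R | (0 < delta)%R]].

Definition hausdorff_dim (A : set T) : \bar R :=
  ereal_inf [set s%:E | s in
    [set s : R | (0 <= s)%R /\ hausdorff_measure s A = 0]].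

Definition dball (x : T) (r : R) : set T := [set z | (d z x < r)%R].

(* A family of balls is a set of pairs (centre, radius): a ball occurring in a
   disjoint family cannot be repeated, since it contains its centre. *)
Definition packing (eps : R) (A : set T) : set (set (T * R)) :=
  [set B | (forall b, B b -> A b.1 /\ (0 < b.2 <= eps)%R) /\
           trivIset B (fun b => dball b.1 b.2)].

Definition packing_presup (s eps : R) (A : set T) : \bar R :=
  ereal_sup [set \esum_(b in B) (b.2 `^ s)%:E | B in packing eps A].

Definition packing_premeasure (s : R) (A : set T) : \bar R :=
  lim (packing_presup s eps A @[eps --> 0^'+]).

Definition packing_measure (s : R) (A : set T) : \bar R :=
  ereal_inf [set \sum_(0 <= i <oo) packing_premeasure s (V i) | V in
    [set V : nat -> set T | A `<=` \bigcup_i V i]].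

Definition packing_dim (A : set T) : \bar R :=
  ereal_inf [set s%:E | s in
    [set s : R | (0 <= s)%R /\ packing_measure s A = 0]].

End dimensions.

Definition domain (R : realType) (n : nat) (Omega : set 'rV[R]_n) : Prop :=
  [/\ open Omega, connected Omega & Omega !=set0].

(* The norm of the library on ['rV[R]_n] is the sup norm. *)
Definition enorm (R : realType) (n : nat) (v : 'rV[R]_n) : R :=
  Num.sqrt (\sum_i v 0 i ^+ 2).

Section internal_metric.
Context {R : realType} {n : nat} (Omega : set 'rV[R]_n).

Definition elength (g : R -> Omega) (a b : R) : \bar R :=
  ereal_sup [set (\sum_(0 <= i < size s)
      enorm (val (g (nth b (a :: s) i.+1)) - val (g (nth b (a :: s) i))))%:E
    | s in itv_partition a b].

Definition arclength_joins (x y : Omega) (l : R) (g : R -> Omega) : Prop :=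
  [/\ 0 <= l, g 0 = x, g l = y &
      forall s t, 0 <= s -> s <= t -> t <= l -> elength g s t = (t - s)%:E].

Lemma arclength_joins_cst (x : Omega) : arclength_joins x x 0 (fun=> x).
Proof.
split=> // s t s0 st t0.
have -> : t = s by apply/eqP; rewrite eq_le st (le_trans t0 s0).
rewrite subrr /elength; set S := [set _ | _ in _].
suff -> : S = [set 0%E] by rewrite ereal_sup1.
have enorm0 : enorm (0 : 'rV[R]_n) = 0.
  by rewrite /enorm big1 ?sqrtr0// => i _; rewrite mxE expr0n.
apply/seteqP; split=> [_ [p _ <-]|_ ->] /=.
  by rewrite big1// => i _; rewrite subrr enorm0.
exists [::]; first by split=> //=.
by rewrite /= big_nil.
Qed.


Definition int_dist_fun (x y : Omega) : R :=
  inf [set l | exists g, arclength_joins x y l g].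

Lemma int_dist_funxx (x : Omega) : int_dist_fun x x = 0.
Proof.
rewrite /int_dist_fun; set S := [set _ | _].
have S0 : S 0 by exists (fun=> x); exact: arclength_joins_cst.
have lbS : lbound S 0 by move=> l [g []].
apply/eqP; rewrite eq_le; apply/andP; split.
  by apply: ge_inf => //; exists 0.
by apply: lb_le_inf => //; exists 0.
Qed.

Definition int_dist : distance R Omega := Distance int_dist_funxx.

Definition int_completion := completion int_dist.

Definition int_bdry : set int_completion := bdry (d := int_dist).

Definition bdist (xi : int_completion) : \bar R :=
  ereal_inf [set (cdist xi eta)%:E | eta in int_bdry].

(* A rectifiable curve parametrized by arc length on [0, curve_len], with values
   in Omega except possibly for its end points, which may lie in the internal
   boundary. [curve_trace] is the part of the curve in Omega, for which Euclidean
   length makes sense. Constant curves, of length 0, are allowed. *)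
Record curve := Curve {
  curve_len : R;
  curve_pt :> R -> int_completion;
  curve_trace : R -> Omega;
  curve_len_ge0 : 0 <= curve_len;
  curve_traceE : forall t, 0 < t < curve_len ->
    curve_pt t = embed int_dist (curve_trace t);
  curve_cont : forall t, 0 <= t <= curve_len ->
    cdist (curve_pt s) (curve_pt t)
      @[s --> within [set` `[0, curve_len]] (nbhs t)] --> (0 : R);
  curve_arclength : forall s t, 0 < s -> s <= t -> t < curve_len ->
    elength curve_trace s t = (t - s)%:E }.

Definition joins (g : curve) (xi eta : int_completion) : Prop :=
  g 0 = xi /\ g (curve_len g) = eta.

Definition height (g : curve) : \bar R :=
  ereal_sup [set bdist (g t) | t in [set` `[0, curve_len g]]].

Definition alpha_john (alpha : R) : Prop :=
  exists x0 : Omega, forall x : Omega, exists g : curve,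
    joins g (embed int_dist x) (embed int_dist x0) /\
    forall t, 0 <= t <= curve_len g -> ((alpha * t)%:E <= bdist (g t))%E.

Definition john : Prop :=
  exists alpha : R, 0 < alpha <= 1 /\ alpha_john alpha.

End internal_metric.

Section rho_metric.
Context {R : realType} {n : nat} {Omega : set 'rV[R]_n}.
Variable rho : Omega -> {posnum R}.

Definition rho_dist_fun (x y : Omega) : R :=
  inf [set r | exists l g, arclength_joins x y l g /\
    r = \int[lebesgue_measure]_(t in `[0, l]) (rho (g t))%:num].

Lemma rho_dist_funxx (x : Omega) : rho_dist_fun x x = 0.
Proof.
rewrite /rho_dist_fun; set S := [set _ | _].
have S0 : S 0.
  exists 0, (fun=> x); split; first exact: arclength_joins_cst.
  by rewrite set_itv1 Rintegral_set1.
have lbS : lbound S 0 by move=> r [l [g [_ ->]]]; exact: Rintegral_ge0.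
apply/eqP; rewrite eq_le; apply/andP; split.
  by apply: ge_inf => //; exists 0.
by apply: lb_le_inf => //; exists 0.
Qed.

Definition rho_dist : distance R Omega := Distance rho_dist_funxx.

Definition rho_completion := completion rho_dist.

Definition rho_bdry : set rho_completion := bdry (d := rho_dist).

Definition rho_length (g : curve Omega) : \bar R :=
  (\int[lebesgue_measure]_(t in `]0%R, curve_len g[)
     ((rho (curve_trace g t))%:num)%:E)%E.

Definition is_density : Prop :=
  [/\ continuous (fun x : Omega => (rho x)%:num),
      rho_bdry !=set0,
      forall x_ : nat -> Omega,
        (exists xi : rho_completion, converges_to x_ xi) ->
        exists eta : int_completion Omega, converges_to x_ eta
    & forall x_ : nat -> Omega,
        (exists eta : int_completion Omega, converges_to x_ eta) ->
        forall xi xi' : rho_completion, rho_bdry xi -> rho_bdry xi' ->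
        clusters_at x_ xi -> clusters_at x_ xi' -> xi = xi'].

(* The graph of the map from the [rho]-completion to the internal completion
   extending the identity of Omega; for a density it is an injective map. *)
Definition same_point (xi : rho_completion) (eta : int_completion Omega) :
    Prop :=
  exists x_ : nat -> Omega, converges_to x_ xi /\ converges_to x_ eta.

Definition int_nbhs (eta : int_completion Omega) : set_system Omega :=
  filter_from [set e : R | 0 < e]
    (fun e => [set y | cdist (embed (int_dist Omega) y) eta < e]).

Definition log_ratio (y : Omega) : \bar R :=
  (ln (rho y)%:num / ln (fine (bdist (embed (int_dist Omega) y))))%:E.

Definition i_minus (eta : int_completion Omega) : \bar R :=
  limf_einf log_ratio (int_nbhs eta).

Definition i_plus (eta : int_completion Omega) : \bar R :=
  limf_esup log_ratio (int_nbhs eta).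

Definition int_dimH : set (int_completion Omega) -> \bar R :=
  hausdorff_dim (@cdist _ _ (int_dist Omega)).
Definition int_dimP : set (int_completion Omega) -> \bar R :=
  packing_dim (@cdist _ _ (int_dist Omega)).
Definition rho_dimH : set rho_completion -> \bar R :=
  hausdorff_dim (@cdist _ _ rho_dist).
Definition rho_dimP : set rho_completion -> \bar R :=
  packing_dim (@cdist _ _ rho_dist).

(* { x in the rho-boundary | i x <= beta }, in the internal boundary. *)
Definition sublevel (i : int_completion Omega -> \bar R) (beta : R) :
    set (int_completion Omega) :=
  [set eta | (exists2 xi, rho_bdry xi & same_point xi eta) /\
             (i eta <= beta%:E)%E].

Definition d_minus (beta : R) : \bar R := int_dimH (sublevel i_minus beta).
Definition d_plus (beta : R) : \bar R := int_dimH (sublevel i_plus beta).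
Definition D_minus (beta : R) : \bar R := int_dimP (sublevel i_minus beta).
Definition D_plus (beta : R) : \bar R := int_dimP (sublevel i_plus beta).

Definition rho_bdry_i_minus_gtN1 : set rho_completion :=
  [set xi | rho_bdry xi /\
            exists2 eta, same_point xi eta & ((-1)%:E < i_minus eta)%E].

End rho_metric.

Arguments rho_bdry {R n Omega} rho.
Arguments rho_bdry_i_minus_gtN1 {R n Omega} rho.

Definition sup_quotient (R : realType) (f : R -> \bar R) : \bar R :=
  ereal_sup [set (f beta * ((1 + beta)^-1)%:E)%E | beta in
    [set beta : R | -1 < beta]].

(* Main.v *)
Require Import Defs.
From HB Require Import structures.
From mathcomp Require Import all_boot all_order all_algebra.
From mathcomp Require Import all_classical all_reals all_analysis.
From mathcomp Require Import measurable_realfun lra ring.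

(* The theorem compares d and d_rho through Hölder-type estimates, each valid on
   countably many pieces of the boundary.

   Lower bounds. If i^+(x) < beta then rho >= dist(., boundary)^beta near x. The access
   curve from x to y rises to height d(x,y)^(1+eps) while staying rho-close, hence d-close,
   to x; along a piece of it of length comparable to its height rho is at least
   height^beta up to a constant, so d_rho(x,y) is at least d(x,y)^(1+beta) up to an
   arbitrarily small loss in the exponent.

   Upper bounds. If i^-(x) > beta then rho <= dist(., boundary)^beta near x. Integrating
   along the initial piece of length r of a John curve shows that x is at rho-distance
   O(r^(1+beta)) from a point w_x whose Euclidean distance to the boundary is at least
   alpha r. If w_x and w_x' lie in the same cell of a Euclidean grid of mesh proportional
   to r, the segment joining them gives d_rho(x,x') = O(r^(1+beta)). Since boundedly many
   cells meet a ball of radius r, d-balls of radius r are covered by boundedly many sets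
   of rho-diameter O(r^(1+beta)); counting all the cells instead handles the points with
   i^- = +oo. *)

Set Implicit Arguments.
Unset Strict Implicit.
Unset Printing Implicit Defensive.

Import Order.TTheory GRing.Theory Num.Theory.
Import numFieldNormedType.Exports.

Local Open Scope classical_set_scope.
Local Open Scope ring_scope.

(** * Metric completions *)

(** Dimensions are compared through null sets, so constants, scales and arbitrarily small losses in
    exponents may all depend on the piece of the boundary under study. The obstacle in the upper
    bounds is that two boundary points close for d need not be close for d_rho at the matching
    scale: a short path between w_x and w_x' may run near the boundary, where a bound by a negative
    power of the distance is useless. Only the segment inside a grid cell is safe, hence splitting
    into boundedly many classes instead of a Hölder map. A single exponent does not suffice there
    either, since i^- varies. The boundary is also cut by rationals a < i^-(x) <= b: a gives the
    exponent 1 + a of the estimate, b bounds the dimension of the piece, and (1 + b) / (1 + a) is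
    close enough to 1 for the supremum to control the result. Disjoint balls do not pass through
    such a splitting but separated points do, so packing sums are first converted into counts of
    separated points; the conversion costs only an arbitrarily small increase of the exponent. *)

Record pseudometric (R : realType) (X : Type) (d : X -> X -> R) : Prop :=
  Pseudometric {
    pm_ge0 : forall x y, 0 <= d x y;
    pm_sym : forall x y, d x y = d y x;
    pm_tri : forall y x z, d x z <= d x y + d y z }.

Lemma cvgn0P (R : realType) (u : nat -> R) :
  (forall i, 0 <= u i) ->
  u i @[i --> \oo] --> (0 : R) <->
  forall e, 0 < e -> exists N, forall i, (N <= i)%N -> u i < e.
Proof.
move=> u0; split => [/cvgr0Pnorm_lt h e e0|h].
  have [N _ hN] := h e e0.
  by exists N => i Ni; have := hN i Ni; rewrite /= ger0_norm.
apply/cvgr0Pnorm_lt => e e0; have [N hN] := h e e0.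
by exists N => // i /= Ni; rewrite ger0_norm// hN.
Qed.

Lemma cvgn_leD (R : realType) (u v w : nat -> R) (a b c : R) :
  u i @[i --> \oo] --> a -> v i @[i --> \oo] --> b ->
  w i @[i --> \oo] --> c -> (forall i, u i <= v i + w i) -> a <= b + c.
Proof.
move=> ua vb wc uvw; have vw : v i + w i @[i --> \oo] --> b + c by exact: cvgD.
rewrite -(cvg_lim (@Rhausdorff R) ua) -(cvg_lim (@Rhausdorff R) vw).
by apply: ler_lim; [exact: cvgP ua|exact: cvgP vw|near=> i; exact: uvw].
Unshelve. all: by end_near. Qed.

Lemma cvgn_dist (R : realType) (u v w : nat -> R) (a : R) :
  u i @[i --> \oo] --> a -> w i @[i --> \oo] --> (0 : R) ->
  (forall i, `|v i - u i| <= w i) -> v i @[i --> \oo] --> a.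
Proof.
move=> ua w0 vuw; have -> : v = (fun i => u i + (v i - u i)).
  by apply/funext => i; rewrite addrC subrK.
rewrite -[a]addr0; apply: cvgD => //; apply/norm_cvg0P.
by apply: (squeeze_cvgr _ (cvg_cst 0) w0); near=> i; rewrite normr_ge0 /=.
Unshelve. all: by end_near. Qed.

Section completion_theory.
Context {R : realType} {X : Type} (d : distance R X).
Hypothesis dP : pseudometric d.
Let d0 := pm_ge0 dP.
Let dC := pm_sym dP.
Let dT := pm_tri dP.
Local Notation E := (embed d).

Lemma cauchy_seqP (u : nat -> X) : cauchy_seq d u <->
  forall e, 0 < e -> exists N, forall i j, (N <= i)%N -> (N <= j)%N ->
    d (u i) (u j) < e.
Proof.
split => [h e e0|h e e0].
  have [[A B] /= [[N _ hN] [M _ hM]] AB] := h e e0.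
  exists (maxn N M) => i j; rewrite !geq_max => /andP[Ni _] /andP[_ Mj].
  by apply: (AB (i, j)); split; [exact: hN | exact: hM].
have [N hN] := h e e0.
exists ([set i | (N <= i)%N], [set i | (N <= i)%N]) => /=.
  by split; exists N.
by move=> [i j] /= [Ni Nj]; exact: hN.
Qed.

Lemma rep_cauchy (xi : completion d) : cauchy_seq d (rep xi).
Proof. by rewrite /rep; case: cid2. Qed.

Lemma class_rep (xi : completion d) : class_of xi = cauchy_class d (rep xi).
Proof. by rewrite /rep; case: cid2. Qed.

Lemma completion_eq (xi eta : completion d) : class_of xi = class_of eta -> xi = eta.
Proof.
case: xi eta => [a ha] [b hb] /= ab; subst b.
by rewrite (Prop_irrelevance ha hb).
Qed.

Lemma dist_cauchy_cvg (u v : nat -> X) : cauchy_seq d u -> cauchy_seq d v ->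
  cvgn (fun i => d (u i) (v i)).
Proof.
move=> /cauchy_seqP cu /cauchy_seqP cv.
apply/cauchy_cvgP/cauchy_exP => e e0.
have [N hN] := cu _ (divr_gt0 e0 (ltr0n _ 2)).
have [M hM] := cv _ (divr_gt0 e0 (ltr0n _ 2)).
set i := maxn N M; exists (d (u i) (v i)), i => // j ij.
have Ni : (N <= i)%N := leq_maxl _ _; have Mi : (M <= i)%N := leq_maxr _ _.
have Nj := leq_trans Ni ij; have Mj := leq_trans Mi ij.
rewrite /ball /= ltr_norml.
have h1 := hN _ _ Ni Nj; have h2 := hM _ _ Mi Mj.
have t1 := dT (u j) (u i) (v i); have t2 := dT (v j) (u j) (v i).
have t3 := dT (u i) (u j) (v j); have t4 := dT (v i) (u i) (v j).
rewrite (dC (u j) (u i)) in t3; rewrite (dC (v j) (v i)) in t2.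
by apply/andP; split; lra.
Qed.

Lemma cdist_rep_cvg (xi eta : completion d) :
  d (rep xi i) (rep eta i) @[i --> \oo] --> cdist xi eta.
Proof. by apply: dist_cauchy_cvg; exact: rep_cauchy. Qed.

Lemma cdist_pm : pseudometric (@cdist R X d).
Proof.
split=> [xi eta|xi eta|z xi eta].
- apply: limr_ge; first by apply: dist_cauchy_cvg; exact: rep_cauchy.
  by near=> i; exact: d0.
- by rewrite /cdist; under eq_fun do rewrite dC.
- apply: (cvgn_leD (@cdist_rep_cvg xi eta) (@cdist_rep_cvg xi z)
    (@cdist_rep_cvg z eta)) => i; exact: dT.
Unshelve. all: by end_near. Qed.

Lemma cdistxx (xi : completion d) : cdist xi xi = 0.
Proof.
rewrite /cdist; under eq_fun do rewrite distxx.
by apply: cvg_lim => //; exact: cvg_cst.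
Qed.

(** [rep] picks an arbitrary Cauchy sequence of the class, so the representative of [E x] need not
    be constant; it is only equivalent to the constant sequence. *)
Lemma rep_embed (x : X) : d x (rep (E x) i) @[i --> \oo] --> (0 : R).
Proof.
have : class_of (E x) (rep (E x)).
  rewrite class_rep; split; first exact: rep_cauchy.
  by under eq_fun do rewrite distxx; exact: cvg_cst.
by case.
Qed.

Lemma cdist_embed_cvg (x : X) (xi : completion d) :
  d x (rep xi i) @[i --> \oo] --> cdist (E x) xi.
Proof.
apply: (cvgn_dist (@cdist_rep_cvg (E x) xi) (rep_embed x)) => i.
have t1 := dT x (rep (E x) i) (rep xi i).
have t2 := dT (rep (E x) i) x (rep xi i).
by rewrite (dC (rep (E x) i) x) in t1; rewrite ler_norml; apply/andP; split; lra.
Qed.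

Lemma cdist_embed (x y : X) : cdist (E x) (E y) = d x y.
Proof.
have h1 := @cdist_embed_cvg x (E y); have h2 := rep_embed y.
apply/eqP; rewrite eq_le -[leRHS]addr0 -[X in _ && (_ <= X)]addr0; apply/andP; split.
  apply: (cvgn_leD h1 (cvg_cst _) h2) => i; exact: dT.
apply: (cvgn_leD (cvg_cst _) h1 h2) => i; rewrite (dC y); exact: dT.
Qed.

Lemma cdist_sym (xi eta : completion d) : cdist xi eta = cdist eta xi.
Proof. exact: pm_sym cdist_pm _ _. Qed.

Lemma cdist_ge0 (xi eta : completion d) : 0 <= cdist xi eta.
Proof. exact: pm_ge0 cdist_pm _ _. Qed.

Lemma cdist_tri (z xi eta : completion d) : cdist xi eta <= cdist xi z + cdist z eta.
Proof. exact: pm_tri cdist_pm _ _ _. Qed.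

Lemma converges_toP (u : nat -> X) (xi : completion d) : converges_to u xi <->
  forall e, 0 < e -> exists N, forall i, (N <= i)%N -> cdist (E (u i)) xi < e.
Proof. by apply: cvgn0P => i; exact: cdist_ge0. Qed.

Lemma rep_converges (xi : completion d) : converges_to (rep xi) xi.
Proof.
apply/converges_toP => e e0.
have /cauchy_seqP/(_ _ (divr_gt0 e0 (ltr0n _ 2)))[N hN] := rep_cauchy xi.
exists N => i Ni; apply: (@le_lt_trans _ _ (e / 2)); last by lra.
rewrite -(cvg_lim (@Rhausdorff R) (@cdist_embed_cvg (rep xi i) xi)).
apply: limr_le; first by apply/cvg_ex; eexists; exact: cdist_embed_cvg.
by exists N => // j /= Nj; exact/ltW/hN.
Qed.

Lemma cauchy_converges (u : nat -> X) : cauchy_seq d u ->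
  exists xi : completion d, converges_to u xi.
Proof.
move=> cu; pose xi := Completion (ex_intro2 (cauchy_seq d) _ u cu erefl); exists xi.
have : class_of xi u.
  by split => //; under eq_fun do rewrite distxx; exact: cvg_cst.
rewrite class_rep => -[_ h].
apply/converges_toP => e e0.
have e20 : 0 < e / 2 by lra.
have [N hN] := (cvgn0P (fun i => d0 (rep xi i) (u i))).1 h _ e20.
have [M hM] := (converges_toP _ _).1 (rep_converges xi) _ e20.
exists (maxn N M) => i; rewrite geq_max => /andP[Ni Mi].
have := cdist_tri (E (rep xi i)) (E (u i)) xi.
have := hN _ Ni; have := hM _ Mi; rewrite cdist_embed dC; lra.
Qed.

Lemma cdist_eq0 (xi eta : completion d) : cdist xi eta = 0 -> xi = eta.
Proof.
wlog suff h : xi eta / cdist xi eta = 0 -> class_of xi `<=` class_of eta.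
  move=> e; apply: completion_eq; apply/seteqP; split; apply: h => //.
  by rewrite cdist_sym.
move=> xe v; rewrite !class_rep => -[cv h]; split => //.
have h2 := @cdist_rep_cvg eta xi; rewrite cdist_sym xe in h2.
apply: (cvgn_dist h2 h) => i.
have t1 := dT (rep xi i) (rep eta i) (v i).
have t2 := dT (v i) (rep eta i) (rep xi i).
rewrite (dC (v i) (rep xi i)) in t2.
by rewrite ler_norml; apply/andP; split; lra.
Qed.

Lemma converges_unique (u : nat -> X) (xi eta : completion d) :
  converges_to u xi -> converges_to u eta -> xi = eta.
Proof.
move=> /converges_toP h1 /converges_toP h2; apply: cdist_eq0.
apply/eqP; rewrite eq_le cdist_ge0 andbT; apply/ler_addgt0Pl => e e0.
have [N hN] := h1 _ (divr_gt0 e0 (ltr0n _ 2)).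
have [M hM] := h2 _ (divr_gt0 e0 (ltr0n _ 2)).
have := hN _ (leq_maxl N M); have := hM _ (leq_maxr N M).
by have := cdist_tri (E (u (maxn N M))) xi eta; rewrite (cdist_sym xi (E _)); lra.
Qed.

Lemma converges_cst (x : X) : converges_to (fun=> x) (E x).
Proof. by apply/converges_toP => e e0; exists 0%N => i _; rewrite cdistxx. Qed.

Lemma converges_subseq (u : nat -> X) (xi : completion d) (f : nat -> nat) :
  (forall i, (i <= f i)%N) -> converges_to u xi -> converges_to (u \o f) xi.
Proof.
move=> fi /converges_toP h; apply/converges_toP => e e0.
have [N hN] := h _ e0; exists N => i Ni; apply: hN; exact: leq_trans (fi i).
Qed.

(** The density axioms speak of one sequence at a time. Interleaving lets them compare two sequences
    that have a limit in common in one of the two completions. *)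
Definition interleave (u v : nat -> X) : nat -> X :=
  fun i => if odd i then u i else v i.

Lemma interleave_converges (u v : nat -> X) (xi : completion d) :
  converges_to u xi -> converges_to v xi -> converges_to (interleave u v) xi.
Proof.
move=> /converges_toP h1 /converges_toP h2; apply/converges_toP => e e0.
have [N hN] := h1 _ e0; have [M hM] := h2 _ e0.
exists (maxn N M) => i; rewrite geq_max /interleave => /andP[Ni Mi].
by case: ifP => _; [exact: hN | exact: hM].
Qed.

Lemma interleave_unique (u v : nat -> X) (theta xi eta : completion d) :
  converges_to (interleave u v) theta ->
  converges_to u xi -> converges_to v eta -> theta = xi /\ theta = eta.
Proof.
move=> h hu hv; split; [apply: (@converges_unique (u \o fun i => i.*2.+1))|
    apply: (@converges_unique (v \o fun i => i.*2))].
- have -> : u \o (fun i => i.*2.+1) = interleave u v \o (fun i => i.*2.+1).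
    by apply/funext => i /=; rewrite /interleave /= odd_double.
  by apply: converges_subseq h => i; rewrite -addnn ltnW// ltnS leq_addr.
- by apply: converges_subseq hu => i; rewrite -addnn ltnW// ltnS leq_addr.
- have -> : v \o double = interleave u v \o double.
    by apply/funext => i /=; rewrite /interleave /= odd_double.
  by apply: converges_subseq h => i; rewrite -addnn leq_addr.
- by apply: converges_subseq hv => i; rewrite -addnn leq_addr.
Qed.

End completion_theory.

(** * Hausdorff dimension *)

Lemma powR_le (R : realType) (a b s : R) : 0 <= s -> 0 <= a -> a <= b ->
  a `^ s <= b `^ s.
Proof. by move=> s0 a0 ab; apply: ge0_ler_powR => //; rewrite nnegrE// (le_trans a0). Qed.

(** The measures are defined with covers indexed by [nat], whereas the covers built below are
    indexed by products such as [nat * 'I_N.+1]. Numbers that code no index contribute 0. *)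
Lemma esum_pickle (R : realType) (I : countType) (f : I -> \bar R) :
  (forall i, (0 <= f i)%E) ->
  (\sum_(0 <= m <oo) oapp f 0 (@pickle_inv I m) = \esum_(i in [set: I]) f i)%E.
Proof.
move=> f0; have g0 m : (0 <= oapp f 0 (@pickle_inv I m))%E by case: pickle_inv.
rewrite nneseries_esumT//.
transitivity (\esum_(m in range (@pickle I)) oapp f 0%E (@pickle_inv I m)).
  rewrite [RHS]esum_mkcond; apply: eq_esum => m _; case: ifPn => //.
  case E : (@pickle_inv I m) => [i|//] /negP[]; rewrite inE.
  by exists i => //; have := @pickle_invK I m; rewrite E.
rewrite (reindex_esum setT (range (@pickle I)) (@pickle I)).
  by apply: eq_esum => i _; rewrite /= pickleK_inv.
split.
- by move=> i _; exists i.
- by move=> x y _ _; exact: (pcan_inj pickleK).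
- by move=> _ [i _ <-]; exists i.
Qed.

Lemma esum_pickle_le (R : realType) (I : countType) (e : R) : 0 <= e ->
  (\esum_(i in [set: I]) (e / (2 ^ (pickle i).+1)%:R)%:E <= e%:E)%E.
Proof.
move=> e0; rewrite -esum_pickle; last by move=> i; rewrite lee_fin divr_ge0.
apply: (le_trans _ (epsilon_trick0 xpredT e0)); apply: lee_nneseries => m _.
  by case: pickle_inv => //= i; rewrite lee_fin divr_ge0.
case E : (@pickle_inv I m) => [i|] /=; last by rewrite lee_fin divr_ge0.
by have := @pickle_invK I m; rewrite E /= => ->.
Qed.

Lemma ler_esum_seq (R : realType) (T : choiceType) (B : set T) (f : T -> \bar R)
  (l : seq T) : uniq l -> (forall x, x \in l -> B x) ->
  (\sum_(x <- l) f x <= \esum_(x in B) f x)%E.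
Proof.
move=> ul lB; apply: esum_ge; exists [set` l].
  by split => [|x /=]; [exact: finite_seq|exact: lB].
by rewrite fsbig_seq.
Qed.

Lemma esum_ord_cst (R : realType) (N : nat) (c : \bar R) : (0 <= c)%E ->
  (\esum_(j in [set: 'I_N]) c = (N%:R : R)%:E * c)%E.
Proof.
move=> c0; rewrite esum_fset//; last exact: finite_finset.
rewrite (_ : setT = [set` enum 'I_N]); last first.
  by apply/seteqP; split => // i _ /=; rewrite mem_enum.
rewrite -fsbig_seq ?enum_uniq// big_const_seq count_predT -cardE card_ord.
elim: N => [|k ih]; first by rewrite mul0e.
by rewrite iterS ih -natr1 EFinD ge0_muleDl ?lee_fin// mul1e addeC.
Qed.

Section hausdorff_null.
Context {R : realType} {T : choiceType} (d : T -> T -> R).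
Local Open Scope ereal_scope.

Lemma diam_le U (r : R) : (forall x y, U x -> U y -> (d x y <= r)%R) ->
  diam d U <= r%:E.
Proof. by move=> h; apply: ge_ereal_sup => _ [[x y] [/= Ux Uy] <-]; rewrite lee_fin h. Qed.

Lemma le_diam U x y : U x -> U y -> (d x y)%:E <= diam d U.
Proof. by move=> Ux Uy; apply: ereal_sup_ubound; exists (x, y). Qed.

Lemma diam_pow_ge0 s U : 0 <= diam_pow d s U.
Proof. by rewrite /diam_pow; case: ifP => // _; exact: poweR_ge0. Qed.

(** The gaps in the numbering of [I] are filled with the empty set, which is harmless: its diameter
    is -oo and its [diam_pow] is 0. *)
Lemma hausdorff_premeasure_le_esum (I : countType) (V : I -> set T) s delta A :
  A `<=` \bigcup_i V i -> (forall i, diam d (V i) <= delta%:E) ->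
  hausdorff_premeasure d s delta A <= \esum_(i in [set: I]) diam_pow d s (V i).
Proof.
move=> AV Vd; rewrite -esum_pickle; last by move=> i; exact: diam_pow_ge0.
apply: ereal_inf_lbound; exists (fun m => oapp V set0 (@pickle_inv I m)); last first.
  apply: eq_eseriesr => m _; case: pickle_inv => //=.
  by rewrite /diam_pow eqxx.
split => [x /AV[i _ Vx]|m]; first by exists (pickle i) => //=; rewrite pickleK_inv.
by case: pickle_inv => //=; apply: diam_le.
Qed.

Lemma hausdorff_premeasure_ge0 s delta A : 0 <= hausdorff_premeasure d s delta A.
Proof.
apply: le_ereal_inf_tmp => _ [U _ <-]; apply: nneseries_ge0 => i _ _.
exact: diam_pow_ge0.
Qed.

Lemma hausdorff_measure_eq0 s A :
  (forall delta e : R, (0 < delta)%R -> (0 < e)%R ->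
    hausdorff_premeasure d s delta A <= e%:E) ->
  hausdorff_measure d s A = 0.
Proof.
move=> h; apply/eqP; rewrite eq_le; apply/andP; split.
  apply: ge_ereal_sup => _ [delta /= d0 <-]; apply/lee_addgt0Pr => e e0.
  by rewrite add0e; exact: h.
apply: le_trans (ereal_sup_ubound _); last by exists 1%R; [exact: ltr01|reflexivity].
exact: hausdorff_premeasure_ge0.
Qed.

Lemma hausdorff_measure0_cover s A : hausdorff_measure d s A = 0 ->
  forall delta e : R, (0 < delta)%R -> (0 < e)%R -> exists U : nat -> set T,
    [/\ A `<=` \bigcup_i U i, forall i, diam d (U i) <= delta%:E &
        \sum_(0 <= i <oo) diam_pow d s (U i) <= e%:E].
Proof.
move=> h delta e d0 e0.
have : hausdorff_premeasure d s delta A < e%:E.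
  apply: (@le_lt_trans _ _ 0); last by rewrite lte_fin.
  by rewrite -h; apply: ereal_sup_ubound; exists delta.
by move=> /ereal_inf_lt[_ [U [AU Ud] <-] Ue]; exists U; split => //; exact: ltW.
Qed.

Lemma sub_hausdorff_null s A B : A `<=` B -> hausdorff_measure d s B = 0 ->
  hausdorff_measure d s A = 0.
Proof.
move=> AB B0; apply: hausdorff_measure_eq0 => delta e d0 e0.
have [U [BU Ud Ue]] := hausdorff_measure0_cover B0 d0 e0.
apply: le_trans Ue; apply: ereal_inf_lbound; exists U => //; split => //.
exact: subset_trans BU.
Qed.

Lemma hausdorff_null_bigcup (I : countType) (A : I -> set T) s :
  (forall i, hausdorff_measure d s (A i) = 0) ->
  hausdorff_measure d s (\bigcup_i A i) = 0.
Proof.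
move=> A0; apply: hausdorff_measure_eq0 => delta e d0 e0.
have ei i : (0 < e / (2 ^ (@pickle I i).+1)%:R)%R by rewrite divr_gt0// ltr0n expn_gt0.
have /choice[U hU] i := hausdorff_measure0_cover (A0 i) d0 (ei i).
apply: le_trans (esum_pickle_le I (ltW e0)).
apply: le_trans (@hausdorff_premeasure_le_esum (I * nat)%type
  (fun k => U k.1 k.2) _ _ _ _ _) _.
- move=> x [i _ Ax]; have [/(_ _ Ax)[k _ Ux] _ _] := hU i.
  by exists (i, k).
- by move=> [i k] /=; have [_ + _] := hU i.
rewrite (_ : [set: _] = setT `*`` (fun=> setT)); last by apply/seteqP; split.
rewrite -(@esum_esum _ _ _ _ _ (fun i k => diam_pow d s (U i k))); last first.
  by move=> *; exact: diam_pow_ge0.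
apply: le_esum => i _; have [_ _ h] := hU i.
rewrite -nneseries_esumT// => k; exact: diam_pow_ge0.
Qed.

End hausdorff_null.

(* [A] is a union of [N.+1] sets of diameter at most [r]. *)
Definition small_labels (R : realType) (T : Type) (d : T -> T -> R) (A : set T)
    (N : nat) (r : R) :=
  exists c : T -> 'I_N.+1, forall x y, A x -> A y -> c x = c y -> d x y <= r.

(** The identification of the two completions is the relation [same_point], not a function, and it
    is followed in both directions; images are therefore taken along relations. *)
Definition rel_image (T1 T2 : Type) (S : T1 -> T2 -> Prop) (U : set T1) : set T2 :=
  [set y | exists2 x, U x & S x y].

(* A quantitative form of Hölder continuity of exponent [p] of the relation [S] that
   suffices to compare dimensions: a set of diameter [r] is mapped into a bounded number
   of sets of diameter of order [r^p]. *)
Definition holder_labels (R : realType) (T1 T2 : Type) (d1 : T1 -> T1 -> R)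
    (d2 : T2 -> T2 -> R) (S : T1 -> T2 -> Prop) (A : set T2) (p : R) :=
  exists (N : nat) (C r0 : R), [/\ 0 < C, 0 < r0 &
    forall r (U : set T1), 0 < r < r0 -> (forall x y, U x -> U y -> d1 x y <= r) ->
      small_labels d2 (A `&` rel_image S U) N (C * r `^ p)].

(** * Transfer of Hausdorff null sets *)

Section hausdorff_transfer.
Context {R : realType} {T1 T2 : choiceType} (d1 : T1 -> T1 -> R)
  (d2 : T2 -> T2 -> R) (S : T1 -> T2 -> Prop).
Hypothesis d1xx : forall x, d1 x x = 0.
Hypothesis d2xx : forall x, d2 x x = 0.

Lemma diam_pow_le_powR (V : set T2) (t r : R) : 0 <= t -> 0 <= r ->
  (forall x y, V x -> V y -> d2 x y <= r) ->
  (diam_pow d2 t V <= (r `^ t)%:E)%E.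
Proof.
move=> t0 r0 h; rewrite /diam_pow; case: ifPn => [_|/set0P[x Vx]].
  by rewrite lee_fin powR_ge0.
have hd : (diam d2 V <= r%:E)%E by exact: diam_le.
have hd0 : (0 <= diam d2 V)%E by have := le_diam d2 Vx Vx; rewrite d2xx.
by rewrite -poweR_EFin gt0_ler_poweR// in_itv/= ?hd0 ?lee_fin ?r0 leey.
Qed.

(** Hölder estimates are stated at positive scales only, but a covering set may be empty or have
    diameter 0. Such a set receives a radius whose power is at most the error [e]; otherwise the
    radius is the diameter, and [delta <= 1] allows the exponent to grow from [s] to [s']. *)
Lemma exists_radius (U : set T1) (s s' delta e : R) : 0 <= s -> s <= s' -> 0 < s' ->
  0 < delta <= 1 -> 0 < e -> (diam d1 U <= delta%:E)%E ->
  exists r : R, [/\ 0 < r <= delta, forall x y, U x -> U y -> d1 x y <= r &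
    ((r `^ s')%:E <= diam_pow d1 s U + e%:E)%E].
Proof.
move=> s0 ss' s'0 /andP[de0 de1] e0 Ud.
pose eta := Num.min delta (e `^ s'^-1).
have eta0 : 0 < eta by rewrite lt_min de0 powR_gt0.
have etae : eta `^ s' <= e.
  rewrite (_ : e = (e `^ s'^-1) `^ s'); last first.
    by rewrite -powRrM mulVf ?gt_eqF// powRr1// ltW.
  by apply: powR_le; rewrite ?ge_min ?lexx ?orbT// ltW.
have etad : eta <= delta by rewrite ge_min lexx.
have [->|/set0P[x Ux]] := eqVneq U set0.
  exists eta; split => //; first by rewrite eta0.
  by rewrite /diam_pow eqxx add0e lee_fin.
have hd0 : (0 <= diam d1 U)%E by have := le_diam d1 Ux Ux; rewrite d1xx.
have Dfin : diam d1 U \is a fin_num.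
  by rewrite ge0_fin_numE// (le_lt_trans Ud)// ltry.
pose D := fine (diam d1 U).
have DE : diam d1 U = D%:E by rewrite fineK.
have D0 : 0 <= D by rewrite -lee_fin -DE.
have DU y z : U y -> U z -> d1 y z <= D.
  by move=> Uy Uz; rewrite -lee_fin -DE; exact: le_diam.
have Un0 : U == set0 = false by apply/negbTE/set0P; exists x.
have Dd : D <= delta by rewrite -lee_fin -DE.
rewrite /diam_pow Un0 DE poweR_EFin.
have [D1|D1] := ltP 0 D.
  exists D; split => //; first by rewrite D1.
  rewrite -EFinD lee_fin; apply: ler_wpDr; first exact: ltW.
  by apply: ger_powR => //; rewrite D1 (le_trans Dd).
exists eta; split => //; first by rewrite eta0.
  by move=> y z Uy Uz; rewrite (le_trans (DU _ _ Uy Uz))// (le_trans D1)// ltW.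
by rewrite -EFinD lee_fin ler_wpDl// powR_ge0.
Qed.

(** A covering set of radius r is replaced by [N.+1] sets of diameter at most C r^p, whose
    contribution is at most [K] r^(t p), hence at most [K] r^s up to the error of
    [exists_radius]. *)
Lemma hausdorff_null_transfer (A1 : set T1) (A2 : set T2) (p s t : R) :
  0 <= s -> 0 < t -> s <= t * p -> 0 < p -> holder_labels d1 d2 S A2 p ->
  hausdorff_measure d1 s A1 = 0 -> A2 `<=` rel_image S A1 ->
  hausdorff_measure d2 t A2 = 0.
Proof.
move=> s0 t0 stp p0 [N [C [r0 [C0 r00 hl]]]] H0 A21.
apply: hausdorff_measure_eq0 => delta e de0 e0.
have tp0 : 0 < t * p by rewrite mulr_gt0.
pose K := (N.+1%:R * C `^ t) : R.
have K0 : 0 < K by rewrite mulr_gt0// powR_gt0.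
(* One half pays for the given cover, the other for the errors made in choosing radii. *)
pose e1 := e / K / 2.
have e10 : 0 < e1 by rewrite !divr_gt0.
pose q := (delta / C) `^ p^-1.
have q0 : 0 < q by rewrite powR_gt0// divr_gt0.
(* The three bounds serve in turn to raise the exponent, to stay below the scale [r0], and to keep C
   r^p below [delta]. *)
pose de1 := Num.min 1 (Num.min (r0 / 2) q).
have de10 : 0 < de1 <= 1.
  by rewrite ge_min lexx andbT !lt_min ltr01 q0 divr_gt0.
have de1r0 : de1 < r0.
  apply: (@le_lt_trans _ _ (r0 / 2)); first by rewrite !ge_min lexx orbT.
  by lra.
have de1q : C * de1 `^ p <= delta.
  rewrite mulrC -ler_pdivlMr//.
  rewrite (_ : delta / C = q `^ p); last first.
    by rewrite -powRrM mulVf ?gt_eqF// powRr1// divr_ge0// ltW.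
  by apply: powR_le; [exact: ltW|exact: ltW (andP de10).1|rewrite !ge_min lexx !orbT].
have [U [A1U Ud Ue]] := hausdorff_measure0_cover H0 (andP de10).1 e10.
have e1i i : 0 < e1 / (2 ^ i.+1)%:R by rewrite divr_gt0// ltr0n expn_gt0.
have /choice[r hr] i := exists_radius s0 stp tp0 de10 (e1i i) (Ud i).
have /choice[c hc] : forall i, exists c : T2 -> 'I_N.+1, forall x y,
    (A2 `&` rel_image S (U i)) x -> (A2 `&` rel_image S (U i)) y -> c x = c y ->
    d2 x y <= C * r i `^ p.
  move=> i; have [/andP[ri0 rid] rU _] := hr i.
  by apply: hl => //; rewrite ri0 (le_lt_trans rid).
pose V (k : nat * 'I_N.+1) := (A2 `&` rel_image S (U k.1)) `&` [set y | c k.1 y = k.2].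
have Vr k x y : V k x -> V k y -> d2 x y <= C * r k.1 `^ p.
  by move=> [h1 /= c1] [h2 /= c2]; apply: hc => //; rewrite c1 c2.
have rp i : 0 <= r i `^ p <= de1 `^ p.
  have [/andP[ri0 rid] _ _] := hr i.
  by rewrite powR_ge0 powR_le// ltW.
apply: le_trans (@hausdorff_premeasure_le_esum _ _ d2 _ V _ _ _ _ _) _.
- move=> y A2y; have [x A1x Sxy] := A21 _ A2y; have [i _ Ux] := A1U _ A1x.
  by exists (i, c i y) => //; split => //; split => //; exists x.
- move=> k; apply: diam_le => x y Vx Vy; apply: le_trans (Vr _ _ _ Vx Vy) _.
  apply: le_trans de1q; apply: ler_wpM2l; [exact: ltW|exact: (andP (rp _)).2].
rewrite (_ : [set: _] = setT `*`` (fun=> setT)); last by apply/seteqP; split.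
rewrite -(@esum_esum _ _ _ _ _ (fun i j => diam_pow d2 t (V (i, j)))); last first.
  by move=> *; exact: diam_pow_ge0.
apply: (@le_trans _ _ (\esum_(i in [set: nat])
  (K%:E * (diam_pow d1 s (U i) + (e1 / (2 ^ i.+1)%:R)%:E)))%E).
  apply: le_esum => i _.
  apply: (@le_trans _ _ (\esum_(j in [set: 'I_N.+1]) ((C * r i `^ p) `^ t)%:E)%E).
    apply: le_esum => j _; apply: diam_pow_le_powR; first exact: ltW.
      by rewrite mulr_ge0 ?powR_ge0// ltW.
    by move=> x y; exact: (Vr (i, j)).
  rewrite esum_ord_cst; last by rewrite lee_fin powR_ge0.
  rewrite /K EFinM -muleA; apply: lee_wpmul2l; first by rewrite lee_fin.
  rewrite powRM ?powR_ge0//; last exact: ltW.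
  rewrite EFinM; apply: lee_wpmul2l.
    by rewrite lee_fin powR_ge0.
  by rewrite -powRrM mulrC; have [_ _] := hr i.
rewrite -nneseries_esumT; last first.
  move=> i; apply: mule_ge0; first by rewrite lee_fin ltW.
  by rewrite adde_ge0 ?diam_pow_ge0// lee_fin ltW.
rewrite nneseriesZl; last first.
  by move=> i _; rewrite adde_ge0 ?diam_pow_ge0// lee_fin ltW.
have := @epsilon_trick _ (fun i => diam_pow d1 s (U i)) e1 xpredT
  (fun i => diam_pow_ge0 _ _ _) (ltW e10).
move=> h; apply: (@le_trans _ _ (K%:E * (e1%:E + e1%:E))%E).
  apply: lee_wpmul2l; first by rewrite lee_fin ltW.
  apply: le_trans h _; apply: leeD => //.
rewrite -EFinD -EFinM lee_fin /e1; have Kn := lt0r_neq0 K0.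
by rewrite le_eqVlt; apply/orP; left; apply/eqP; field.
Qed.

(** Box counting: a cover by K r^(-a) sets of diameter r has sum at most K r^(t - a), which tends to
    0 with r. *)
Lemma hausdorff_null_labels (A : set T2) (K a t r0 : R) : 0 < K -> 0 <= a -> a < t ->
  0 < r0 ->
  (forall r, 0 < r < r0 -> exists2 N : nat, N.+1%:R <= K * r `^ (- a) &
     small_labels d2 A N r) ->
  hausdorff_measure d2 t A = 0.
Proof.
move=> K0 a0 at_ r00 h; apply: hausdorff_measure_eq0 => delta e de0 e0.
have ta : 0 < t - a by lra.
pose q := (e / K) `^ (t - a)^-1.
have q0 : 0 < q by rewrite powR_gt0// divr_gt0.
pose r := Num.min (Num.min (r0 / 2) delta) q.
have r_gt0 : 0 < r by rewrite !lt_min q0 de0 divr_gt0.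
have rr0 : r < r0.
  by apply: (@le_lt_trans _ _ (r0 / 2)); [rewrite !ge_min lexx|lra].
have [N NK [c hc]] := h r (introT andP (conj r_gt0 rr0)).
apply: le_trans (@hausdorff_premeasure_le_esum _ _ d2 _
  (fun j : 'I_N.+1 => A `&` [set y | c y = j]) _ _ _ _ _) _.
- by move=> y Ay; exists (c y).
- move=> j; apply: diam_le => x y [Ax /= cx] [Ay /= cy].
  by apply: (@le_trans _ _ r); [apply: hc; rewrite ?cx|rewrite !ge_min lexx !orbT].
apply: (@le_trans _ _ (\esum_(j in [set: 'I_N.+1]) (r `^ t)%:E)%E).
  apply: le_esum => j _; apply: diam_pow_le_powR; [lra|exact: ltW|].
  by move=> x y [Ax /= cx] [Ay /= cy]; apply: hc; rewrite ?cx.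
rewrite esum_ord_cst; last by rewrite lee_fin powR_ge0.
rewrite -EFinM lee_fin.
apply: (@le_trans _ _ (K * r `^ (- a) * r `^ t)).
  by rewrite ler_wpM2r// powR_ge0.
rewrite -mulrA -powRD; last by rewrite (gt_eqF r_gt0) implybT.
rewrite mulrC -ler_pdivlMr//.
rewrite (_ : e / K = q `^ (t - a)); last first.
  by rewrite -powRrM mulVf ?gt_eqF// powRr1// divr_ge0// ltW.
by rewrite addrC; apply: powR_le; [exact: ltW..|rewrite !ge_min lexx !orbT].
Qed.

End hausdorff_transfer.

(** * Packing dimension *)

Lemma powRV (R : realType) (a s : R) : 0 <= a -> (a^-1) `^ s = (a `^ s)^-1.
Proof. by move=> a0; rewrite -powR_inv1// powRAC powR_inv1// powR_ge0. Qed.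

Section packing_null.
Context {R : realType} {T : choiceType} (d : T -> T -> R).
Local Open Scope ereal_scope.

Lemma packing_presup_ge0 s eps A : 0 <= packing_presup d s eps A.
Proof.
apply: ereal_sup_ubound => /=; exists set0; last by rewrite esum_set0.
by split => //; apply/trivIsetP.
Qed.

Lemma packing_presup_le s eps eps' A : (eps <= eps')%R ->
  packing_presup d s eps A <= packing_presup d s eps' A.
Proof.
move=> ee; apply: ereal_sup_le => _ [B [hB tB] <-]; exists B => //; split => // b Bb.
by have [Ab /andP[b0 be]] := hB b Bb; rewrite b0 (le_trans be ee).
Qed.

(** The limit is an infimum because the supremum over packings is monotone in [eps]; the upper end 1
    of the interval is arbitrary. *)
Lemma packing_premeasure_inf s A :
  packing_premeasure d s A = ereal_inf [set packing_presup d s eps A | eps in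
    [set` `]0%R, 1%R[%R]].
Proof.
apply/cvg_lim => //; apply: (@nondecreasing_at_right_cvge _ _ _ (BLeft 1%R)).
  by rewrite bnd_simp.
by move=> x y _ _ xy; exact: packing_presup_le.
Qed.

Lemma packing_premeasure_ge0 s A : 0 <= packing_premeasure d s A.
Proof.
rewrite packing_premeasure_inf; apply: le_ereal_inf_tmp => _ [eps _ <-].
exact: packing_presup_ge0.
Qed.

Lemma packing_premeasure_eq0 s A :
  (forall e : R, (0 < e)%R -> exists2 eps : R, (0 < eps)%R &
    packing_presup d s eps A <= e%:E) ->
  packing_premeasure d s A = 0.
Proof.
move=> h; apply/eqP; rewrite eq_le packing_premeasure_ge0 andbT.
apply/lee_addgt0Pr => e e0; rewrite add0e packing_premeasure_inf.
have [eps eps0 he] := h e e0.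
apply: (@le_trans _ _ (packing_presup d s (Num.min eps 2^-1)%R A)).
  apply: ereal_inf_lbound; exists (Num.min eps 2^-1)%R => //=.
  rewrite in_itv/= lt_min eps0 invr_gt0 ltr0n/= gt_min; apply/orP; right; lra.
by apply: le_trans he; apply: packing_presup_le; rewrite ge_min lexx.
Qed.

Lemma packing_measure_ge0 s A : 0 <= packing_measure d s A.
Proof.
apply: le_ereal_inf_tmp => _ [V _ <-]; apply: nneseries_ge0 => i _ _.
exact: packing_premeasure_ge0.
Qed.

(** Only boundedness of the packing sums at one scale is extracted. It already bounds the number of
    separated points, and nullity is regained by raising the exponent. *)
Lemma packing_measure0_cover s A : packing_measure d s A = 0 ->
  exists V : nat -> set T, A `<=` \bigcup_i V i /\
    forall i, exists2 eps : R, (0 < eps)%R & packing_presup d s eps (V i) <= 1.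
Proof.
move=> h; have : packing_measure d s A < 1 by rewrite h.
move=> /ereal_inf_lt[_ [V AV <-] V1]; exists V; split => // i.
have : packing_premeasure d s (V i) < 1.
  apply: le_lt_trans V1.
  rewrite nneseries_esumT; last by move=> n; exact: packing_premeasure_ge0.
  have := @ler_esum_seq _ _ setT (fun i => packing_premeasure d s (V i)) [:: i].
  by rewrite big_seq1; apply.
rewrite packing_premeasure_inf => /ereal_inf_lt[_ [eps /= epsI <-] he].
by move: epsI; rewrite in_itv/= => /andP[e0 _]; exists eps => //; exact: ltW.
Qed.

Lemma packing_premeasure_set0 s : packing_premeasure d s set0 = 0.
Proof.
apply: packing_premeasure_eq0 => e e0; exists 1%R => //.
apply: ge_ereal_sup => _ [B [hB _] <-].
rewrite (_ : B = set0) ?esum_set0 ?lee_fin ?ltW//.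
by apply/seteqP; split => // b /hB[].
Qed.

Lemma packing_premeasure_null_bigcup (I : countType) s (V : I -> set T) A :
  A `<=` \bigcup_i V i -> (forall i, packing_premeasure d s (V i) = 0) ->
  packing_measure d s A = 0.
Proof.
move=> AV V0; apply/eqP; rewrite eq_le packing_measure_ge0 andbT.
apply: ereal_inf_lbound; exists (fun m => oapp V set0 (@pickle_inv I m)).
  by move=> x /AV[i _ Vx]; exists (pickle i) => //=; rewrite pickleK_inv.
apply: eseries0 => m _ _; case: pickle_inv => //=.
exact: packing_premeasure_set0.
Qed.

(** Formally stronger than packing measure zero, whose covers only have small total premeasure. In
    this form countable unions involve no epsilon, and the transfer below produces exactly such
    covers. *)
Definition packing_null s A := exists V : nat -> set T,
  A `<=` \bigcup_i V i /\ forall i, packing_premeasure d s (V i) = 0.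

Lemma packing_null_measure s A : packing_null s A -> packing_measure d s A = 0.
Proof. by move=> [V [AV V0]]; exact: packing_premeasure_null_bigcup AV V0. Qed.

Lemma packing_null_bigcup (I : countType) (A : I -> set T) s :
  (forall i, packing_null s (A i)) -> packing_null s (\bigcup_i A i).
Proof.
move=> /choice[V hV].
exists (fun m => oapp (fun k : I * nat => V k.1 k.2) set0 (@pickle_inv (I * nat)%type m)).
split=> [x [i _ Aix]|m].
  have [k _ Vx] := (hV i).1 x Aix.
  by exists (pickle (i, k)) => //=; rewrite pickleK_inv.
case: pickle_inv => [[i k]|] /=; first exact: (hV i).2.
exact: packing_premeasure_set0.
Qed.

Lemma sub_packing_null s A B : A `<=` B -> packing_null s B -> packing_null s A.
Proof. by move=> AB [V [BV V0]]; exists V; split => //; exact: subset_trans BV. Qed.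

End packing_null.

(** * Separated families and packing sums *)

Definition separated_seq (R : realType) (T : Type) (d : T -> T -> R) (r : R) (s : seq T) :=
  pairwise (fun x y => r <= d x y) s.

(** Pigeonhole: equal labels would force a distance at most [r], below the separation [r'], so
    labels are injective on the sequence. *)
Lemma small_labels_separated (R : realType) (T : choiceType) (d : T -> T -> R) A N r r'
  (s : seq T) : small_labels d A N r -> r < r' ->
  separated_seq d r' s -> (forall x, x \in s -> A x) -> (size s <= N.+1)%N.
Proof.
move=> [c hc] rr' ss sA; have u : uniq (map c s).
  rewrite uniq_pairwise pairwise_map.
  apply: (@sub_in_pairwise _ [pred x | x \in s] _ _ _ s _ ss); last exact/allP.
  move=> x y /= xs ys rxy; apply/eqP => cxy.
  by have := hc x y (sA _ xs) (sA _ ys) cxy; lra.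
rewrite -(size_map c) -(card_uniqP u).
by have := max_card (mem (map c s)); rewrite card_ord.
Qed.

Lemma separated_in (R : realType) (T : eqType) (d : T -> T -> R) r (s : seq T) x y :
  (forall x y, d x y = d y x) -> separated_seq d r s -> x \in s -> y \in s ->
  x != y -> r <= d x y.
Proof.
move=> dC; elim: s => //= z s ih; rewrite /separated_seq /= => /andP[/allP hz hs].
rewrite !inE => /orP[/eqP->|xs] /orP[/eqP->|ys]; first by rewrite eqxx.
- by move=> _; exact: hz.
- by move=> _; rewrite dC; exact: hz.
- exact: ih.
Qed.

(** Greedy selection: a point is kept when its image is far from the images of those already kept.
    Separation is measured through [f] because the points live in one space and the packing is to be
    built in the other. *)
Lemma separated_net (R : realType) (T : Type) (U : choiceType) (d : T -> T -> R)
  (f : U -> T) (r : R) (s : seq U) : (forall x y, d x y = d y x) ->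
  exists t, [/\ {subset t <= s}, separated_seq (fun x y => d (f x) (f y)) r t &
    forall x, x \in s -> d (f x) (f x) < r -> has (fun y => d (f x) (f y) < r) t].
Proof.
move=> dC; elim: s => [|x s [t [ts st ht]]]; first by exists [::].
have [/hasP[y yt xy]|/hasPn h] := boolP (has (fun y => d (f x) (f y) < r) t).
  exists t; split => // [z /ts zs|z]; first by rewrite inE zs orbT.
  by rewrite inE => /orP[/eqP-> _|zs]; [apply/hasP; exists y|exact: ht].
exists (x :: t); split => [z||z].
- by rewrite !inE => /orP[->//|/ts->]; rewrite orbT.
- rewrite /separated_seq /= -/(separated_seq _ _ _) st andbT; apply/allP => y yt.
  by rewrite leNgt h.
- rewrite inE => /orP[/eqP->|zs] zz /=; first by rewrite zz.
  by rewrite ht// orbT.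
Qed.

(** Double counting: each element of [s] is charged to some element of [t], and each of these is
    charged at most [N] times. *)
Lemma size_le_sum_count (U : Type) (e : U -> U -> bool) (s t : seq U) N :
  all (fun x => has (e x) t) s -> (forall y, (count (fun x => e x y) s <= N)%N) ->
  (size s <= N * size t)%N.
Proof.
move=> /all_filterP h hN; rewrite -h size_filter.
elim: t {h} => [|y t ih] /=; first by rewrite (eq_count (a2 := pred0)) ?count_pred0.
rewrite mulnS.
apply: leq_trans (leq_add (hN y) ih).
by rewrite -count_predUI leq_addr.
Qed.

(** A quantitative form of the statement that the upper box dimension of [A] is at most [a]. *)
Definition few_separated (R : realType) (T : choiceType) (d : T -> T -> R) (A : set T)
    (a K r0 : R) :=
  forall r (s : seq T), 0 < r < r0 -> separated_seq d r s ->
    (forall x, x \in s -> A x) -> (size s)%:R <= K * r `^ (- a).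

Lemma few_separated_labels (R : realType) (T : choiceType) (d : T -> T -> R) (A : set T)
    (K a r0 : R) : 0 < K -> 0 <= a ->
  (forall r, 0 < r < r0 -> exists2 N : nat, N.+1%:R <= K * r `^ (- a) &
     small_labels d A N r) ->
  few_separated d A a (K * 2 `^ a) r0.
Proof.
move=> K0 a0 h r s /andP[r_gt0 rr0] ss sA.
have [|N hN lN] := h (r / 2); first by apply/andP; split; lra.
have rr : r / 2 < r by lra.
have := small_labels_separated lN rr ss sA; rewrite -(ler_nat R) => /le_trans; apply.
apply: le_trans hN _; rewrite -mulrA ler_pM2l//.
rewrite powRM ?invr_ge0//; last exact: ltW.
by rewrite mulrC -powR_inv1// -powRrM mulN1r opprK.
Qed.

Section dyadic.
Context {R : realType}.

Lemma dyadic_ex (r : R) : 0 < r -> exists n, 2^-1 ^+ n.+1 < r.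
Proof.
move=> r0; have h : (2^-1 : R) ^+ n @[n --> \oo] --> (0 : R).
  by apply: cvg_expr; rewrite ger0_norm; lra.
have [N _ hN] := (cvgr0Pnorm_lt _).1 h r r0.
exists N; have := hN N.+1 (leqnSn N); rewrite /= ger0_norm// exprn_ge0//; lra.
Qed.

Lemma dyadic_scale (r : R) : 0 < r -> r <= 1 ->
  exists n, 2^-1 ^+ n.+1 < r <= 2^-1 ^+ n.
Proof.
move=> r0 r1; case: (ex_minnP (dyadic_ex r0)) => n hn hmin.
exists n; rewrite hn /=; case: n hn hmin => [|n] hn hmin; first by rewrite expr0.
by rewrite leNgt; apply/negP => /hmin; rewrite ltnn.
Qed.

End dyadic.

Section packing_count.
Context {R : realType} {T : choiceType} (d : T -> T -> R).
Hypothesis dP : pseudometric d.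
Hypothesis dxx : forall x, d x x = 0.

(** Otherwise the centre of the second ball would belong to both balls. *)
Lemma packing_separated eps A (B : set (T * R)) (b b' : T * R) : packing d eps A B ->
  B b -> B b' -> b != b' -> b.2 <= d b.1 b'.1.
Proof.
move=> [hB /trivIsetP tB] Bb Bb' bb'; rewrite leNgt; apply/negP => h.
have := tB _ _ Bb Bb' bb'; move/seteqP => -[/(_ b'.1) + _]; apply; split.
  by rewrite /dball /= (pm_sym dP).
by rewrite /dball /= dxx; have [_ /andP[]] := hB _ Bb'.
Qed.

Lemma two_powR_lt1 (x : R) : x < 0 -> 2 `^ x < 1.
Proof.
move=> x0; rewrite /powR pnatr_eq0/= -[ltRHS]expR0 ltr_expR.
by rewrite nmulr_rlt0//; apply: ln_gt0; rewrite ltr1n.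
Qed.

Lemma geometric_tail (q : R) (J M : nat) : 0 <= q -> q < 1 ->
  \sum_(j < M | (J <= j)%N) q ^+ j <= q ^+ J / (1 - q).
Proof.
move=> q0 q1; have q1' : 0 < 1 - q by lra.
(* With truncated subtraction the closed formula also holds for [M <= J], where both sides
   vanish. *)
suff -> : \sum_(j < M | (J <= j)%N) q ^+ j = q ^+ J * (1 - q ^+ (M - J)) / (1 - q).
  rewrite ler_pM2r ?invr_gt0// ler_piMr ?exprn_ge0// gerBl exprn_ge0//.
elim: M => [|M ih]; first by rewrite big_ord0 sub0n expr0 subrr mulr0 mul0r.
rewrite big_mkcond big_ord_recr /= -big_mkcond /= ih.
have [JM|MJ] := leqP J M.
  rewrite subSn// exprSr -{2}(subnKC JM) exprD.
  by field; exact: lt0r_neq0.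
have -> : (M.+1 - J = 0)%N by apply/eqP; rewrite subn_eq0.
by rewrite (_ : (M - J = 0)%N) ?addr0//; apply/eqP; rewrite subn_eq0 ltnW.
Qed.

(** The balls are sorted by dyadic size. Those with radius in ]2^(-j-1), 2^(-j)] have centres
    separated by 2^(-j-1), so there are at most K 2^(a (j+1)) of them, each contributing at most
    2^(-j t). What remains is the tail from [J] of a geometric series of ratio 2^(a-t) < 1. *)
Lemma packing_sum_le (A : set T) (a t K r0 : R) (J : nat) (B : set (T * R)) (s : seq (T * R)) :
  0 <= K -> 0 <= a -> a < t -> 0 < r0 -> few_separated d A a K r0 ->
  2^-1 ^+ J < r0 ->
  packing d (2^-1 ^+ J) A B -> uniq s -> (forall b, b \in s -> B b) ->
  \sum_(b <- s) b.2 `^ t <=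
    K * 2 `^ a * ((2 `^ (a - t)) ^+ J / (1 - 2 `^ (a - t))).
Proof.
move=> K0 a0 at_ r00 few Jr pB us sB.
have h2 : 0 <= (2^-1 : R) by lra.
have h20 n : 0 < (2^-1 : R) ^+ n by rewrite exprn_gt0//; lra.
have hJ n m : (n <= m)%N -> (2^-1 : R) ^+ m <= 2^-1 ^+ n.
  by move=> nm; apply: ler_wiXn2l => //; lra.
have hb b : b \in s -> 0 < b.2 <= 2^-1 ^+ J by move=> /sB Bb; exact: (pB.1 _ Bb).2.
have /choice[sc hsc] : forall b : T * R, exists n, b \in s -> 2^-1 ^+ n.+1 < b.2 <= 2^-1 ^+ n.
  move=> b; have [bs|_] := boolP (b \in s); last by exists 0%N.
  have /andP[b0 bJ] := hb _ bs.
  have [|n hn] := dyadic_scale b0; last by exists n.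
  by apply: le_trans bJ _; rewrite -[leRHS](expr0 2^-1); exact: hJ.
pose M := (\max_(b <- s) sc b).+1.
have scM b : b \in s -> (sc b < M)%N by move=> bs; rewrite ltnS; exact: leq_bigmax_seq.
have scJ b : b \in s -> (J <= (sc b))%N.
  move=> bs; rewrite leqNgt; apply/negP => lt.
  have /andP[h _] := hsc _ bs; have /andP[_ h'] := hb _ bs.
  by have := hJ _ _ lt; lra.
have -> : \sum_(b <- s) b.2 `^ t =
    \sum_(j < M | (J <= j)%N) \sum_(b <- s | sc b == j) b.2 `^ t.
  rewrite big_seq (partition_big (fun b => inord (sc b) : 'I_M) (fun j : 'I_M => (J <= j)%N)).
    apply: eq_bigr => j Jj; rewrite big_seq_cond [RHS]big_seq_cond.
    rewrite [LHS]big_mkcondr [RHS]big_mkcondr /=.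
    rewrite [LHS]big_seq_cond [RHS]big_seq_cond; apply: eq_bigr => b /andP[bs _].
    by rewrite bs /= -val_eqE /= inordK// scM.
  by move=> b bs; rewrite inordK ?scJ// scM.
apply: (@le_trans _ _ (\sum_(j < M | (J <= j)%N) K * 2 `^ a * (2 `^ (a - t)) ^+ j)).
  apply: ler_sum => j Jj.
  set l := [seq b <- s | sc b == j].
  have lE b : b \in l -> b \in s /\ sc b = j :> nat.
    by rewrite mem_filter => /andP[/eqP ? ?].
  have sepl : separated_seq d (2^-1 ^+ j.+1) [seq b.1 | b <- l].
    rewrite /separated_seq pairwise_map.
    have ul : uniq l by exact: filter_uniq.
    rewrite uniq_pairwise in ul.
    apply: (@sub_in_pairwise _ [pred x | x \in l] _ _ _ l _ ul); last exact/allP.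
    move=> b b' /= /lE[bs bj] /lE[bs' bj'] bb'.
    have /andP[h _] := hsc _ bs; rewrite bj in h.
    apply: (le_trans (ltW h)).
    exact: (packing_separated pB (sB _ bs) (sB _ bs') bb').
  have jr : 0 < (2^-1 : R) ^+ j.+1 < r0.
    by rewrite h20 (le_lt_trans _ Jr)// hJ// (leq_trans Jj).
  have szl : (size l)%:R <= K * (2^-1 ^+ j.+1) `^ (- a).
    rewrite -(size_map fst); apply: (few _ _ jr sepl) => x /mapP[b /lE[bs _] ->].
    by have [] := pB.1 _ (sB _ bs).
  apply: (@le_trans _ _ (\sum_(b <- l) (2^-1 ^+ j) `^ t)).
    rewrite -big_filter -/l big_seq [leRHS]big_seq; apply: ler_sum => b /lE[bs bj].
    have /andP[h h'] := hsc _ bs; rewrite bj in h h'.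
    apply: powR_le => //; last by apply: le_trans (ltW h); exact: ltW.
    lra.
  rewrite big_const_seq count_predT iter_addr_0 -[leLHS]mulr_natl.
  apply: (@le_trans _ _ (K * (2^-1 ^+ j.+1) `^ (- a) * (2^-1 ^+ j) `^ t)).
    by rewrite ler_wpM2r// powR_ge0.
  rewrite -!mulrA le_eqVlt; apply/orP; left; apply/eqP; congr (K * _).
  have E n x : ((2^-1 : R) ^+ n) `^ x = 2 `^ (- (n%:R * x)).
    rewrite exprVn -powR_inv1 ?exprn_ge0// -powR_mulrn// -!powRrM; congr (_ `^ _).
    by rewrite mulN1r mulrN.
  rewrite !E -powR_mulrn ?powR_ge0// -powRrM -!powRD ?pnatr_eq0 ?implybT//.
  congr (_ `^ _); rewrite -natr1; ring.
rewrite -mulr_sumr ler_wpM2l ?mulr_ge0 ?powR_ge0//.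
apply: geometric_tail; first exact: powR_ge0.
by apply: two_powR_lt1; lra.
Qed.

Lemma packing_premeasure_few (A : set T) (a t K r0 : R) :
  0 <= K -> 0 <= a -> a < t -> 0 < r0 -> few_separated d A a K r0 ->
  packing_premeasure d t A = 0%E.
Proof.
move=> K0 a0 at_ r00 few.
pose q : R := 2 `^ (a - t).
have q0 : 0 <= q by exact: powR_ge0.
have q1 : q < 1 by apply: two_powR_lt1; lra.
have q1' : 0 < 1 - q by lra.
apply: packing_premeasure_eq0 => e e0.
have c1 : K * 2 `^ a * (q ^+ n / (1 - q)) @[n --> \oo] --> (0 : R).
  rewrite -(mulr0 (K * 2 `^ a)) -[in X in _ --> X](mul0r (1 - q)^-1).
  apply: cvgM; first exact: cvg_cst.
  apply: cvgM; last exact: cvg_cst.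
  by apply: cvg_expr; rewrite ger0_norm.
have c2 : (2^-1 : R) ^+ n @[n --> \oo] --> (0 : R).
  by apply: cvg_expr; rewrite ger0_norm; lra.
have [N1 _ h1] := (cvgr0Pnorm_lt _).1 c1 e e0.
have [N2 _ h2] := (cvgr0Pnorm_lt _).1 c2 r0 r00.
pose J := maxn N1 N2.
have /= hJ1 := h1 J (leq_maxl _ _); have /= hJ2 := h2 J (leq_maxr _ _).
have h20 n : 0 < (2^-1 : R) ^+ n by rewrite exprn_gt0//; lra.
exists (2^-1 ^+ J) => //.
apply: ge_ereal_sup => _ [B pB <-]; apply: ge_ereal_sup => _ [X [Xfin XB] <-].
rewrite fsbig_finite//= sumEFin lee_fin.
apply: le_trans (ltW (le_lt_trans (ler_norm _) hJ1)).
apply: (packing_sum_le K0 a0 at_ r00 few _ pB); [|exact: finmap.fset_uniq|].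
  exact: le_lt_trans (ler_norm _) hJ2.
by move=> b bX; apply: XB; move: bX; rewrite in_fset_set// inE.
Qed.

End packing_count.

(** * Transfer of packing null sets *)

Section packing_transfer.
Context {R : realType} {T1 T2 : choiceType} (d1 : T1 -> T1 -> R)
  (d2 : T2 -> T2 -> R) (S : T1 -> T2 -> Prop).
Hypothesis d1P : pseudometric d1.
Hypothesis d1xx : forall x, d1 x x = 0.

(** Separated points of [A2] are pulled back to [A1] by a choice [f] of preimages, and a maximal
    separated net [t] is extracted there. Small balls around the net form a packing, which bounds
    [size t]; the points pulled back near one net point are at most [N.+1] by the labels. *)
Lemma few_separated_transfer (A1 : set T1) (A2 : set T2) (p s eps : R) :
  0 < p -> 0 <= s -> 0 < eps -> holder_labels d1 d2 S A2 p ->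
  (packing_presup d1 s eps A1 <= 1)%E ->
  A2 `<=` rel_image S A1 -> exists K r0 : R, [/\ 0 <= K, 0 < r0 &
    few_separated d2 A2 (s / p) K r0].
Proof.
move=> p0 s0 eps0 [N [C [r0 [C0 r00 hl]]]] pre A21.
(* [rr r] solves C x^p = r / 2, so a set of diameter [rr r] has labelled classes of diameter r / 2 <
   r. *)
pose rr (r : R) := (r / 2 / C) `^ p^-1.
(* The constant is [N.+1] times (rr r / 4)^(-s), with [rr r] written as a power of r; [r1] is the
   value of r at which [rr r] reaches the smaller of [r0] and [eps]. *)
pose K := N.+1%:R * 4 `^ s * (2 * C) `^ (s / p).
pose r1 := 2 * C * (Num.min r0 eps) `^ p.
exists K, r1; split.
- by rewrite !mulr_ge0// powR_ge0.
- by rewrite !mulr_gt0// powR_gt0// lt_min r00.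
move=> r l /andP[r_gt0 rr1] sl lA.
have rr0 : 0 < rr r by rewrite powR_gt0// !divr_gt0.
have rrp : C * rr r `^ p = r / 2.
  rewrite -powRrM mulVf ?gt_eqF// powRr1; last by rewrite !divr_ge0// ltW.
  by rewrite mulrC divfK ?gt_eqF.
have : rr r < Num.min r0 eps.
  rewrite ltNge; apply/negP => h.
  suff : r1 <= r by lra.
  rewrite (_ : r = 2 * (C * rr r `^ p)); last by rewrite rrp; field.
  rewrite /r1 -mulrA ler_pM2l// ler_pM2l//; apply: powR_le; [exact: ltW| |exact: h].
  by rewrite le_min !ltW.
rewrite lt_min => /andP[rrr0 rreps].
have [[x0 x0l]|l0] := pselect (exists x, x \in l); last first.
  rewrite (_ : l = [::]); first by rewrite mulr_ge0 ?powR_ge0// !mulr_ge0// powR_ge0.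
  by case: l l0 {sl lA} => // a ? []; exists a; rewrite mem_head.
have [z0 _ _] := A21 _ (lA _ x0l).
have /choice[f hf] : forall y, exists x, A2 y -> A1 x /\ S x y.
  move=> y; have [/A21[x A1x Sxy]|] := pselect (A2 y); first by exists x.
  by exists z0.
have rr20 : 0 < rr r / 2 by lra.
have [t [tl st ht]] := @separated_net R T1 T2 d1 f (rr r / 2) l (pm_sym d1P).
have tA y : y \in t -> A1 (f y) /\ S (f y) y by move=> /tl/lA/hf.
have st' y y' : y \in t -> y' \in t -> y != y' -> rr r / 2 <= d1 (f y) (f y').
  apply: (separated_in _ st) => a b; exact: (pm_sym d1P).
have szl : (size l <= N.+1 * size t)%N.
  apply: (@size_le_sum_count _ (fun x y => d1 (f x) (f y) < rr r / 2)).
    by apply/allP => x xl; apply: ht => //; rewrite d1xx.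
  move=> y; rewrite -size_filter.
  have hlab : small_labels d2 (A2 `&` rel_image S [set x | d1 x (f y) < rr r / 2]) N (r / 2).
    rewrite -rrp; apply: hl; first by rewrite rr0.
    move=> u v /= hu hv; apply: le_trans (pm_tri d1P (f y) u v) _.
    by rewrite (pm_sym d1P (f y)); lra.
  apply: (small_labels_separated hlab (r' := r)); first by lra.
    by apply: subseq_pairwise sl; exact: filter_subseq.
  move=> x; rewrite mem_filter => /andP[xy xl]; split; first exact: lA.
  by exists (f x) => //; exact: (hf _ (lA _ xl)).2.
(* The radius is half the separation of the net, so two such balls that meet would have centres
   closer than [rr r / 2]. *)
pose g y : T1 * R := (f y, rr r / 4).
have finj : {in t &, injective g}.
  move=> y y' yt y't [ff]; apply/eqP; apply: contraT => yy'.
  by have := st' _ _ yt y't yy'; rewrite ff d1xx; lra.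
have ut : uniq t.
  rewrite uniq_pairwise; apply: sub_pairwise st => y y' /= h.
  by apply/eqP => yy'; move: h; rewrite yy' d1xx; lra.
have pB : packing d1 eps A1 [set` map g t].
  split=> [b /mapP[y yt ->]|].
    by split; [exact: (tA _ yt).1|rewrite /g /=; apply/andP; split; lra].
  apply/trivIsetP => _ _ /mapP[y yt ->] /mapP[y' y't ->] gg.
  apply/seteqP; split => // z [/= zy zy'].
  have yy' : y != y' by apply: contra_neq gg => ->.
  have := st' _ _ yt y't yy'; have := pm_tri d1P z (f y) (f y').
  have {}zy : d1 z (f y) < rr r / 4 := zy.
  have {}zy' : d1 z (f y') < rr r / 4 := zy'.
  by rewrite (pm_sym d1P _ z); lra.
have szt : (size t)%:R * (rr r / 4) `^ s <= 1.
  rewrite -lee_fin; apply: le_trans pre.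
  apply: le_trans (ereal_sup_ubound _); last by exists [set` map g t].
  have := @ler_esum_seq R _ [set` map g t] (fun b => (b.2 `^ s)%:E) (map g t).
  rewrite map_inj_in_uniq// big_map /= sumEFin big_const_seq count_predT iter_addr_0.
  by rewrite mulr_natl; apply.
have rr4 : 0 < (rr r / 4) `^ s by rewrite powR_gt0//; lra.
apply: (@le_trans _ _ (N.+1%:R * (size t)%:R)).
  by rewrite -natrM ler_nat.
rewrite /K -!mulrA ler_pM2l//.
apply: (@le_trans _ _ ((rr r / 4) `^ s)^-1).
  by rewrite -[leRHS]mul1r ler_pdivlMr.
have C20 : 0 <= 2 * C by rewrite mulr_ge0// ltW.
rewrite powRM ?invr_ge0//; last exact: ltW.
have -> : rr r `^ s = r `^ (s / p) / (2 * C) `^ (s / p).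
  rewrite /rr -powRrM -powRV// -powRM ?invr_ge0//; last exact: ltW.
  by rewrite (mulrC p^-1) invfM mulrA.
rewrite powRV// powRN !invfM !invrK mulrC le_eqVlt; apply/orP; left; apply/eqP.
ring.
Qed.

Lemma packing_null_transfer (A1 : set T1) (A2 : set T2) (p s t : R) :
  pseudometric d2 -> (forall x, d2 x x = 0) ->
  0 <= s -> 0 < p -> s < t * p -> holder_labels d1 d2 S A2 p ->
  packing_measure d1 s A1 = 0%E -> A2 `<=` rel_image S A1 ->
  packing_null d2 t A2.
Proof.
move=> d2P d2xx s0 p0 stp [N [C [r0 [C0 r00 hl]]]] P0 A21.
have [V [AV Ve]] := packing_measure0_cover P0.
exists (fun i => A2 `&` rel_image S (A1 `&` V i)); split.
  move=> y A2y; have [x A1x Sxy] := A21 _ A2y; have [i _ Vx] := AV _ A1x.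
  by exists i => //; split => //; exists x.
move=> i; have [eps eps0 he] := Ve i.
have [| |K [r1 [K0 r10 few]]] := @few_separated_transfer (V i)
  (A2 `&` rel_image S (A1 `&` V i)) p s eps p0 s0 eps0 _ he.
- exists N, C, r0; split => // r U hr hU; have [c hc] := hl r U hr hU.
  by exists c => x y [[? _] ?] [[? _] ?]; exact: hc.
- by move=> y [_ [x [_ Vx] Sxy]]; exists x.
apply: (packing_premeasure_few d2P d2xx K0 _ _ r10 few).
  by rewrite divr_ge0// ltW.
by rewrite ltr_pdivrMr.
Qed.

End packing_transfer.

(** * Euclidean norm and arcs *)

Section euclidean_norm.
Context {R : realType} {n : nat}.
Implicit Types x y v : 'rV[R]_n.

Lemma enorm_ge0 v : 0 <= enorm v.
Proof. exact: sqrtr_ge0. Qed.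

Lemma sqr_enorm v : enorm v ^+ 2 = \sum_i v 0 i ^+ 2.
Proof. by rewrite sqr_sqrtr// sumr_ge0// => i _; exact: sqr_ge0. Qed.

Lemma enorm0 : enorm (0 : 'rV[R]_n) = 0.
Proof. by rewrite /enorm big1 ?sqrtr0// => i _; rewrite mxE expr0n. Qed.

Lemma enormZ (a : R) v : enorm (a *: v) = `|a| * enorm v.
Proof.
rewrite /enorm -sqrtr_sqr -sqrtrM ?sqr_ge0//; congr Num.sqrt.
by rewrite mulr_sumr; apply: eq_bigr => i _; rewrite mxE exprMn.
Qed.

Lemma enormN v : enorm (- v) = enorm v.
Proof. by rewrite -scaleN1r enormZ normrN1 mul1r. Qed.

Lemma enormBC x y : enorm (x - y) = enorm (y - x).
Proof. by rewrite -enormN opprB. Qed.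

Lemma ler_coord_enorm v i : `|v 0 i| <= enorm v.
Proof.
rewrite -sqrtr_sqr; apply: ler_wsqrtr.
by rewrite (bigD1 i)//= lerDl sumr_ge0// => j _; exact: sqr_ge0.
Qed.

Lemma enorm_eq0 v : enorm v = 0 -> v = 0.
Proof.
move=> v0; apply/rowP => i; rewrite mxE; apply/eqP; rewrite -normr_le0 -v0.
exact: ler_coord_enorm.
Qed.

Lemma enorm_le_coord v (c : R) : 0 <= c -> (forall i, `|v 0 i| <= c) -> enorm v <= n%:R * c.
Proof.
move=> c0 h; apply: le_trans (_ : Num.sqrt (n%:R * c ^+ 2) <= _).
  apply: ler_wsqrtr; rewrite mulr_natl -[n in leRHS]card_ord -sumr_const.
  by apply: ler_sum => i _; rewrite -real_normK ?num_real// lerXn2r// nnegrE.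
rewrite -[leRHS]ger0_norm ?mulr_ge0// -sqrtr_sqr; apply: ler_wsqrtr.
rewrite exprMn ler_wpM2r ?sqr_ge0// -natrX ler_nat.
by case: n => // m; rewrite -mulnn leq_pmulr.
Qed.

Lemma cauchy_schwarz x y : (\sum_i x 0 i * y 0 i) <= enorm x * enorm y.
Proof.
set C := \sum_i _; set A := enorm x; set B := enorm y.
have [B0|B0] := eqVneq B 0.
  rewrite /C (_ : y = 0) ?big1 ?mulr_ge0 ?enorm_ge0//; last exact: enorm_eq0.
  by move=> i _; rewrite mxE mulr0.
have Bp : 0 < B by rewrite lt0r B0 enorm_ge0.
(* This sum of squares expands to B^2 (B^2 A^2 - C^2). *)
have h : 0 <= \sum_i (B ^+ 2 * x 0 i - C * y 0 i) ^+ 2.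
  by apply: sumr_ge0 => i _; exact: sqr_ge0.
have {h} : 0 <= B ^+ 2 * (B ^+ 2 * A ^+ 2 - C ^+ 2).
  move: h; under eq_bigr do rewrite sqrrB exprMn [(C * _) ^+ 2]exprMn.
  rewrite big_split /= sumrB -!mulr_sumr -!sqr_enorm -/A -/B.
  have -> : \sum_i B ^+ 2 * x 0 i * (C * y 0 i) *+ 2 = B ^+ 2 * C * C *+ 2.
    rewrite sumrMnl; congr (_ *+ 2).
    rewrite -[RHS]/(B ^+ 2 * C * (\sum_i x 0 i * y 0 i)) mulr_sumr.
    by apply: eq_bigr => i _; ring.
  by move=> h; apply: le_trans h _; rewrite le_eqVlt; apply/orP; left; apply/eqP; ring.
rewrite pmulr_rge0 ?exprn_gt0// subr_ge0 => h.
apply: le_trans (ler_norm _) _.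
rewrite -(@ler_pXn2r _ 2)// ?nnegrE ?mulr_ge0 ?enorm_ge0//.
by rewrite real_normK ?num_real// exprMn mulrC.
Qed.

Lemma ler_enormD x y : enorm (x + y) <= enorm x + enorm y.
Proof.
rewrite -(@ler_pXn2r _ 2)// ?nnegrE ?addr_ge0 ?enorm_ge0//.
rewrite sqrrD !sqr_enorm.
under eq_bigr do rewrite mxE sqrrD.
rewrite 2!big_split /= lerD2r lerD2l sumrMnl lerMn2r /=.
exact: cauchy_schwarz.
Qed.

Lemma ler_enorm_dist x y z : enorm (x - z) <= enorm (x - y) + enorm (y - z).
Proof. by rewrite (_ : x - z = (x - y) + (y - z)) ?ler_enormD// addrA subrK. Qed.

Lemma open_enormP (A : set 'rV[R]_n) : open A <->
  forall x, A x -> exists2 e : R, 0 < e & forall y, enorm (y - x) < e -> A y.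
Proof.
rewrite openE; split => [h x /h /nbhs_ballP[e /= e0 he]|h x /h[e e0 he]].
  exists e => // y yx; apply: he; split => // i j; rewrite /ball /=.
  rewrite ord1 distrC; have := ler_coord_enorm (y - x) j.
  by rewrite !mxE => /le_lt_trans; apply.
apply/nbhs_ballP; exists (e / n.+1%:R) => /=; first by rewrite divr_gt0.
move=> y [_ yx]; apply: he.
have e1 : 0 <= e / n.+1%:R by rewrite divr_ge0// ltW.
apply: (@le_lt_trans _ _ (n%:R * (e / n.+1%:R))).
  apply: enorm_le_coord => // i; have := yx 0 i; rewrite /ball /= distrC !mxE; exact: ltW.
by rewrite mulrCA gtr_pMr// ltr_pdivrMr// mul1r ltr_nat.
Qed.

End euclidean_norm.

Section arcs.
Context {R : realType} {n : nat}.
Implicit Types f g : R -> 'rV[R]_n.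

(** A recursive form of the partition sums in [elength], for which concatenation, reversal and
    translation of partitions are plain inductions. *)
Fixpoint polylen f (a : R) (s : seq R) : R :=
  if s is x :: s' then enorm (f x - f a) + polylen f x s' else 0.

Lemma polylen_sum f a b s : \sum_(0 <= i < size s)
  enorm (f (nth b (a :: s) i.+1) - f (nth b (a :: s) i)) = polylen f a s.
Proof.
elim: s a => [|x s ih] a /=; first by rewrite big_nil.
by rewrite big_nat_recl//= -ih.
Qed.

Lemma polylen_ext f g a s : (forall t, t \in a :: s -> f t = g t) ->
  polylen f a s = polylen g a s.
Proof.
elim: s a => //= x s ih a h; rewrite !h ?inE ?eqxx ?orbT//; congr (_ + _).
by apply: ih => t ts; apply: h; rewrite inE ts orbT.
Qed.

Lemma polylen_shift f c a s :
  polylen (fun t => f (t + c)) a s = polylen f (a + c) (map (fun u => u + c) s).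
Proof. by elim: s a => //= x s ih a; rewrite ih. Qed.

Lemma polylen_cat f a s s' :
  polylen f a (s ++ s') = polylen f a s + polylen f (last a s) s'.
Proof. by elim: s a => [|x s ih] a /=; rewrite ?add0r// ih addrA. Qed.

Lemma polylen_rev f a s :
  polylen f (last a s) (rev (belast a s)) = polylen f a s.
Proof.
elim: s a => //= x s ih a; rewrite rev_cons -cats1 polylen_cat ih /= addr0 enormBC.
rewrite addrC; congr (enorm (_ - _) + _).
case: s {ih} => //= y s; rewrite rev_cons last_rcons//.
Qed.

Lemma polylen_opp f a s :
  polylen (fun t => f (- t)) a s = polylen f (- a) (map -%R s).
Proof. by elim: s a => //= x s ih a; rewrite ih. Qed.

Definition lip_on f (a b : R) :=
  forall s t, a <= s -> s <= t -> t <= b -> enorm (f t - f s) <= t - s.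

Definition polylen_approx f (s t : R) :=
  forall e, 0 < e -> exists2 p, itv_partition s t p & t - s - e < polylen f s p.

(** The two inequalities behind unit speed, free of extended reals: the Lipschitz half bounds all
    polygonal lengths from above, the approximation half says that they come close to the length of
    the interval. *)
Definition arc_on f (a b : R) := lip_on f a b /\
  forall s t, a <= s -> s <= t -> t <= b -> polylen_approx f s t.

Lemma polylen_le f a b s : lip_on f a b -> itv_partition a b s ->
  polylen f a s <= b - a.
Proof.
elim: s a => [|x s ih] a fl; first by move=> /itv_partition_nil ->; rewrite subrr.
move=> p; have /= [/andP[ax _] _] := p; have xb := itv_partition_cons p.
have xb' := itv_partition_le xb.
rewrite /= (_ : b - a = (x - a) + (b - x)); last by ring.
apply: lerD; first by apply: fl => //; exact: ltW.
by apply: ih => // u v xu; apply: fl; rewrite (le_trans (ltW ax)).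
Qed.

Lemma arcP f a b :
  (forall s t, a <= s -> s <= t -> t <= b ->
    ereal_sup [set (polylen f s p)%:E | p in itv_partition s t] = (t - s)%:E) <->
  arc_on f a b.
Proof.
split=> [h|[fl fa] s t as_ st tb].
  have lip : lip_on f a b.
    move=> s t as_; rewrite le_eqVlt => /predU1P[<- _|st tb].
      by rewrite !subrr enorm0.
    rewrite -lee_fin -(h s t as_ (ltW st) tb); apply: ereal_sup_ubound.
    by exists [:: t]; [exact: itv_partition1|rewrite /= addr0].
  split => // s t as_ st tb e e0.
  have : (((t - s) - e)%:E < ereal_sup [set (polylen f s p)%:E | p in itv_partition s t])%E.
    by rewrite h// lte_fin; lra.
  by move=> /ereal_sup_gt[_ [p sp <-]]; rewrite lte_fin; exists p.
apply/eqP; rewrite eq_le; apply/andP; split.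
  apply: ge_ereal_sup => _ [p sp <-]; rewrite lee_fin; apply: polylen_le sp.
  by move=> u v su uv vt; apply: fl; [exact: le_trans su| |exact: le_trans tb].
apply/lee_addgt0Pr => e e0; have [p sp hp] := fa s t as_ st tb e e0.
apply: (@le_trans _ _ ((polylen f s p)%:E + e%:E)%E).
  by rewrite -EFinD lee_fin; lra.
by apply: leeD => //; apply: ereal_sup_ubound; exists p.
Qed.

Lemma arc_ext f g a b : (forall t, a <= t <= b -> f t = g t) -> arc_on f a b -> arc_on g a b.
Proof.
move=> fg [fl fa]; split=> s t as_ st tb.
  rewrite -!fg ?as_ ?(le_trans st)// ?(le_trans as_)//; exact: fl.
move=> e e0; have [p sp hp] := fa s t as_ st tb e e0; exists p => //.
rewrite -(@polylen_ext f)// => u up; apply: fg.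
have [k ksz <-] : exists2 k, (k < size (s :: p))%N & nth t (s :: p) k = u.
  by exists (index u (s :: p)); [rewrite index_mem|rewrite nth_index].
apply/andP; split.
  exact: le_trans (itv_partition_nth_ge _ sp).
exact: le_trans (itv_partition_nth_le _ sp) tb.
Qed.

Lemma itv_partition_shift (s t c : R) p : itv_partition s t p ->
  itv_partition (s + c) (t + c) (map (fun u => u + c) p).
Proof.
move=> [sp /eqP pt]; split; last by rewrite (last_map (fun u => u + c)) pt.
apply: (homo_path _ sp) => u v; by rewrite ltrD2r.
Qed.

Lemma arc_shift f a b c : arc_on f (a + c) (b + c) -> arc_on (fun t => f (t + c)) a b.
Proof.
move=> [fl fa]; split=> s t as_ st tb.
  by rewrite (_ : t - s = (t + c) - (s + c)); [apply: fl; lra|ring].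
move=> e e0; have [||| p sp hp] := fa (s + c) (t + c) _ _ _ e e0; [lra..|].
exists (map (fun u => u - c) p).
  by have := itv_partition_shift (- c) sp; rewrite !addrK.
rewrite polylen_shift -map_comp (_ : map _ p = p); first lra.
by rewrite -[RHS]map_id; apply: eq_map => u /=; rewrite subrK.
Qed.

Lemma arc_opp f a b : arc_on f (- b) (- a) -> arc_on (fun t => f (- t)) a b.
Proof.
move=> [fl fa]; split=> s t as_ st tb.
  rewrite enormBC (_ : t - s = (- s) - (- t)); [apply: fl; lra|ring].
move=> e e0; have [||| p sp hp] := fa (- t) (- s) _ _ _ e e0; [lra..|].
exists (rev (belast t (map -%R p))).
  by have := itv_partition_rev sp; rewrite !opprK.
have ls : s = last t (map -%R p).
  by have [_ /eqP lp] := sp; rewrite -[t]opprK last_map lp opprK.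
rewrite {2}ls polylen_rev polylen_opp -map_comp (_ : map _ p = p); first lra.
by rewrite -[RHS]map_id; apply: eq_map => u /=; rewrite opprK.
Qed.

Lemma arc_cat f a m b : a <= m -> m <= b -> arc_on f a m -> arc_on f m b -> arc_on f a b.
Proof.
move=> am mb [fl1 fa1] [fl2 fa2]; split=> s t as_ st tb.
  have [tm|mt] := leP t m; first exact: fl1.
  have [sm|ms] := leP s m; last by apply: fl2 => //; exact: ltW.
  apply: le_trans (ler_enorm_dist _ (f m) _) _.
  rewrite (_ : t - s = (t - m) + (m - s)); last by ring.
  by apply: lerD; [apply: fl2 => //; exact: ltW|exact: fl1].
have [tm|mt] := leP t m; first exact: fa1.
have [sm|ms] := leP s m; last by apply: fa2 => //; exact: ltW.
move=> e e0; have e20 : 0 < e / 2 by lra.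
have [p sp hp] := fa1 s m as_ sm (lexx _) _ e20.
have [q mq hq] := fa2 m t (lexx _) (ltW mt) tb _ e20.
exists (p ++ q); first exact: itv_partition_cat sp mq.
have [_ /eqP lp] := sp; rewrite polylen_cat lp; lra.
Qed.

Lemma arc_segment (x v : 'rV[R]_n) a b : enorm v = 1 -> arc_on (fun t => x + t *: v) a b.
Proof.
move=> v1; have E s t : s <= t -> enorm (x + t *: v - (x + s *: v)) = t - s.
  move=> st; rewrite opprD addrACA subrr add0r -scalerBl enormZ v1 mulr1 ger0_norm//.
  by rewrite subr_ge0.
split=> s t as_ st tb; first by rewrite E.
move=> e e0; move: st; rewrite le_eqVlt => /predU1P[->|st].
  by exists [::]; [split|rewrite /=; lra].
exists [:: t]; first exact: itv_partition1.
by rewrite /= addr0 E; [lra|exact: ltW].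
Qed.

End arcs.

(** * The internal metric and the rho-metric *)

Section interval_integrals.
Context {R : realType}.
Implicit Types (F : R -> R) (a b c : R).
Local Notation mu := lebesgue_measure.

(** Continuity relative to a closed interval in epsilon-delta form, which restricts, translates and
    reflects without subspace topologies. *)
Definition cont_itv F a b := forall t, a <= t <= b -> forall e, 0 < e ->
  exists2 delta, 0 < delta & forall s, a <= s <= b -> `|s - t| < delta -> `|F s - F t| < e.

Lemma cont_itv_within F a b : cont_itv F a b -> {within `[a, b], continuous F}.
Proof.
move=> h; apply/subspace_continuousP => t; rewrite /= in_itv/= => tab.
apply/cvgrPdist_lt => e e0; have [delta d0 hd] := h t tab e e0.
exists delta => // s /= ts; rewrite in_itv/= => sab.
by rewrite distrC; apply: hd => //; rewrite distrC.
Qed.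

Lemma cont_itv_integrable F a b : cont_itv F a b ->
  mu.-integrable `[a, b] (EFin \o F).
Proof.
move=> h; apply: continuous_compact_integrable; first exact: segment_compact.
exact: cont_itv_within.
Qed.

Lemma cont_itv_sub F a b a' b' : a <= a' -> b' <= b -> cont_itv F a b -> cont_itv F a' b'.
Proof.
move=> aa bb h t /andP[at_ tb] e e0.
have [|delta d0 hd] := h t _ e e0; first by apply/andP; split; lra.
by exists delta => // s /andP[as_ sb]; apply: hd; apply/andP; split; lra.
Qed.

Lemma cont_itv_opp F a b : cont_itv F (- b) (- a) -> cont_itv (fun t => F (- t)) a b.
Proof.
move=> h t /andP[at_ tb] e e0.
have [|delta d0 hd] := h (- t) _ e e0; first by apply/andP; split; lra.
exists delta => // s /andP[as_ sb] st; apply: hd; first by apply/andP; split; lra.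
by rewrite opprK addrC distrC.
Qed.

Lemma Rintegral_shift F a b c : a <= b -> cont_itv F (a + c) (b + c) ->
  \int[mu]_(t in `[a + c, b + c]) F t = \int[mu]_(t in `[a, b]) F (t + c).
Proof.
move=> ab cF; rewrite /Rintegral; congr fine.
have dshift (x : R) : is_derive x (1 : R) (fun t : R => t + c) 1.
  by rewrite -[X in is_derive _ _ _ X]addr0; apply: is_deriveD.
have Dshift : derive1 (fun t : R => t + c) = cst 1.
  by apply/funext => x; rewrite derive1E; apply: derive_val.
have cshift : continuous (fun t : R => t + c).
  by move=> x; apply: cvgD; [exact: cvg_id|exact: cvg_cst].
rewrite (@integration_by_substitution_increasing _ (fun t => t + c) F a b ab).
- by apply: eq_integral => x _; rewrite !fctE Dshift mulr1.
- by move=> x y _ _; rewrite ltrD2r.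
- by rewrite Dshift => x _; exact: cvg_cst.
- by rewrite Dshift; exact: is_cvg_cst.
- by rewrite Dshift; exact: is_cvg_cst.
- split => [x _|| ].
  + by apply: ex_derive.
  + by apply: cvg_at_right_filter; exact: cshift.
  + by apply: cvg_at_left_filter; exact: cshift.
- exact: cont_itv_within.
Qed.

Lemma Rintegral_reflect F (l : R) : 0 <= l -> cont_itv F 0 l ->
  \int[mu]_(t in `[0, l]) F (l - t) = \int[mu]_(t in `[0, l]) F t.
Proof.
move=> l0 cF.
have cN : cont_itv (fun t => F (- t)) (- l) 0.
  by apply: cont_itv_opp; rewrite oppr0 opprK.
have := @Rintegral_shift (fun t => F (- t)) 0 l (- l) l0.
rewrite add0r subrr => /(_ cN) h.
transitivity (\int[mu]_(t in `[0, l]) F (- (t - l))).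
  by apply: eq_Rintegral => t _; rewrite opprB.
rewrite -h /Rintegral; congr fine.
have := @integration_by_substitution_oppr _ F (- l) 0.
rewrite oppr0 opprK => ->//; first by rewrite lerNl oppr0.
exact: cont_itv_within.
Qed.

Lemma Rintegral_split F a m b : a <= m -> m <= b -> cont_itv F a b ->
  \int[mu]_(t in `[a, b]) F t =
  \int[mu]_(t in `[a, m]) F t + \int[mu]_(t in `[m, b]) F t.
Proof.
move=> am mb cF; have iF := cont_itv_integrable cF.
have := @Rintegral_itvB _ F (BLeft a) (BRight b) m iF; rewrite !bnd_simp => /(_ am mb).
rewrite Rintegral_itv_obnd_cbnd; last first.
  apply: integrableS iF => //; apply: subset_itv; by rewrite bnd_simp.
by move=> <-; rewrite addrC subrK.
Qed.

Lemma Rintegral_le_cst F a b M : a <= b -> cont_itv F a b ->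
  (forall t, a <= t <= b -> F t <= M) -> \int[mu]_(t in `[a, b]) F t <= M * (b - a).
Proof.
move=> ab cF h; apply: (@le_trans _ _ (\int[mu]_(t in `[a, b]) M)).
  apply: le_Rintegral.
  - exact: measurable_itv.
  - exact: cont_itv_integrable.
  - apply: cont_itv_integrable => t _ e e0; exists 1 => // s _ _.
    by rewrite subrr normr0.
  - by move=> t /=; rewrite in_itv/=; exact: h.
move: ab; rewrite le_eqVlt => /predU1P[<-|ab].
  by rewrite set_itv1 Rintegral_set1 subrr mulr0.
by rewrite Rintegral_cst//= lebesgue_measure_itv/= lte_fin ab.
Qed.

End interval_integrals.

(** * The two distances as infima over arcs *)

Section distances.
Context {R : realType} {n : nat} {Omega : set 'rV[R]_n}.
Local Notation mu := lebesgue_measure.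
Implicit Types (x y z : Omega) (g h : R -> Omega).

Lemma Omega_val x : Omega (val x).
Proof. exact: set_mem (valP x). Qed.

Lemma elengthE g a b : elength g a b =
  ereal_sup [set (polylen (fun t => val (g t)) a p)%:E | p in itv_partition a b].
Proof.
rewrite /elength; congr ereal_sup; apply/seteqP; split=> _ [p ap <-]; exists p => //;
  by rewrite (polylen_sum (fun t => val (g t))).
Qed.

Lemma arclength_joinsP x y l g : arclength_joins x y l g <->
  [/\ 0 <= l, g 0 = x, g l = y & arc_on (fun t => val (g t)) 0 l].
Proof.
split=> -[l0 g0 gl h]; split=> //.
  by apply/arcP => s t s0 st tl; rewrite -elengthE h.
by move=> s t s0 st tl; rewrite elengthE; apply/arcP : s t s0 st tl.
Qed.

Definition cat_path g h (l : R) (t : R) : Omega := if t <= l then g t else h (t - l).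

Lemma joins_cat x y z l l' g h : arclength_joins x y l g -> arclength_joins y z l' h ->
  arclength_joins x z (l + l') (cat_path g h l).
Proof.
move=> /arclength_joinsP[l0 g0 gl ag] /arclength_joinsP[l'0 h0 hl ah].
have hE t : l <= t -> cat_path g h l t = h (t - l).
  move=> lt; rewrite /cat_path; case: ifPn => // tl.
  have -> : t = l by apply/eqP; rewrite eq_le tl lt.
  by rewrite subrr h0 gl.
apply/arclength_joinsP; split.
- exact: addr_ge0.
- by rewrite /cat_path l0.
- by rewrite hE ?lerDl// addrC addKr.
- apply: (@arc_cat _ _ _ _ l); rewrite ?lerDl//.
    apply: arc_ext ag => t /andP[_ tl]; by rewrite /cat_path tl.
  apply: (@arc_ext _ _ (fun t => val (h (t - l)))).
    by move=> t /andP[lt _]; rewrite hE.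
  apply: (@arc_shift _ _ (fun t => val (h t))).
  by rewrite subrr addrC addKr.
Qed.

Lemma joins_rev x y l g : arclength_joins x y l g ->
  arclength_joins y x l (fun t => g (l - t)).
Proof.
move=> /arclength_joinsP[l0 g0 gl ag]; apply/arclength_joinsP; split => //.
- by rewrite subr0.
- by rewrite subrr.
- apply: (@arc_ext _ _ (fun t => val (g (- t + l)))).
    by move=> t _; rewrite addrC.
  apply: (@arc_opp _ _ (fun t => val (g (t + l)))).
  apply: (@arc_shift _ _ (fun t => val (g t))).
  by rewrite oppr0 add0r addNr.
Qed.

Lemma joins_sub g a b : a <= b -> arc_on (fun t => val (g t)) a b ->
  arclength_joins (g a) (g b) (b - a) (fun t => g (t + a)).
Proof.
move=> ab ag; apply/arclength_joinsP; split.
- by rewrite subr_ge0.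
- by rewrite add0r.
- by rewrite subrK.
- by apply: (@arc_shift _ _ (fun t => val (g t))); rewrite add0r subrK.
Qed.

Definition seg_in x y := forall u : R, 0 <= u <= 1 -> Omega (val x + u *: (val y - val x)).

Lemma joins_segment x y : seg_in x y -> exists g,
  arclength_joins x y (enorm (val y - val x)) g /\
  forall t, 0 <= t <= enorm (val y - val x) ->
    exists2 u, 0 <= u <= 1 & val (g t) = val x + u *: (val y - val x).
Proof.
set v := val y - val x; set L := enorm v => xy.
have [L0|L0] := eqVneq L 0.
  have xy' : y = x by apply: val_inj; apply/eqP; rewrite -subr_eq0 -/v; apply/eqP/enorm_eq0.
  exists (fun=> x); split; first by rewrite L0 xy'; exact: arclength_joins_cst.
  by move=> t _; exists 0; rewrite ?lexx ?ler01// scale0r addr0.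
have Lp : 0 < L by rewrite lt0r L0 enorm_ge0.
pose f t := val x + t *: (L^-1 *: v).
have fin t : 0 <= t <= L -> f t \in Omega.
  move=> /andP[t0 tL]; rewrite inE /f scalerA; apply: xy.
  by apply/andP; split; [exact: divr_ge0 t0 (ltW Lp)|rewrite ler_pdivrMr// mul1r].
(* The default value [x] can occur only outside [[0, L]]. *)
pose g t := insubd x (f t).
have gE t : 0 <= t <= L -> val (g t) = f t by move=> /fin tL; rewrite insubdK.
exists g; split; last first.
  move=> t /[dup] tL /andP[t0 tL']; exists (t / L).
    by apply/andP; split; [exact: divr_ge0 t0 (ltW Lp)|rewrite ler_pdivrMr// mul1r].
  by rewrite gE// /f scalerA.
apply/arclength_joinsP; split.
- exact: ltW.
- by apply: val_inj; rewrite gE ?lexx ?ltW// /f scale0r addr0.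
- apply: val_inj; rewrite gE ?lexx ?andbT ?ltW// /f scalerA divff// scale1r addrC subrK//.
- apply: (@arc_ext _ _ f); first by move=> t /gE.
  apply: arc_segment; rewrite enormZ ger0_norm ?invr_ge0 ?ltW// mulVf//.
Qed.

Lemma seg_in_ball x y (e : R) : (forall z : 'rV[R]_n, enorm (z - val x) < e -> Omega z) ->
  enorm (val y - val x) < e -> seg_in x y.
Proof.
move=> h xy u /andP[u0 u1]; apply: h; rewrite addrC addKr enormZ ger0_norm//.
by apply: le_lt_trans xy; rewrite ler_piMl// enorm_ge0.
Qed.

Lemma int_dist_le x y l g : arclength_joins x y l g -> int_dist Omega x y <= l.
Proof. by move=> h; apply: ge_inf; [exists 0 => r [? []]|exists g]. Qed.

Lemma int_dist_segment x y : seg_in x y -> int_dist Omega x y <= enorm (val y - val x).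
Proof. by move=> /joins_segment[g [/int_dist_le]]. Qed.

Hypothesis Omega_domain : domain Omega.

Lemma domain_ball x : exists2 e : R, 0 < e & forall z : 'rV[R]_n, enorm (z - val x) < e -> Omega z.
Proof. have [oO _ _] := Omega_domain; exact: (open_enormP _).1 oO _ (Omega_val x). Qed.

(** By connectedness: the points reached from [x] and the points not reached both form open sets,
    since small balls are joined to their centre by segments. This makes the infima defining the
    distances range over nonempty sets. *)
Lemma domain_joins x y : exists l g, arclength_joins x y l g.
Proof.
have [oO cO _] := Omega_domain.
pose J (z : Omega) := exists l g, arclength_joins x z l g.
have Jstep z w : J z -> seg_in z w -> J w.
  move=> [l [g hg]] /joins_segment[h [hh _]].
  by exists (l + enorm (val w - val z)), (cat_path g h l); exact: joins_cat hh.
have Jstep' z w : J z -> seg_in w z -> J w.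
  move=> [l [g hg]] /joins_segment[h [/joins_rev hh _]].
  by eexists; eexists; exact: joins_cat hg hh.
pose B := [set v | exists2 z : Omega, v = val z & J z].
pose B' := [set v | exists2 z : Omega, v = val z & ~ J z].
have oB : open B.
  apply/open_enormP => _ [z -> Jz]; have [e e0 he] := domain_ball z.
  exists e => // w wz; have Ow : w \in Omega by rewrite inE; exact: he.
  exists (Sub w Ow); rewrite ?SubK//; apply: Jstep Jz _.
  by apply: seg_in_ball he _; rewrite SubK.
have oB' : open B'.
  apply/open_enormP => _ [z -> Jz]; have [e e0 he] := domain_ball z.
  exists e => // w wz; have Ow : w \in Omega by rewrite inE; exact: he.
  exists (Sub w Ow); rewrite ?SubK// => /Jstep' Jw; apply: Jz; apply: Jw.
  by apply: seg_in_ball he _; rewrite SubK.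
have BO : B = Omega.
  apply: cO.
  - exists (val x), x => //; exists 0, (fun=> x); exact: arclength_joins_cst.
  - exists B => //; apply/seteqP; split => [_ [z -> Jz]|v []//].
    by split; [exact: Omega_val|exists z].
  - exists (~` B'); first exact: open_closedC.
    apply/seteqP; split => [_ [z -> Jz]|v [Ov B'v]].
      by split; [exact: Omega_val|move=> [w /val_inj <-]].
    have Ov' : v \in Omega by rewrite inE.
    exists (Sub v Ov'); rewrite ?SubK//; apply: contrapT => Jv; apply: B'v.
    by exists (Sub v Ov'); rewrite ?SubK.
have : B (val y) by rewrite BO; exact: Omega_val.
by move=> [z /val_inj <-].
Qed.

Lemma int_dist_approx x y (e : R) : 0 < e -> exists l g,
  arclength_joins x y l g /\ l < int_dist Omega x y + e.
Proof.
move=> e0; have [l0 [g0 h0]] := domain_joins x y.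
have hi : has_inf [set l | exists g, arclength_joins x y l g].
  by split; [exists l0, g0|exists 0 => r [? []]].
by have [l [g hg] hl] := inf_adherent e0 hi; exists l, g.
Qed.

Lemma int_dist_pm : pseudometric (int_dist Omega).
Proof.
have sym x y : int_dist Omega x y <= int_dist Omega y x.
  apply/ler_addgt0Pr => e e0; have [l [g [/joins_rev hg hl]]] := int_dist_approx y x e0.
  exact: le_trans (int_dist_le hg) (ltW hl).
split=> [x y|x y|y x z].
- have [l0 [g0 h0]] := domain_joins x y.
  by apply: lb_le_inf; [exists l0, g0|move=> r [? []]].
- by apply/eqP; rewrite eq_le !sym.
- apply/ler_addgt0Pr => e e0; have e20 : 0 < e / 2 by lra.
  have [l [g [hg hl]]] := int_dist_approx x y e20.
  have [l' [g' [hg' hl']]] := int_dist_approx y z e20.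
  by have := int_dist_le (joins_cat hg hg'); lra.
Qed.

Lemma enorm_le_int_dist x y : enorm (val y - val x) <= int_dist Omega x y.
Proof.
apply/ler_addgt0Pr => e e0; have [l [g [/arclength_joinsP[l0 <- <- [ag _]] hl]]] :=
  int_dist_approx x y e0.
by have := ag 0 l (lexx _) l0 (lexx _); lra.
Qed.

Lemma int_dist_arc g a b : a <= b -> arc_on (fun t => val (g t)) a b ->
  int_dist Omega (g a) (g b) <= b - a.
Proof. by move=> ab ag; exact: int_dist_le (joins_sub ab ag). Qed.

Variable rho : Omega -> {posnum R}.
Hypothesis rho_cont : continuous (fun x : Omega => (rho x)%:num).

Lemma rho_continuousP x (e : R) : 0 < e -> exists2 delta, 0 < delta &
  forall y, enorm (val y - val x) < delta -> `|(rho y)%:num - (rho x)%:num| < e.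
Proof.
move=> e0; have /cvgrPdist_lt/(_ e e0) := @rho_cont x.
move=> [_ /= [[W oW <-] Wx WU]].
have [delta d0 hd] := (open_enormP W).1 oW _ Wx.
by exists delta => // y yx; rewrite distrC; apply: WU; exact: hd.
Qed.

Lemma lipschitz_cont_itv g a b : lip_on (fun t => val (g t)) a b ->
  cont_itv (fun t => (rho (g t))%:num) a b.
Proof.
move=> lip t /andP[at_ tb] e e0; have [delta d0 hd] := rho_continuousP (g t) e0.
exists delta => // s /andP[as_ sb] st; apply: hd; apply: le_lt_trans st.
have [ts|st] := leP t s.
  by rewrite ger0_norm ?subr_ge0//; exact: lip.
rewrite enormBC distrC ger0_norm ?subr_ge0 ?(ltW st)//; apply: lip => //; exact: ltW.
Qed.

Definition rho_len g a b : R := \int[mu]_(t in `[a, b]) (rho (g t))%:num.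

Lemma arc_cont_itv g a b : arc_on (fun t => val (g t)) a b ->
  cont_itv (fun t => (rho (g t))%:num) a b.
Proof. by move=> [/lipschitz_cont_itv]. Qed.

Lemma rho_dist_le x y l g : arclength_joins x y l g -> rho_dist rho x y <= rho_len g 0 l.
Proof.
move=> h; apply: ge_inf; last by exists l, g.
by exists 0 => r [? [? [_ ->]]]; exact: Rintegral_ge0.
Qed.

Lemma rho_dist_approx x y (e : R) : 0 < e -> exists l g,
  arclength_joins x y l g /\ rho_len g 0 l < rho_dist rho x y + e.
Proof.
move=> e0; have [l0 [g0 h0]] := domain_joins x y.
set S := [set r | exists l g, arclength_joins x y l g /\ r = rho_len g 0 l].
have hi : has_inf S.
  split; first by exists (rho_len g0 0 l0), l0, g0.
  by exists 0 => r [? [? [_ ->]]]; exact: Rintegral_ge0.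
have [r [l [g [hg ->]]] hr] := inf_adherent e0 hi.
by exists l, g.
Qed.

Lemma rho_dist_pm : pseudometric (rho_dist rho).
Proof.
have sym x y : rho_dist rho x y <= rho_dist rho y x.
  apply/ler_addgt0Pr => e e0; have [l [g [hg hl]]] := rho_dist_approx y x e0.
  apply: le_trans (rho_dist_le (joins_rev hg)) (le_trans _ (ltW hl)).
  have /arclength_joinsP[l0 _ _ ag] := hg.
  by rewrite /rho_len (Rintegral_reflect l0 (arc_cont_itv ag)).
split=> [x y|x y|y x z].
- have [l0 [g0 h0]] := domain_joins x y.
  apply: lb_le_inf; first by exists (rho_len g0 0 l0), l0, g0.
  by move=> r [? [? [_ ->]]]; exact: Rintegral_ge0.
- by apply/eqP; rewrite eq_le !sym.
- apply/ler_addgt0Pr => e e0; have e20 : 0 < e / 2 by lra.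
  have [l [g [hg hl]]] := rho_dist_approx x y e20.
  have [l' [g' [hg' hl']]] := rho_dist_approx y z e20.
  have hc := joins_cat hg hg'; have := rho_dist_le hc.
  have /arclength_joinsP[ll0 _ _ ac] := hc.
  have /arclength_joinsP[l0 _ gl ag] := hg.
  have /arclength_joinsP[l'0 gl' _ ag'] := hg'.
  rewrite /rho_len (@Rintegral_split _ _ 0 l)//; [|by rewrite lerDl|exact: arc_cont_itv].
  have -> : \int[mu]_(t in `[0, l]) (rho (cat_path g g' l t))%:num = rho_len g 0 l.
    by apply: eq_Rintegral => t; rewrite inE/= in_itv/= => /andP[_ tl]; rewrite /cat_path tl.
  have -> : \int[mu]_(t in `[l, l + l']) (rho (cat_path g g' l t))%:num = rho_len g' 0 l'.
    have := @Rintegral_shift _ (fun t => (rho (cat_path g g' l t))%:num) 0 l' l l'0.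
    rewrite add0r (addrC l') => ->; last first.
      by apply: (cont_itv_sub _ _ (arc_cont_itv ac)).
    apply: eq_Rintegral => t; rewrite inE/= in_itv/= => /andP[t0 _].
    rewrite /cat_path gerDr; case: ifPn => t0'; last by rewrite addrK.
    have -> : t = 0 by apply/eqP; rewrite eq_le t0' t0.
    by rewrite add0r gl gl'.
  lra.
Qed.

Lemma rho_dist_arc g a b : a <= b -> arc_on (fun t => val (g t)) a b ->
  rho_dist rho (g a) (g b) <= rho_len g a b.
Proof.
move=> ab ag; apply: le_trans (rho_dist_le (joins_sub ab ag)) _.
rewrite /rho_len le_eqVlt; apply/orP; left; apply/eqP.
have := @Rintegral_shift _ (fun t => (rho (g t))%:num) 0 (b - a) a.
by rewrite add0r subrK subr_ge0 => <- //; exact: arc_cont_itv.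
Qed.

Lemma rho_dist_arc_le g a b M : a <= b -> arc_on (fun t => val (g t)) a b ->
  (forall t, a <= t <= b -> (rho (g t))%:num <= M) ->
  rho_dist rho (g a) (g b) <= M * (b - a).
Proof.
move=> ab ag gM; apply: le_trans (rho_dist_arc ab ag) _.
by apply: Rintegral_le_cst => //; exact: arc_cont_itv.
Qed.

Lemma rho_dist_segment x y M : seg_in x y ->
  (forall z u, 0 <= u <= 1 -> val z = val x + u *: (val y - val x) -> (rho z)%:num <= M) ->
  rho_dist rho x y <= M * enorm (val y - val x).
Proof.
move=> /joins_segment[g [/arclength_joinsP[l0 g0 gl ag] gu]] hM.
have := @rho_dist_arc_le g 0 _ M l0 ag; rewrite g0 gl subr0; apply.
by move=> t /gu[u u01 tu]; exact: hM tu.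
Qed.

End distances.

(** * Distance to the internal boundary *)

Lemma euclidean_complete (R : realType) (n : nat) (u : nat -> 'rV[R]_n) :
  (forall e : R, 0 < e -> exists N, forall i j, (N <= i)%N -> (N <= j)%N ->
    enorm (u i - u j) < e) ->
  exists l, forall e : R, 0 < e -> exists N, forall i, (N <= i)%N -> enorm (u i - l) < e.
Proof.
move=> cu; have : cvgn u.
  apply/cauchy_cvgP/cauchy_exP => e e0; have [N hN] := cu e e0.
  exists (u N), N => // i /= Ni; split => // k j; rewrite /ball /=.
  have := ler_coord_enorm (u N - u i) j; rewrite !mxE ord1 => /le_lt_trans; apply.
  exact: hN.
move=> /cvg_ex[l ul]; exists l => e e0.
have e1 : 0 < e / n.+1%:R by rewrite divr_gt0.
have [N _ hN] := ul _ (nbhsx_ballx l _ e1).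
exists N => i Ni; have [_ h] := hN i Ni.
apply: (@le_lt_trans _ _ (n%:R * (e / n.+1%:R))); last first.
  by rewrite mulrCA gtr_pMr// ltr_pdivrMr// mul1r ltr_nat.
apply: enorm_le_coord; first exact: ltW.
by move=> j; have := h 0 j; rewrite /ball /= distrC !mxE; exact: ltW.
Qed.

Section geometry.
Context {R : realType} {n : nat} {Omega : set 'rV[R]_n}.
Hypothesis Omega_domain : domain Omega.
Local Notation di := (int_dist Omega).
Local Notation Ei := (embed di).
Let diP := int_dist_pm Omega_domain.

(** [bdist] as a real number; it carries its meaning once the internal boundary has a point, which
    is the role of [eta0] below. *)
Definition bd (xi : int_completion Omega) : R := fine (bdist xi).

Section boundary_distance.
Variable eta0 : int_completion Omega.
Hypothesis eta0_bdry : int_bdry eta0.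

Lemma bdist_fin (xi : int_completion Omega) : bdist xi \is a fin_num.
Proof.
rewrite ge0_fin_numE.
  apply: (@le_lt_trans _ _ (cdist xi eta0)%:E); last exact: ltry.
  by apply: ereal_inf_lbound; exists eta0.
by apply: le_ereal_inf_tmp => _ [eta _ <-]; rewrite lee_fin; exact: cdist_ge0.
Qed.

Lemma bdE (xi : int_completion Omega) : bdist xi = (bd xi)%:E.
Proof. by rewrite fineK// bdist_fin. Qed.

Lemma bd_le xi eta : int_bdry eta -> bd xi <= cdist xi eta.
Proof. by move=> he; rewrite -lee_fin -bdE; apply: ereal_inf_lbound; exists eta. Qed.

Lemma bd_lip xi xi' : bd xi <= cdist xi xi' + bd xi'.
Proof.
apply/ler_addgt0Pr => e e0.
have : (bdist xi' < (bd xi' + e)%:E)%E by rewrite bdE lte_fin ltrDl.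
move=> /ereal_inf_lt[_ [eta eb <-]]; rewrite lte_fin => h.
apply: le_trans (bd_le xi eb) _; apply: le_trans (cdist_tri diP xi' _ _) _.
by rewrite -addrA lerD2l ltW.
Qed.

Lemma bd_bdry eta : int_bdry eta -> bd eta = 0.
Proof.
move=> he; apply/eqP; rewrite eq_le -{1}(cdistxx eta) bd_le//=.
rewrite -lee_fin -bdE; apply: le_ereal_inf_tmp => _ [eta' _ <-].
by rewrite lee_fin; exact: cdist_ge0.
Qed.

Lemma converges_of_enorm (u : nat -> Omega) (z : Omega) :
  (forall e : R, 0 < e -> exists N, forall i, (N <= i)%N -> enorm (val (u i) - val z) < e) ->
  converges_to u (Ei z).
Proof.
move=> h; apply/(converges_toP diP) => e e0.
have [e1 e10 he1] := domain_ball Omega_domain z.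
have m0 : 0 < Num.min e e1 by rewrite lt_min e0.
have [N hN] := h _ m0; exists N => i Ni.
have := hN i Ni; rewrite lt_min => /andP[h1 h2].
rewrite cdist_embed// (pm_sym diP); apply: le_lt_trans h1.
by apply: int_dist_segment; apply: seg_in_ball he1 h2.
Qed.

Lemma enorm_of_converges (u : nat -> Omega) (z : Omega) : converges_to u (Ei z) ->
  forall e : R, 0 < e -> exists N, forall i, (N <= i)%N -> enorm (val (u i) - val z) < e.
Proof.
move=> /(converges_toP diP) h e e0; have [N hN] := h e e0; exists N => i Ni.
have := hN i Ni; rewrite cdist_embed// enormBC.
by apply: le_lt_trans; rewrite (pm_sym diP) -enormBC; exact: enorm_le_int_dist.
Qed.

(** A boundary point closer than [e] is represented by a Cauchy sequence whose Euclidean limit falls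
    in the ball, hence in Omega. Near an interior point Euclidean and internal convergence agree, so
    the boundary point would lie in Omega. *)
Lemma bd_ge_ball (x : Omega) (e : R) :
  (forall z : 'rV[R]_n, enorm (z - val x) < e -> Omega z) -> e <= bd (Ei x).
Proof.
move=> he; rewrite -lee_fin -bdE; apply: le_ereal_inf_tmp => _ [eta eb <-].
rewrite lee_fin leNgt; apply/negP => xe.
have [e' e'1 e'2] : exists2 e', cdist (Ei x) eta < e' & e' < e.
  by exists ((cdist (Ei x) eta + e) / 2); lra.
have e'3 : 0 < e' - cdist (Ei x) eta by lra.
have [N hN] := (converges_toP diP _ _).1 (rep_converges diP eta) _ e'3.
have hN' i : (N <= i)%N -> enorm (val (rep eta i) - val x) < e'.
  move=> /hN h; apply: le_lt_trans (enorm_le_int_dist Omega_domain x (rep eta i)) _.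
  rewrite -(cdist_embed diP); apply: le_lt_trans (cdist_tri diP eta _ _) _.
  by rewrite (cdist_sym diP eta) -ltrBrDl.
have [|l hl] := @euclidean_complete _ _ (fun i => val (rep eta i)).
  move=> e1 e10; have [M hM] := (cauchy_seqP _ _).1 (rep_cauchy eta) e1 e10.
  exists M => i j Mi Mj; apply: le_lt_trans (hM j i Mj Mi).
  exact: enorm_le_int_dist.
have Ol : Omega l.
  apply: he; apply: (@le_lt_trans _ _ e') => //; apply/ler_addgt0Pr => e1 e10.
  have [M hM] := hl e1 e10.
  have := hM _ (leq_maxl M N); have := hN' _ (leq_maxr M N).
  rewrite (enormBC _ l) => h1 h2.
  by apply: le_trans (ler_enorm_dist _ (val (rep eta (maxn M N))) _) _; lra.
have lO : l \in Omega by rewrite inE.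
apply: eb; exists (Sub l lO) => //.
apply: (converges_unique diP _ (rep_converges diP eta)).
by apply: converges_of_enorm; rewrite SubK.
Qed.

Lemma bd_gt0 (x : Omega) : 0 < bd (Ei x).
Proof.
by have [e e0 /bd_ge_ball] := domain_ball Omega_domain x; exact: lt_le_trans.
Qed.

(* On leaving Omega along a segment one meets the internal boundary: the points
   before the first exit form a Cauchy sequence for the internal metric. *)
Lemma bd_ball (x : Omega) (v : 'rV[R]_n) : enorm (v - val x) < bd (Ei x) -> Omega v.
Proof.
move=> vx; apply: contrapT => Nv; set w := v - val x in vx.
pose S := [set s : R | 0 <= s <= 1 /\ forall u, 0 <= u <= s -> Omega (val x + u *: w)].
have S0 : S 0.
  split=> [|u]; first by rewrite lexx ler01.
  move=> u0; rewrite (_ : u = 0) ?scale0r ?addr0; first exact: Omega_val.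
  by apply/eqP; rewrite eq_le andbC.
have ubS : has_ubound S by exists 1 => s [/andP[]].
have hS : has_sup S by split => //; exists 0.
pose tau := sup S.
have tau0 : 0 <= tau by apply: ub_le_sup.
have tau1 : tau <= 1 by apply: ge_sup; [exists 0|move=> s [/andP[]]].
have Slt u : 0 <= u -> u < tau -> Omega (val x + u *: w).
  move=> u0 ut; have tu : 0 < tau - u by rewrite subr_gt0.
  have [s [_ hs] us] := sup_adherent tu hS.
  by apply: hs; rewrite u0 /=; rewrite -/tau in us; lra.
have Ntau : ~ Omega (val x + tau *: w).
  move=> Ot; have tau_lt1 : tau < 1.
    rewrite lt_neqAle tau1 andbT; apply/eqP => t1; apply: Nv.
    by move: Ot; rewrite t1 scale1r /w addrC subrK.
  have [oO _ _] := Omega_domain; have [e e0 he] := (open_enormP _).1 oO _ Ot.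
  pose s := Num.min 1 (tau + e / 2 / (enorm w + 1)).
  have w1 : 0 < enorm w + 1 by rewrite ltr_wpDl// enorm_ge0.
  have d0 : 0 < e / 2 / (enorm w + 1) by rewrite !divr_gt0.
  have ts : tau < s by rewrite lt_min tau_lt1 ltrDl.
  suff : S s by move=> /(ub_le_sup ubS); rewrite leNgt ts.
  split; first by rewrite ge_min lexx (le_trans tau0 (ltW ts)).
  move=> u /andP[u0 us]; have [ut|tu] := ltP u tau; first exact: Slt.
  apply: he; rewrite opprD addrACA subrr add0r -scalerBl enormZ ger0_norm ?subr_ge0//.
  have : u - tau <= e / 2 / (enorm w + 1).
    by rewrite lerBlDl (le_trans us)// ge_min lexx orbT.
  move=> h; apply: (@le_lt_trans _ _ (e / 2 / (enorm w + 1) * (enorm w + 1))).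
    by apply: ler_pM; rewrite ?subr_ge0 ?enorm_ge0// lerDl.
  by rewrite divfK ?gt_eqF//; lra.
have tau_gt0 : 0 < tau.
  rewrite lt_neqAle tau0 andbT; apply/eqP => t0; apply: Ntau.
  by rewrite -t0 scale0r addr0; exact: Omega_val.
pose c i : R := tau * (1 - i.+1%:R^-1).
have cI i : 0 <= c i < tau.
  have i0 : 0 < (i.+1%:R : R)^-1 by rewrite invr_gt0.
  have i1 : (i.+1%:R : R)^-1 <= 1 by rewrite invf_le1// ler1n.
  by rewrite /c mulr_ge0 ?subr_ge0//= gtr_pMr// gtrBl.
have Oc i : val x + c i *: w \in Omega.
  by rewrite inE; have /andP[] := cI i; exact: Slt.
pose u i : Omega := SigSub (Oc i).
have valu i : val (u i) = val x + c i *: w by [].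
have dxu (p : Omega) (s : R) i : val p = val x + s *: w -> 0 <= s < tau ->
    di p (u i) <= `|c i - s| * enorm w.
  move=> ps /andP[s0 st]; apply: le_trans (int_dist_segment _) _; last first.
    by rewrite valu ps opprD addrACA subrr add0r -scalerBl enormZ.
  move=> a /andP[a0 a1]; have /andP[ci0 cit] := cI i.
  rewrite valu ps opprD addrACA subrr add0r -scalerBl scalerA -addrA -scalerDl.
  have h1 : 0 <= a * c i by exact: mulr_ge0.
  have h2 : 0 <= (1 - a) * s by rewrite mulr_ge0// subr_ge0.
  have h3 : 0 <= a * (tau - c i) by rewrite mulr_ge0// subr_ge0 ltW.
  apply: Slt; first by lra.
  have [a1'|a1'] := ltP a 1; last first.
    have -> : a = 1 by apply/eqP; rewrite eq_le a1 a1'.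
    by rewrite mul1r addrC subrK.
  have h4 : 0 < (1 - a) * (tau - s) by rewrite mulr_gt0// subr_gt0.
  by lra.
have ccv (e : R) : 0 < e -> exists N, forall i, (N <= i)%N -> tau - c i < e.
  move=> e0; have et : 0 < e / tau by rewrite divr_gt0.
  have [N _ hN] := near_infty_natSinv_lt (PosNum et); exists N => i Ni.
  have -> : tau - c i = i.+1%:R^-1 * tau by rewrite /c; ring.
  by rewrite -ltr_pdivlMr//; exact: (hN i Ni).
have w1 : 0 < enorm w + 1 by rewrite ltr_wpDl// enorm_ge0.
have cu : cauchy_seq di u.
  apply/cauchy_seqP => e e0; have ew : 0 < e / (enorm w + 1) by rewrite divr_gt0.
  have [N hN] := ccv _ ew; exists N => i j Ni Nj.
  apply: le_lt_trans (dxu (u i) (c i) j (valu i) (cI i)) _.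
  have hi := hN _ Ni; have hj := hN _ Nj.
  have /andP[_ ci] := cI i; have /andP[_ cj] := cI j.
  have h : `|c j - c i| < e / (enorm w + 1) by rewrite ltr_norml; apply/andP; split; lra.
  apply: (@le_lt_trans _ _ (`|c j - c i| * (enorm w + 1))).
    by rewrite ler_wpM2l// lerDl.
  by rewrite -ltr_pdivlMr.
have [eta ueta] := cauchy_converges diP cu.
have eb : int_bdry eta.
  move=> [z _ zeta]; subst eta; have hz := enorm_of_converges ueta.
  apply: Ntau; suff -> : val x + tau *: w = val z by exact: Omega_val.
  apply/eqP; rewrite -subr_eq0; apply/eqP/enorm_eq0/eqP; rewrite eq_le enorm_ge0 andbT.
  apply/ler_addgt0Pr => e e0; rewrite add0r.
  have e20 : 0 < e / 2 by lra.
  have ew : 0 < e / 2 / (enorm w + 1) by rewrite divr_gt0.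
  have [N hN] := ccv _ ew; have [M hM] := hz _ e20.
  have h1 := hN _ (leq_maxl N M); have h2 := hM _ (leq_maxr N M).
  apply: le_trans (ler_enorm_dist _ (val (u (maxn N M))) _) _.
  have /andP[_ ci] := cI (maxn N M).
  suff : enorm (val x + tau *: w - val (u (maxn N M))) <= e / 2 by lra.
  rewrite valu opprD addrACA subrr add0r -scalerBl enormZ ger0_norm ?subr_ge0 ?(ltW ci)//.
  apply: (@le_trans _ _ ((tau - c (maxn N M)) * (enorm w + 1))).
    by rewrite ler_wpM2l ?subr_ge0 ?(ltW ci)// lerDl.
  by rewrite -ler_pdivlMr// ltW.
have := bd_le (Ei x) eb; apply/negP; rewrite -ltNge; apply: le_lt_trans vx.
apply/ler_addgt0Pr => e e0; have [N hN] := (converges_toP diP _ _).1 ueta e e0.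
apply: le_trans (cdist_tri diP (Ei (u N)) _ _) _; apply: lerD; last exact/ltW/hN.
rewrite cdist_embed//.
have h0 : 0 <= (0 : R) < tau by rewrite lexx tau_gt0.
apply: le_trans (dxu x 0 N _ h0) _; first by rewrite scale0r addr0.
have /andP[c0 ct] := cI N.
by rewrite subr0 ger0_norm// ler_piMl ?enorm_ge0//; lra.
Qed.

Lemma seg_in_bd (x y : Omega) : enorm (val y - val x) < bd (Ei x) -> seg_in x y.
Proof. by apply: seg_in_ball => z; exact: bd_ball. Qed.

End boundary_distance.

Section curves.
Variable g : curve Omega.
Local Notation len := (curve_len g).
Local Notation tr := (curve_trace g).

Lemma curve_arc (s t : R) : 0 < s -> t < len -> arc_on (fun u => val (tr u)) s t.
Proof.
move=> s0 tl; apply/arcP => a b sa ab bt; rewrite -elengthE.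
by apply: curve_arclength => //; [exact: lt_le_trans sa|exact: le_lt_trans tl].
Qed.

Lemma curve_cvg (t : R) : 0 <= t <= len -> forall e : R, 0 < e ->
  exists2 delta : R, 0 < delta & forall s, 0 <= s <= len -> `|s - t| < delta ->
    cdist (g s) (g t) < e.
Proof.
move=> tl e e0; have /cvgr0Pnorm_lt/(_ e e0) := curve_cont tl.
move=> [delta d0 hd]; exists delta => // s sl st.
have := hd s; rewrite /= distrC in_itv/= => /(_ st sl).
by rewrite ger0_norm// cdist_ge0.
Qed.

Lemma curve_dist_trace (s t : R) : 0 < s -> s <= t -> t < len ->
  cdist (g s) (g t) <= t - s.
Proof.
move=> s0 st tl; have s1 : 0 < s < len by rewrite s0 (le_lt_trans st).
have t1 : 0 < t < len by rewrite tl (lt_le_trans s0).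
rewrite (curve_traceE s1) (curve_traceE t1).
by rewrite cdist_embed//; exact: (int_dist_arc st (curve_arc s0 tl)).
Qed.

(** Arc length is prescribed on the open parameter interval only. The ends, possibly on the
    boundary, are reached by continuity from [s + m] and [t - m]. *)
Lemma curve_dist (s t : R) : 0 <= s -> s <= t -> t <= len -> cdist (g s) (g t) <= t - s.
Proof.
move=> s0 st tl; move: (st); rewrite le_eqVlt => /predU1P[->|lt_st].
  by rewrite cdistxx subrr.
apply/ler_addgt0Pr => e e0; have e20 : 0 < e / 2 by lra.
have [|d1 d10 h1] := @curve_cvg s _ _ e20; first by rewrite s0 (le_trans st).
have [|d2 d20 h2] := @curve_cvg t _ _ e20; first by rewrite tl (le_trans s0).
pose m := Num.min (Num.min d1 d2) (t - s) / 3.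
have mm : 0 < Num.min (Num.min d1 d2) (t - s) by rewrite !lt_min d10 d20 subr_gt0.
have m0 : 0 < m by rewrite /m; lra.
have md1 : m < d1.
  by apply: (@lt_le_trans _ _ (Num.min (Num.min d1 d2) (t - s)));
    [rewrite /m; lra|rewrite !ge_min lexx].
have md2 : m < d2.
  by apply: (@lt_le_trans _ _ (Num.min (Num.min d1 d2) (t - s)));
    [rewrite /m; lra|rewrite !ge_min lexx orbT].
have mts : m <= (t - s) / 3.
  by rewrite /m ler_pM2r// ge_min lexx orbT.
have {}h1 := h1 (s + m); have {}h2 := h2 (t - m).
have h3 : cdist (g (s + m)) (g (t - m)) <= (t - m) - (s + m).
  by apply: curve_dist_trace; lra.
have {}h1 : cdist (g (s + m)) (g s) < e / 2.
  by apply: h1; [apply/andP; split; lra|rewrite addrC addKr ger0_norm// ltW].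
have {}h2 : cdist (g (t - m)) (g t) < e / 2.
  by apply: h2; [apply/andP; split; lra|rewrite addrC addKr normrN ger0_norm// ltW].
have := cdist_tri diP (g (s + m)) (g s) (g t).
have := cdist_tri diP (g (t - m)) (g (s + m)) (g t).
by rewrite (cdist_sym diP (g s) (g (s + m))); lra.
Qed.

End curves.

End geometry.

(** * Lower bound for the rho-metric *)

Lemma limf_esup_lt (R : realType) (T : choiceType)
  (X : filteredType T) (f : X -> \bar R) (F : set_system X)
  (c : \bar R) : (limf_esup f F < c)%E ->
  exists2 V, F V & forall y, V y -> (f y < c)%E.
Proof.
move=> /ereal_inf_lt[_ [V FV <-] h]; exists V => // y Vy.
by apply: le_lt_trans h; apply: ereal_sup_ubound; exists y.
Qed.

Lemma limf_einf_gt (R : realType) (T : choiceType)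
  (X : filteredType T) (f : X -> \bar R) (F : set_system X)
  (c : \bar R) : (c < limf_einf f F)%E ->
  exists2 V, F V & forall y, V y -> (c < f y)%E.
Proof.
rewrite /limf_einf lteNr => /limf_esup_lt[V FV h]; exists V => // y /h /=.
by rewrite lteN2.
Qed.

(** A factor 2 in the base costs at most 2^|beta|, whatever the sign of beta. *)
Lemma powR_ge_ratio (R : realType) (b0 b beta : R) : 0 < b0 -> b0 / 2 <= b -> b <= 2 * b0 ->
  2 `^ (- `|beta|) * b0 `^ beta <= b `^ beta.
Proof.
move=> b00 h1 h2; have b_gt0 : 0 < b by apply: lt_le_trans h1; lra.
have [be0|be0] := leP 0 beta.
  rewrite ger0_norm// powRN -powRV// -powRM ?invr_ge0 ?(ltW b00)//.
  by apply: powR_le => //; [rewrite mulr_ge0 ?invr_ge0// ltW|rewrite mulrC].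
rewrite ltr0_norm// opprK -powRM// ?(ltW b00)//.
rewrite -[beta]opprK !(powRN _ (- beta)) lef_pV2 ?posrE ?powR_gt0//; last first.
  by rewrite mulr_gt0.
by apply: powR_le; [rewrite oppr_ge0 ltW|exact: ltW|].
Qed.

(** * Densities and the identification of the two completions *)

Section density.
Context {R : realType} {n : nat} {Omega : set 'rV[R]_n}.
Variable rho : Omega -> {posnum R}.
Hypothesis Omega_domain : domain Omega.
Hypothesis rho_density : is_density rho.
Local Notation di := (int_dist Omega).
Local Notation dr := (rho_dist rho).
Local Notation Ei := (embed di).
Local Notation Er := (embed dr).
Let rho_cont : continuous (fun x : Omega => (rho x)%:num).
Proof. by case: rho_density. Qed.
Let diP := int_dist_pm Omega_domain.
Let drP := rho_dist_pm Omega_domain rho_cont.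
Implicit Types (xi zeta : rho_completion rho) (eta y : int_completion Omega).

(** Axiom (A1) applied to the interleaved sequence, which converges to [xi], gives one internal
    limit for both halves. *)
Lemma same_point_fun xi eta eta' : same_point xi eta -> same_point xi eta' -> eta = eta'.
Proof.
move=> [u [uxi ueta]] [v [vxi veta]]; have [_ _ A1 _] := rho_density.
have [|theta ht] := A1 (interleave u v).
  by exists xi; exact: interleave_converges drP _ _ _ uxi vxi.
by have [<- <-] := interleave_unique diP ht ueta veta.
Qed.

Lemma same_point_inj xi xi' eta : rho_bdry rho xi -> rho_bdry rho xi' ->
  same_point xi eta -> same_point xi' eta -> xi = xi'.
Proof.
move=> xb xb' [u [uxi ueta]] [v [vxi veta]]; have [_ _ _ A2] := rho_density.
apply: (A2 (interleave u v)) => //.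
- by exists eta; exact: interleave_converges diP _ _ _ ueta veta.
- move=> e N e0; have [M hM] := (converges_toP drP _ _).1 uxi e e0.
  exists (maxn N M).*2.+1.
    by rewrite -addnn ltnW// ltnS (leq_trans (leq_maxl N M))// leq_addr.
  rewrite /interleave /= odd_double /=; apply: hM.
  by rewrite -addnn ltnW// ltnS (leq_trans (leq_maxr N M))// leq_addr.
- move=> e N e0; have [M hM] := (converges_toP drP _ _).1 vxi e e0.
  exists (maxn N M).*2; first by rewrite -addnn (leq_trans (leq_maxl N M))// leq_addr.
  rewrite /interleave odd_double; apply: hM.
  by rewrite -addnn (leq_trans (leq_maxr N M))// leq_addr.
Qed.

Lemma int_near_rho_near (w : Omega) (e : R) : 0 < e -> exists2 delta : R, 0 < delta &
  forall z : Omega, di w z < delta -> dr w z < e.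
Proof.
move=> e0; have [d1 d10 h1] := rho_continuousP rho_cont w (ltr01 : 0 < (1 : R)).
have [d2 d20 h2] := domain_ball Omega_domain w.
pose M := (rho w)%:num + 1.
have M0 : 0 < M by rewrite addr_gt0.
exists (Num.min (Num.min d1 d2) (e / M)); first by rewrite !lt_min d10 d20 divr_gt0.
move=> z; rewrite !lt_min => /andP[/andP[z1 z2] ze].
have Ez := enorm_le_int_dist Omega_domain w z.
have sz : seg_in w z by apply: seg_in_ball h2 _; exact: le_lt_trans z2.
apply: le_lt_trans (rho_dist_segment rho_cont (M := M) sz _) _; last first.
  by rewrite mulrC -ltr_pdivlMr// (le_lt_trans Ez).
move=> x u /andP[u0 u1] xu; have := h1 x.
rewrite xu addrC addKr enormZ (ger0_norm u0) => h.
have : `|(rho x)%:num - (rho w)%:num| < 1.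
  by apply: h; apply: le_lt_trans z1; apply: le_trans Ez; rewrite ler_piMl// enorm_ge0.
by rewrite ltr_norml /M => /andP[_ ?]; lra.
Qed.

Lemma int_converges_rho (u : nat -> Omega) (w : Omega) :
  converges_to u (Ei w) -> converges_to u (Er w).
Proof.
move=> /(converges_toP diP) h; apply/(converges_toP drP) => e e0.
have [delta d0 hd] := int_near_rho_near w e0; have [N hN] := h _ d0.
exists N => i Ni; rewrite cdist_embed// (pm_sym drP); apply: hd.
by rewrite (pm_sym diP) -(cdist_embed diP); exact: hN.
Qed.

(** An internal limit inside Omega would also be a limit for the rho-metric, as rho is bounded near
    an interior point. *)
Lemma same_point_bdry xi eta : rho_bdry rho xi -> same_point xi eta -> int_bdry eta.
Proof.
move=> xb [u [uxi ueta]] [w _ weta]; subst eta; apply: xb; exists w => //.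
exact: converges_unique drP _ _ _ (int_converges_rho ueta) uxi.
Qed.

Lemma same_point_rho_bdry xi eta : int_bdry eta -> same_point xi eta -> rho_bdry rho xi.
Proof.
move=> eb sxe [w _ wxi]; subst xi; apply: eb; exists w => //.
apply: same_point_fun sxe; exists (fun=> w).
by split; exact: converges_cst.
Qed.

(** Points violating continuity at [xi] would form a sequence that tends to [xi]; by (A1) it
    converges internally, and its limit can only be [eta]. *)
Lemma same_point_cont xi eta (e : R) : same_point xi eta -> 0 < e ->
  exists2 delta : R, 0 < delta &
    forall z : Omega, cdist (Er z) xi < delta -> cdist (Ei z) eta < e.
Proof.
move=> sxe e0; apply: contrapT => h.
have hk k : exists z : Omega, cdist (Er z) xi < k.+1%:R^-1 /\ e <= cdist (Ei z) eta.
  apply: contrapT => hk; apply: h; exists k.+1%:R^-1; first by rewrite invr_gt0.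
  move=> z zk; rewrite ltNge; apply/negP => ez; apply: hk; by exists z.
have [u hu] := choice hk.
have uxi : converges_to u xi.
  apply/(converges_toP drP) => e1 e10.
  have [N _ hN] := near_infty_natSinv_lt (PosNum e10).
  by exists N => i Ni; apply: lt_trans (hu i).1 (hN i Ni).
have [_ _ A1 _] := rho_density; have [|theta ht] := A1 u; first by exists xi.
have st : same_point xi theta by exists u.
rewrite (same_point_fun st sxe) in ht.
have [N hN] := (converges_toP diP _ _).1 ht e e0.
by have := (hu N).2; rewrite leNgt hN.
Qed.

Section access_curve.
Variables (g : curve Omega) (l : R).
Hypothesis g_len : (rho_length rho g <= l%:E)%E.
Local Notation len := (curve_len g).
Local Notation tr := (curve_trace g).

Lemma trace_rho_len (s t : R) : 0 < s -> s <= t -> t < len -> rho_len rho tr s t <= l.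
Proof.
move=> s0 st tl; rewrite -lee_fin; apply: le_trans g_len.
have ci a b : 0 < a -> b < len -> cont_itv (fun u => (rho (tr u))%:num) a b.
  by move=> a0 bl; apply: (arc_cont_itv rho_cont); exact: curve_arc.
rewrite /rho_len /Rintegral fineK; last first.
  apply: integrable_fin_num => //; apply: cont_itv_integrable.
  exact: ci.
apply: ge0_subset_integral => //.
- apply/measurable_EFinP; apply: open_continuous_measurable_fun; first exact: interval_open.
  move=> t0; rewrite inE /= in_itv/= => /andP[t00 t0l].
  have /cont_itv_within : cont_itv (fun u => (rho (tr u))%:num) (t0 / 2) ((t0 + len) / 2).
    by apply: ci; lra.
  move=> /within_continuous_continuous; apply; rewrite ?in_itv/=; last by apply/andP; split; lra.
  by lra.
- move=> u /=; rewrite !in_itv/= => /andP[su ut].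
  by rewrite (lt_le_trans s0)//= (le_lt_trans ut).
Qed.

(* The points [tr s] form a rho-Cauchy family as [s] tends to 0, because the rho-length
   is finite; axiom (A2) identifies their rho-limit with [xi]. *)
Lemma trace_near_start xi (t : R) : rho_bdry rho xi -> same_point xi (g 0) ->
  0 < t -> t < len -> cdist (Er (tr t)) xi <= l.
Proof.
move=> xb sx t0 tl.
pose s k : R := t / k.+2%:R.
have sI k : 0 < s k <= t.
  by rewrite divr_gt0//= ler_pdivrMr// ler_peMr ?(ltW t0)// ler1n.
have s_dec i j : (i <= j)%N -> s j <= s i.
  by move=> ij; rewrite /s ler_pM2l// lef_pV2 ?posrE// ler_nat !ltnS.
pose u k := tr (s k).
pose a k := rho_len rho tr (s k) t.
have ain b c : 0 < b -> b <= c -> c <= t -> rho_len rho tr b t =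
    rho_len rho tr b c + rho_len rho tr c t.
  move=> b0 bc ct; apply: Rintegral_split => //; apply: (arc_cont_itv rho_cont).
  exact: curve_arc.
have dra b c : 0 < b -> b <= c -> c <= t -> dr (tr b) (tr c) <= rho_len rho tr b c.
  move=> b0 bc ct; apply: rho_dist_arc => //; apply: curve_arc => //.
  exact: le_lt_trans tl.
have dru i j : (i <= j)%N -> dr (u j) (u i) <= a j - a i.
  move=> ij; have /andP[sj0 sjt] := sI j; have /andP[si0 sit] := sI i.
  rewrite /a (ain (s j) (s i))// ?s_dec// addrK; apply: dra => //; exact: s_dec.
have a_nd i j : (i <= j)%N -> a i <= a j.
  by move=> ij; rewrite -subr_ge0; apply: le_trans (dru _ _ ij); exact: (pm_ge0 drP).
have a_cv : cvgn a.
  apply: nondecreasing_is_cvgn; first exact: a_nd.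
  exists l => _ [k _ <-]; have /andP[sk0 skt] := sI k; exact: trace_rho_len.
have cu : cauchy_seq dr u.
  apply/cauchy_seqP => e e0; have e20 : 0 < e / 2 by lra.
  have [N _ hN] := (cvgrPdist_lt _ _).1 a_cv _ e20.
  have key i j : (N <= i)%N -> (i <= j)%N -> dr (u j) (u i) < e.
    move=> Ni ij; apply: le_lt_trans (dru _ _ ij) _.
    have := hN i Ni; have := hN j (leq_trans Ni ij).
    by rewrite !ltr_norml => /andP[? ?] /andP[? ?]; lra.
  exists N => i j Ni Nj; have [ij|/ltnW ji] := leqP i j; last exact: key.
  by rewrite (pm_sym drP); exact: key.
have [xi' uxi'] := cauchy_converges drP cu.
have ug : converges_to u (g 0).
  apply/(converges_toP diP) => e e0.
  have g0 : 0 <= (0 : R) <= len by rewrite lexx curve_len_ge0.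
  have [d d0 hd] := curve_cvg Omega_domain g0 e0.
  have dt : 0 < d / t by rewrite divr_gt0.
  have [N _ hN] := near_infty_natSinv_lt (PosNum dt); exists N => i Ni.
  have /andP[si0 sit] := sI i.
  have sl : 0 < s i < len by rewrite si0 (le_lt_trans sit).
  rewrite -(curve_traceE sl); apply: hd; first by rewrite !ltW ?(andP sl).2.
  rewrite subr0 ger0_norm ?(ltW si0)// /s mulrC -ltr_pdivlMr//.
  apply: le_lt_trans (hN i Ni).
  by rewrite /= lef_pV2 ?posrE// ler_nat.
have sx' : same_point xi' (g 0) by exists u.
have xb' := same_point_rho_bdry (same_point_bdry xb sx) sx'.
rewrite (same_point_inj xb xb' sx sx').
apply/ler_addgt0Pr => e e0; have [N hN] := (converges_toP drP _ _).1 uxi' e e0.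
apply: le_trans (cdist_tri drP (Er (u N)) _ _) _; apply: lerD; last exact/ltW/hN.
have /andP[sN0 sNt] := sI N.
rewrite cdist_embed// (pm_sym drP); apply: le_trans (dra _ _ sN0 sNt (lexx _)) _.
exact: trace_rho_len.
Qed.

(** The distance [B] to the boundary along the curve is 1-Lipschitz and vanishes at 0. If [B t1]
    equals b1 > h / 2, then b1 <= t1, so the curve contains the piece [t1 - b1 / 2, t1], on which
    [B] stays within a factor 2 of b1. There rho is at least 2^(-|beta|) b1^beta, and the piece has
    length b1 / 2. *)
Lemma height_lower_bound eta0 (beta h : R) : int_bdry eta0 -> int_bdry (g 0) ->
  0 < h -> (h%:E <= height g)%E -> -1 < beta ->
  (forall t, 0 < t < len -> bd (Ei (tr t)) `^ beta <= (rho (tr t))%:num) ->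
  2 `^ (- `|beta|) / 2 * (h / 2) `^ (1 + beta) <= l.
Proof.
move=> e0b gb h0 hg be1 hrho.
have : ((h / 2)%:E < height g)%E by apply: lt_le_trans hg; rewrite lte_fin; lra.
move=> /ereal_sup_gt[_ [t0 /= + <-]]; rewrite in_itv/= => /andP[t00 t0l].
rewrite (bdE Omega_domain e0b) lte_fin.
have [B [BE B0 Blip hB]] : exists B : R -> R, [/\ forall t, B t = bd (g t), B 0 = 0,
    forall s t, 0 <= s -> s <= t -> t <= len ->
      B s <= B t + (t - s) /\ B t <= B s + (t - s) &
    forall t, 0 < t < len -> B t `^ beta <= (rho (tr t))%:num].
  exists (fun t => bd (g t)); split.
  - by move=> t; reflexivity.
  - exact: (bd_bdry Omega_domain e0b).
  - move=> s t s0 st tl.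
    have h1 := bd_lip Omega_domain e0b (g s) (g t).
    have h2 := bd_lip Omega_domain e0b (g t) (g s).
    have h3 := curve_dist Omega_domain s0 st tl.
    rewrite (cdist_sym diP (g t)) in h2.
    by split; [apply: le_trans h1 _|apply: le_trans h2 _]; rewrite addrC lerD2l.
  - by move=> t tl; rewrite (curve_traceE tl); exact: hrho.
rewrite -BE => bt0.
have t0_gt0 : 0 < t0.
  rewrite lt_neqAle t00 andbT; apply/eqP => t0E; move: bt0.
  by rewrite -t0E B0 ltNge divr_ge0// ltW.
(* [t0] may be the final time, which the bound on rho along the trace does not cover; a slightly
   earlier time still has [B] above h / 2. *)
have [t1 /andP[t10 t1l] bt1] : exists2 t1, 0 < t1 < len & h / 2 < B t1.
  pose m := Num.min (t0 / 2) ((B t0 - h / 2) / 2).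
  have m0 : 0 < m by rewrite lt_min; apply/andP; split; lra.
  have m1 : m <= t0 / 2 by rewrite ge_min lexx.
  have m2 : m <= (B t0 - h / 2) / 2 by rewrite ge_min lexx orbT.
  exists (t0 - m); first by apply/andP; split; lra.
  by have [|||_ ?] := Blip (t0 - m) t0; lra.
set b1 := B t1 in bt1.
have b1t : b1 <= t1.
  by have [_] := Blip 0 t1 (lexx _) (ltW t10) (ltW t1l); rewrite B0 add0r subr0.
have b10 : 0 < b1 by lra.
pose M := 2 `^ (- `|beta|) * b1 `^ beta.
have hM t : t1 - b1 / 2 <= t <= t1 -> M <= (rho (tr t))%:num.
  move=> /andP[ta tb]; have tl : 0 < t < len by apply/andP; split; lra.
  apply: le_trans (hB t tl).
  have [|||h1 h2] := Blip t t1; [lra..|].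
  by apply: powR_ge_ratio => //; rewrite -/b1 in h1 h2; lra.
have t12 : 0 < t1 - b1 / 2 by lra.
have t12' : t1 - b1 / 2 <= t1 by lra.
apply: le_trans (trace_rho_len t12 t12' t1l).
apply: (@le_trans _ _ (M * (b1 / 2))).
  rewrite /M (_ : _ * (b1 / 2) = 2 `^ (- `|beta|) / 2 * (b1 * b1 `^ beta)); last by ring.
  rewrite ler_wpM2l ?divr_ge0 ?powR_ge0//.
  rewrite -{1}(powRr1 (ltW b10)) -powRD; last by rewrite (gt_eqF b10) implybT.
  by apply: powR_le; lra.
have ci : cont_itv (fun u => (rho (tr u))%:num) (t1 - b1 / 2) t1.
  by apply: (arc_cont_itv rho_cont); exact: curve_arc.
apply: (@le_trans _ _ (\int[lebesgue_measure]_(t in `[t1 - b1 / 2, t1]) M)).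
  rewrite Rintegral_cst//= lebesgue_measure_itv/= lte_fin ifT; last by lra.
  by rewrite /= (_ : t1 - (t1 - b1 / 2) = b1 / 2)//; ring.
apply: le_Rintegral.
- exact: measurable_itv.
- apply: cont_itv_integrable => t _ e e0; exists 1 => // s _ _.
  by rewrite subrr normr0.
- exact: cont_itv_integrable.
- by move=> t /=; rewrite in_itv/=; exact: hM.
Qed.

End access_curve.

Hypothesis rho_access : forall xi, rho_bdry rho xi -> forall eps : R, 0 < eps ->
  exists2 r : R, 0 < r & forall zeta, cdist zeta xi < r ->
  exists (g : curve Omega) (x y : int_completion Omega),
    [/\ same_point xi x, same_point zeta y, joins g x y,
      ((cdist x y `^ (1 + eps))%:E <= height g)%E
    & (rho_length rho g <= (cdist xi zeta `^ (1 - eps))%:E)%E].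

(** The negative sign of the logarithm is what reverses inequalities when the denominator of
    [log_ratio] is cleared. *)
Lemma bd_lt1_ratio eta (z : Omega) (e : R) : int_bdry eta -> e <= 1 -> cdist (Ei z) eta < e ->
  0 < bd (Ei z) /\ ln (bd (Ei z)) < 0.
Proof.
move=> eb e1 ze; have b0 := bd_gt0 Omega_domain eb z; split => //.
by apply: ln_lt0; rewrite b0 (le_lt_trans (bd_le Omega_domain eb _ eb))// (lt_le_trans ze).
Qed.

Lemma i_plus_lt eta (beta : R) : int_bdry eta -> (i_plus rho eta < beta%:E)%E ->
  exists2 e : R, 0 < e & forall z : Omega, cdist (Ei z) eta < e ->
    bd (Ei z) `^ beta <= (rho z)%:num.
Proof.
move=> eb /limf_esup_lt[V [e /= e0 eV] hV]; exists (Num.min e 1); first by rewrite lt_min e0/=.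
move=> z ze; have [|b0 lb0] := bd_lt1_ratio eb _ ze; first by rewrite ge_min lexx orbT.
have ze1 : cdist (Ei z) eta < e by apply: lt_le_trans ze _; rewrite ge_min lexx.
have h : ln (rho z)%:num / ln (bd (Ei z)) < beta by rewrite -lte_fin; exact: hV z (eV z ze1).
rewrite ltr_ndivrMr// in h.
by rewrite -ler_ln ?posrE ?powR_gt0// ln_powR ltW.
Qed.

Lemma i_minus_gt eta (beta : R) : int_bdry eta -> (beta%:E < i_minus rho eta)%E ->
  exists2 e : R, 0 < e & forall z : Omega, cdist (Ei z) eta < e ->
    (rho z)%:num <= bd (Ei z) `^ beta.
Proof.
move=> eb /limf_einf_gt[V [e /= e0 eV] hV]; exists (Num.min e 1); first by rewrite lt_min e0/=.
move=> z ze; have [|b0 lb0] := bd_lt1_ratio eb _ ze; first by rewrite ge_min lexx orbT.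
have ze1 : cdist (Ei z) eta < e by apply: lt_le_trans ze _; rewrite ge_min lexx.
have h : beta < ln (rho z)%:num / ln (bd (Ei z)) by rewrite -lte_fin; exact: hV z (eV z ze1).
rewrite ltr_ndivlMr// in h.
by rewrite -ler_ln ?posrE ?powR_gt0// ln_powR ltW.
Qed.

(** With D = d_rho(x, y), the access curve has height at least d(x,y)^(1+eps) and rho-length at most
    D^(1-eps), so [height_lower_bound] bounds d(x,y)^((1+eps)(1+beta)) by a constant times
    D^(1-eps). The estimate is pointwise: [r] and [C] depend on [xi], while [zeta] is arbitrary. *)
Lemma lower_holder xi eta (beta p : R) : rho_bdry rho xi -> same_point xi eta ->
  (i_plus rho eta < beta%:E)%E -> -1 < beta -> 0 < p -> p * (1 + beta) < 1 ->
  exists r C : R, [/\ 0 < r, 0 < C & forall zeta y, same_point zeta y ->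
    cdist zeta xi < r -> cdist eta y <= C * cdist xi zeta `^ p].
Proof.
move=> xb sxe ip be1 p0 pb.
have eb := same_point_bdry xb sxe.
have [e1 e10 he1] := i_plus_lt eb ip.
have [delta d0 hd] := same_point_cont sxe e10.
pose q : R := p * (1 + beta).
have b0 : 0 < 1 + beta by lra.
have q0 : 0 < q by rewrite mulr_gt0.
have q1 : q < 1 by [].
(* The solution of 1 - eps = q (1 + eps): after raising to the power [m] the exponent of d_rho is
   exactly p. *)
pose eps : R := (1 - q) / (1 + q).
have eps0 : 0 < eps by apply: divr_gt0; lra.
have [r r0 hr] := rho_access xb eps0.
have q1n : 1 + q != 0 by rewrite gt_eqF//; lra.
have eps1 : 1 - eps = q * (1 + eps) by rewrite /eps; field; exact: q1n.
have eps10 : 0 < 1 - eps by rewrite eps1 mulr_gt0//; lra.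
pose c := 2 `^ (- `|beta|) / 2.
have c0 : 0 < c by rewrite divr_gt0// powR_gt0.
(* The second bound makes the rho-length of the access curve smaller than [delta], so the whole
   trace stays where the bound on rho near [eta] is valid. *)
pose r' := Num.min r (delta `^ (1 - eps)^-1).
pose m := ((1 + eps) * (1 + beta))^-1.
have e10' : 0 < 1 + eps by rewrite addr_gt0.
have eb0 : 0 < (1 + eps) * (1 + beta) by rewrite mulr_gt0.
have m0 : 0 < m by rewrite invr_gt0.
pose C := (2 `^ (1 + beta) / c) `^ m.
exists r', C; split.
- by rewrite lt_min r0 powR_gt0.
- by rewrite powR_gt0// divr_gt0// powR_gt0.
move=> zeta y szy; rewrite lt_min => /andP[zr zd].
have [g [x [y' [sx sy [g0 gl] hg lg]]]] := hr _ zr.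
have xE := same_point_fun sx sxe; have yE := same_point_fun sy szy.
rewrite xE yE in g0 hg.
have D0 : 0 <= cdist xi zeta by exact: (cdist_ge0 drP).
have [y0|y0] := leP (cdist eta y) 0.
  by apply: le_trans y0 _; rewrite mulr_ge0 ?powR_ge0.
have h0 : 0 < cdist eta y `^ (1 + eps) by rewrite powR_gt0.
have lE : cdist xi zeta `^ (1 - eps) < delta.
  rewrite (_ : delta = (delta `^ (1 - eps)^-1) `^ (1 - eps)); last first.
    by rewrite -powRrM mulVf ?gt_eqF// powRr1// ltW.
  by rewrite gt0_ltr_powR ?nnegrE ?powR_ge0// (cdist_sym drP).
have sxg : same_point xi (g 0) by rewrite g0.
have gb : int_bdry (g 0) by rewrite g0.
have hrho t : 0 < t < curve_len g ->
    bd (Ei (curve_trace g t)) `^ beta <= (rho (curve_trace g t))%:num.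
  move=> /andP[t0 tl]; apply: he1; apply: hd; apply: le_lt_trans lE.
  exact: (trace_near_start lg xb sxg t0 tl).
have := height_lower_bound lg eb gb h0 hg be1 hrho.
rewrite -/c powRM ?powR_ge0 ?invr_ge0// powRV// -powRrM => key.
have key2 : cdist eta y `^ ((1 + eps) * (1 + beta)) <=
    2 `^ (1 + beta) / c * cdist xi zeta `^ (1 - eps).
  have b20 : 0 < 2 `^ (1 + beta) :> R by rewrite powR_gt0.
  rewrite (_ : cdist eta y `^ _ = 2 `^ (1 + beta) / c *
    (c * (cdist eta y `^ ((1 + eps) * (1 + beta)) / 2 `^ (1 + beta)))).
    by rewrite ler_wpM2l// divr_ge0// ltW.
  by field; rewrite !gt_eqF.
have {key2} := powR_le (ltW m0) (powR_ge0 _ _) key2.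
rewrite -(powRrM (cdist eta y)) (mulfV (lt0r_neq0 eb0)) (powRr1 (ltW y0)).
rewrite powRM; [|by rewrite divr_ge0 ?powR_ge0// ltW|exact: powR_ge0].
rewrite -(powRrM (cdist xi zeta)) eps1 -/C (_ : q * (1 + eps) * m = p)//.
by rewrite /q /m; field; apply/andP; split; exact: lt0r_neq0.
Qed.

End density.

(** * Upper bound for the rho-metric *)

(** The label is the cell of a grid of mesh [delta] in the cube of half-side M delta. Each
    coordinate takes 2M + 1 values rather than 2M, because the right end of the interval starts a
    cell of its own; outside the cube the labels are meaningless. *)
Lemma grid_labels (R : realType) (n : nat) (delta : R) (M : nat) : 0 < delta ->
  exists2 N, N.+1 = ((M.*2).+1 ^ n)%N & exists c : 'rV[R]_n -> 'I_N.+1,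
    forall v w : 'rV[R]_n, (forall i, `|v 0 i| <= M%:R * delta) ->
      (forall i, `|w 0 i| <= M%:R * delta) -> c v = c w -> enorm (v - w) <= n%:R * delta.
Proof.
move=> d0; pose m := (M.*2).+1; pose N := (m ^ n).-1.
have NE : N.+1 = (m ^ n)%N by rewrite prednK// expn_gt0.
exists N => //.
have cE : #|{ffun 'I_n -> 'I_m}| = N.+1 by rewrite card_ffun !card_ord NE.
pose k (x : R) : 'I_m := inord (Num.truncn ((x + M%:R * delta) / delta)).
exists (fun v => cast_ord cE (enum_rank [ffun i => k (v 0 i)])).
move=> v w hv hw /cast_ord_inj/enum_rank_inj/ffunP h.
apply: enorm_le_coord; first exact: ltW.
have bnd x : `|x| <= M%:R * delta ->
    let q := (x + M%:R * delta) / delta in 0 <= q /\ (Num.truncn q < m)%N.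
  rewrite ler_norml => /andP[x1 x2] q; have q0 : 0 <= q.
    by rewrite divr_ge0// ?(ltW d0)// -lerBlDr sub0r.
  split => //; rewrite /m ltnS -(ler_nat R).
  have /andP[h1 _] := truncn_itv q0; apply: le_trans h1 _.
  by rewrite ler_pdivrMr// -addnn natrD mulrDl lerD2r.
move=> i; rewrite !mxE; have := h i; rewrite !ffunE => /(congr1 val).
have [v0 vm] := bnd _ (hv i); have [w0 wm] := bnd _ (hw i).
rewrite /k /= !inordK// => E.
have := truncn_itv v0; have := truncn_itv w0; rewrite E => /andP[w1 w2] /andP[v1 v2].
set a := (v 0 i + _) / _ in v0 vm v1 v2 E; set b := (w 0 i + _) / _ in w0 wm w1 w2 E.
have -> : v 0 i - w 0 i = (a - b) * delta by rewrite /a /b; field; exact: lt0r_neq0.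
rewrite normrM (gtr0_norm d0) -[leRHS]mul1r ler_pM2r// ler_norml.
rewrite -natr1 in v2 w2.
by move: (_%:R) v1 v2 w1 w2 => t *; apply/andP; split; lra.
Qed.

(** Both signs of beta at once: the largest value on [a, b] is at b when beta >= 0, and at a, which
    accounts for the factor (a / b)^beta, when beta < 0. *)
Lemma powR_itv_le (R : realType) (a b x beta : R) : 0 < a -> a <= x -> x <= b ->
  x `^ beta <= b `^ beta * (a / b) `^ (Num.min beta 0).
Proof.
move=> a0 ax xb; have x0 : 0 < x by exact: lt_le_trans ax.
have b0 : 0 < b by exact: lt_le_trans xb.
rewrite {1}(_ : x = b * (x / b)); last by field; exact: lt0r_neq0.
have xb0 : 0 < x / b by rewrite divr_gt0.
have ab0 : 0 < a / b by rewrite divr_gt0.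
have xb1 : x / b <= 1 by rewrite ler_pdivrMr// mul1r.
rewrite powRM ?(ltW b0) ?(ltW xb0)//; apply: ler_wpM2l; first exact: powR_ge0.
apply: (@le_trans _ _ ((x / b) `^ (Num.min beta 0))).
  by apply: ger_powR; [rewrite xb0|rewrite ge_min lexx].
rewrite -[Num.min _ _]opprK !(powRN _ (- Num.min _ _)) lef_pV2 ?posrE ?powR_gt0//.
apply: powR_le; last by rewrite ler_pM2r// invr_gt0.
  by rewrite oppr_ge0 ge_min lexx orbT.
exact: ltW.
Qed.

Lemma geometric_chain (R : realType) (X : Type) (d : X -> X -> R) (u : nat -> X) (A q : R) :
  pseudometric d -> d (u 0%N) (u 0%N) = 0 -> 0 <= A -> 0 <= q -> q < 1 ->
  (forall k, d (u k.+1) (u k) <= A * q ^+ k) ->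
  forall k, d (u k) (u 0%N) <= A / (1 - q).
Proof.
move=> dP d0 A0 q0 q1 h k; have q1' : 0 < 1 - q by rewrite subr_gt0.
(* The factor 1 - q^k is what makes the induction close. *)
suff : d (u k) (u 0%N) <= A / (1 - q) * (1 - q ^+ k).
  move=> /le_trans; apply; rewrite ler_piMr ?divr_ge0 ?(ltW q1')// gerBl exprn_ge0//.
elim: k => [|k ih]; first by rewrite d0 expr0 subrr mulr0.
apply: le_trans (pm_tri dP (u k) _ _) _; apply: le_trans (lerD (h k) ih) _.
rewrite exprSr le_eqVlt; apply/orP; left; apply/eqP; field; exact: lt0r_neq0.
Qed.

Section upper.
Context {R : realType} {n : nat} {Omega : set 'rV[R]_n}.
Variable rho : Omega -> {posnum R}.
Hypothesis Omega_domain : domain Omega.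
Hypothesis rho_density : is_density rho.
Local Notation di := (int_dist Omega).
Local Notation dr := (rho_dist rho).
Local Notation Ei := (embed di).
Local Notation Er := (embed dr).
Let rho_cont : continuous (fun x : Omega => (rho x)%:num).
Proof. by case: rho_density. Qed.
Let diP := int_dist_pm Omega_domain.
Let drP := rho_dist_pm Omega_domain rho_cont.
Implicit Types (xi zeta : rho_completion rho) (eta y : int_completion Omega).

Variables (alpha : R) (x0 : Omega) (eta0 : int_completion Omega).
Hypothesis alpha_gt0 : 0 < alpha.
Hypothesis alpha_le1 : alpha <= 1.
Hypothesis eta0_bdry : int_bdry eta0.
Hypothesis john_curve : forall x : Omega, exists g : curve Omega,
  joins g (Ei x) (Ei x0) /\
  forall t, 0 <= t <= curve_len g -> ((alpha * t)%:E <= bdist (g t))%E.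

Let bdl := bd_le Omega_domain eta0_bdry.

Variables (beta e1 : R).
Hypothesis beta_gtN1 : -1 < beta.
Hypothesis e1_gt0 : 0 < e1.

(** The condition i^- > beta at the fixed scale [e1]; letting [e1] run through the numbers 1 / (k +
    1) exhausts the points that satisfy it. *)
Definition rho_bounded eta := forall z : Omega, cdist (Ei z) eta < e1 ->
  (rho z)%:num <= bd (Ei z) `^ beta.

(** On the dyadic piece of length of order 2^(-k) r of a John curve, rho exceeds its size at scale r
    by at most a factor of order 2^(-k bm). Hence [q], the ratio of successive contributions, which
    is below 1 because beta > -1. *)
Let bm := Num.min beta 0.
Let q : R := 2^-1 `^ (1 + bm).

Let bm_gtN1 : 0 < 1 + bm.
Proof. by rewrite -ltrBlDl sub0r lt_min beta_gtN1 ltrN10. Qed.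

Let q_lt1 : q < 1.
Proof.
rewrite /q powRV// -powRN; apply: two_powR_lt1.
rewrite oppr_lt0; exact: bm_gtN1.
Qed.

Let pow2 (k : nat) : ((2^-1 : R) ^+ k) `^ bm * 2^-1 ^+ k = q ^+ k.
Proof.
have k0 : 0 < (2^-1 : R) ^+ k by rewrite exprn_gt0// invr_gt0.
rewrite -{2}(powRr1 (ltW k0)) -powRD; last by rewrite (gt_eqF k0) implybT.
rewrite -powR_mulrn ?invr_ge0// -powRrM /q -powR_mulrn ?powR_ge0// -powRrM.
by rewrite mulrC addrC.
Qed.

(** Bound for the outermost dyadic piece: distances to the boundary lie between alpha r / 2 and 2 r,
    whose ratio is alpha / 4, and the length is r / 2. *)
Let A0 : R := 2 `^ beta * (alpha / 4) `^ bm / 2.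

(** [w] is the point at arc length r on the John curve from [z]. At arc length t <= r the distance
    to the boundary is at least alpha t by the John condition and at most 2 r because [eta] is near,
    which bounds rho there; dyadic pieces replace the integral near t = 0. *)
Lemma john_cone (z : Omega) eta (r : R) : int_bdry eta -> rho_bounded eta -> 0 < r ->
  2 * r < e1 -> 3 * r <= bd (Ei x0) -> cdist (Ei z) eta < r ->
  exists w : Omega, [/\ alpha * r <= bd (Ei w), cdist (Ei w) eta <= 2 * r,
    dr z w <= A0 / (1 - q) * r `^ (1 + beta) & di x0 w <= bd (Ei x0) / alpha].
Proof.
move=> eb hrho r0 re1 rx0 zr.
have [g [[g0 gl] hg]] := john_curve z.
pose len := curve_len g; pose tr := curve_trace g.
have {}hg t : 0 <= t <= len -> alpha * t <= bd (g t).
  by move=> tl; rewrite -lee_fin -(bdE Omega_domain eta0_bdry); exact: hg.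
have len0 : 0 <= len by exact: curve_len_ge0.
have d0t t : 0 <= t -> t <= len -> cdist (g t) eta <= t + r.
  move=> t0 tl; apply: le_trans (cdist_tri diP (g 0) _ _) _; apply: lerD.
    by rewrite (cdist_sym diP); have := curve_dist Omega_domain (lexx _) t0 tl; rewrite subr0.
  by rewrite g0; exact: ltW.
(* The centre is at least 3 r from the boundary while the curve ends within len + r of [eta], so it
   is long enough to contain [w]. *)
have lenr : 2 * r <= len.
  have : bd (g len) <= len + r.
    by apply: le_trans (bdl _ eb) _; exact: d0t.
  by rewrite gl; move: (bd (Ei x0)) rx0 => b; lra.
have rl : r < len by lra.
have trE t : 0 < t -> t < len -> g t = Ei (tr t).
  by move=> t0 tl; apply: curve_traceE; rewrite t0.
have bnd t : 0 < t -> t <= r -> (rho (tr t))%:num <=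
    (2 * r) `^ beta * (alpha * t / (2 * r)) `^ bm.
  move=> t0 tr'; have tl : t < len by lra.
  have ct : cdist (g t) eta <= 2 * r.
    by apply: le_trans (d0t t (ltW t0) (ltW tl)) _; lra.
  have e1t : cdist (Ei (tr t)) eta < e1 by rewrite -trE//; exact: le_lt_trans re1.
  apply: le_trans (hrho _ e1t) _; rewrite -trE//.
  apply: powR_itv_le; first exact: mulr_gt0.
    by apply: hg; rewrite !ltW.
  by apply: le_trans (bdl _ eb) _.
have half0 k : 0 < (2^-1 : R) ^+ k by rewrite exprn_gt0// invr_gt0.
have half1 k : (2^-1 : R) ^+ k <= 1 by apply: exprn_ile1; rewrite ?invr_ge0// invf_le1// ler1n.
pose t_ k := r * 2^-1 ^+ k.
have t_0 k : 0 < t_ k by rewrite mulr_gt0.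
have t_r k : t_ k <= r by rewrite /t_ ler_piMr// ltW.
have t_S k : t_ k.+1 = t_ k / 2 by rewrite /t_ exprSr mulrA.
have step k : dr (tr (t_ k.+1)) (tr (t_ k)) <= A0 * r `^ (1 + beta) * q ^+ k.
  have tt : t_ k.+1 <= t_ k by rewrite t_S ler_pdivrMr// ler_peMr ?(ltW (t_0 k))// ler1n.
  have ag : arc_on (fun u => val (tr u)) (t_ k.+1) (t_ k).
    by apply: curve_arc => //; exact: le_lt_trans rl.
  pose M := (2 * r) `^ beta * (alpha * t_ k.+1 / (2 * r)) `^ bm.
  apply: le_trans (rho_dist_arc_le rho_cont (M := M) tt ag _) _.
    move=> t /andP[t1 t2]; have t_gt0 : 0 < t := lt_le_trans (t_0 _) t1.
    apply: le_trans (bnd t t_gt0 (le_trans t2 (t_r k))) _.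
    rewrite /M; apply: ler_wpM2l; first exact: powR_ge0.
    rewrite -[bm]opprK !(powRN _ (- bm)) lef_pV2 ?posrE ?powR_gt0 ?divr_gt0 ?mulr_gt0//.
    apply: powR_le; first by rewrite oppr_ge0 ge_min lexx orbT.
      by rewrite ltW// divr_gt0 ?mulr_gt0.
    by rewrite ler_pM2r ?invr_gt0 ?mulr_gt0// ler_pM2l.
  rewrite /M t_S (_ : alpha * (t_ k / 2) / (2 * r) = alpha / 4 * 2^-1 ^+ k); last first.
    by rewrite /t_; field; exact: lt0r_neq0.
  have a40 : 0 <= alpha / 4 by rewrite divr_ge0// ltW.
  rewrite (powRM bm a40 (ltW (half0 k))) (powRM beta (ler0n _ 2) (ltW r0)) -pow2.
  rewrite powRD; last by rewrite (gt_eqF r0) implybT.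
  rewrite (powRr1 (ltW r0)) /A0 /t_ le_eqVlt; apply/orP; left; apply/eqP.
  by field.
have A00 : 0 <= A0 * r `^ (1 + beta) by rewrite /A0 !mulr_ge0 ?powR_ge0 ?invr_ge0.
have chain k : dr (tr (t_ k)) (tr (t_ 0%N)) <= A0 * r `^ (1 + beta) / (1 - q).
  apply: (@geometric_chain _ _ dr (fun k => tr (t_ k))) => //; last exact: powR_ge0.
  exact: distxx.
have t_0E : t_ 0%N = r by rewrite /t_ expr0 mulr1.
exists (tr r); split.
- by rewrite -trE//; apply: hg; rewrite !ltW.
- rewrite -trE//; apply: le_trans (d0t r (ltW r0) (ltW rl)) _.
  by rewrite le_eqVlt; apply/orP; left; apply/eqP; ring.
(* The dyadic chain never reaches [z]. As [z] is interior, the points [tr (t_ k)], internally close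
   to it for large k, are also rho-close. *)
- apply/ler_addgt0Pr => e e0.
  have [delta de0 hd] := int_near_rho_near Omega_domain rho_density z e0.
  have g00 : 0 <= (0 : R) <= len by rewrite lexx len0.
  have [d' d'0 hd'] := curve_cvg Omega_domain g00 de0.
  have [k hk] := dyadic_ex (divr_gt0 d'0 r0).
  apply: le_trans (pm_tri drP (tr (t_ k.+1)) _ _) _; rewrite addrC; apply: lerD.
    by rewrite mulrAC; have := chain k.+1; rewrite t_0E.
  apply/ltW/hd; rewrite -(cdist_embed diP) (cdist_sym diP) -trE//; last first.
    exact: le_lt_trans rl.
  rewrite -g0; apply: hd'; first by rewrite (ltW (t_0 _))/= (le_trans (t_r _))// ltW.
  by rewrite subr0 gtr0_norm// /t_ mulrC -ltr_pdivlMr.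
(* The John condition at the final time bounds the length of every John curve, so all the points [w]
   stay in one bounded region. *)
- rewrite -(cdist_embed diP) (cdist_sym diP) -trE// -gl.
  apply: le_trans (curve_dist Omega_domain (ltW r0) (ltW rl) (lexx _)) _.
  rewrite ler_pdivlMr// mulrC.
  apply: (@le_trans _ _ (alpha * len)).
    by rewrite ler_pM2l// gerBl ltW.
  by apply: hg; rewrite len0 lexx.
Qed.

Let B0 : R := 3 `^ beta * (alpha / 6) `^ bm * (alpha / 2).

(** The segment is at most half as long as the distance from [w] to the boundary. Along it that
    distance stays between alpha r / 2 and 3 r, whose ratio alpha / 6 appears in [B0]. *)
Lemma near_points (w w' : Omega) eta (r : R) : int_bdry eta -> rho_bounded eta -> 0 < r ->
  3 * r < e1 -> alpha * r <= bd (Ei w) -> cdist (Ei w) eta <= 2 * r ->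
  enorm (val w' - val w) <= alpha * r / 2 -> dr w w' <= B0 * r `^ (1 + beta).
Proof.
move=> eb hrho r0 re1 bw wr ww.
have ar0 : 0 < alpha * r by exact: mulr_gt0.
have ar : alpha * r / 2 <= r.
  by rewrite ler_pdivrMr// mulrC ler_pM2l// (le_trans alpha_le1)// ler1n.
have h2 : alpha * r / 2 < alpha * r by rewrite ltr_pdivrMr// ltr_pMr// ltr1n.
have sw : seg_in w w'.
  apply: (seg_in_bd Omega_domain eta0_bdry); apply: le_lt_trans ww _.
  exact: lt_le_trans bw.
pose M := (3 * r) `^ beta * (alpha * r / 2 / (3 * r)) `^ bm.
apply: le_trans (rho_dist_segment rho_cont (M := M) sw _) _.
  move=> z u /andP[u0 u1] zE.
  have zw : enorm (val z - val w) <= alpha * r / 2.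
    rewrite zE addrC addKr enormZ ger0_norm//; apply: le_trans ww.
    by rewrite ler_piMl// enorm_ge0.
  have dz : cdist (Ei w) (Ei z) <= alpha * r / 2.
    rewrite cdist_embed//; apply: (le_trans _ zw); apply: int_dist_segment.
    apply: (seg_in_bd Omega_domain eta0_bdry).
    by apply: le_lt_trans zw _; exact: lt_le_trans bw.
  have dz3 : cdist (Ei z) eta <= 3 * r.
    apply: le_trans (cdist_tri diP (Ei w) _ _) _; rewrite (cdist_sym diP).
    apply: le_trans (lerD (le_trans dz ar) wr) _.
    by rewrite le_eqVlt; apply/orP; left; apply/eqP; ring.
  apply: le_trans (hrho z _) _; first exact: le_lt_trans re1.
  apply: powR_itv_le; first by rewrite divr_gt0.
    have := le_trans bw (bd_lip Omega_domain eta0_bdry (Ei w) (Ei z)).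
    move=> /le_trans/(_ (lerD dz (lexx _))); move: (bd (Ei z)) => b; lra.
  exact: le_trans (bdl _ eb) _.
have M0 : 0 <= M by rewrite mulr_ge0 ?powR_ge0.
apply: le_trans (ler_wpM2l M0 ww) _.
rewrite /M (_ : alpha * r / 2 / (3 * r) = alpha / 6); last by field; exact: lt0r_neq0.
rewrite powRM ?(ltW r0)// powRD; last by rewrite (gt_eqF r0) implybT.
rewrite (powRr1 (ltW r0)) /B0 le_eqVlt; apply/orP; left; apply/eqP.
by move: (3 `^ _) (r `^ _) (_ `^ bm) => *; field.
Qed.

Definition bounded_bdry : set (rho_completion rho) := [set xi | rho_bdry rho xi /\
  forall eta, same_point xi eta -> rho_bounded eta].

(** The Euclidean substitute for the boundary: closeness of the points [W xi] at scale r forces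
    rho-closeness. The first clause permits counting cells globally, the second counting them near
    one boundary point. *)
Lemma john_points : exists C r0 : R, [/\ 0 < C, 0 < r0 & forall r, 0 < r < r0 ->
  exists W : rho_completion rho -> Omega,
    [/\ forall xi, bounded_bdry xi -> (exists eta, same_point xi eta) ->
          enorm (val (W xi) - val x0) <= bd (Ei x0) / alpha,
        forall xi eta, bounded_bdry xi -> same_point xi eta ->
          cdist (Ei (W xi)) eta <= 2 * r &
        forall xi xi', bounded_bdry xi -> bounded_bdry xi' ->
          (exists eta, same_point xi eta) -> (exists eta, same_point xi' eta) ->
          enorm (val (W xi') - val (W xi)) <= alpha * r / 2 ->
          cdist xi xi' <= C * r `^ (1 + beta)]].
Proof.
(* The added 1 pays for replacing [xi] by a point of Omega at rho-distance below r^(1+beta). In [C]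
   the three terms are the legs from [xi] to [W xi], to [W xi'] and to [xi']. *)
pose C1 := A0 / (1 - q) + 1.
pose C := C1 + B0 + C1.
have q1' : 0 < 1 - q by rewrite subr_gt0; exact: q_lt1.
have C10 : 0 < C1 by rewrite ltr_wpDl// divr_ge0 ?(ltW q1')// /A0 !mulr_ge0 ?powR_ge0 ?invr_ge0.
have B00 : 0 <= B0 by rewrite /B0 !mulr_ge0 ?powR_ge0 ?divr_ge0// ltW.
have b0 : 0 < bd (Ei x0) by exact: bd_gt0 eta0_bdry _.
exists C, (Num.min (e1 / 3) (bd (Ei x0) / 3)); split.
- by rewrite /C addr_gt0// ltr_wpDr.
- by rewrite lt_min !divr_gt0.
move=> r /andP[r0]; rewrite lt_min !ltr_pdivlMr// => /andP[re rb].
have hw xi : exists w : Omega, bounded_bdry xi -> (exists eta, same_point xi eta) ->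
    [/\ alpha * r <= bd (Ei w), forall eta, same_point xi eta -> cdist (Ei w) eta <= 2 * r,
      cdist (Er w) xi <= C1 * r `^ (1 + beta) & di x0 w <= bd (Ei x0) / alpha].
  have [[[xb hx] [eta sxe]]|hn] := pselect (bounded_bdry xi /\ exists eta, same_point xi eta);
      last first.
    by exists x0 => h1 h2; exfalso; apply: hn.
  have eb := same_point_bdry Omega_domain rho_density xb sxe.
  have [u [uxi ueta]] := sxe.
  have rp : 0 < r `^ (1 + beta) by rewrite powR_gt0.
  have [N1 h1] := (converges_toP drP _ _).1 uxi _ rp.
  have [N2 h2] := (converges_toP diP _ _).1 ueta _ r0.
  pose z := u (maxn N1 N2).
  have z1 : cdist (Er z) xi < r `^ (1 + beta) by exact/h1/leq_maxl.
  have z2 : cdist (Ei z) eta < r by exact/h2/leq_maxr.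
  have re2 : 2 * r < e1 by lra.
  have rb3 : 3 * r <= bd (Ei x0) by rewrite mulrC ltW.
  have [w [w1 w2 w3 w4]] := john_cone eb (hx _ sxe) r0 re2 rb3 z2.
  exists w => _ _; split => //.
    by move=> eta' sxe'; rewrite (same_point_fun Omega_domain rho_density sxe' sxe).
  apply: le_trans (cdist_tri drP (Er z) _ _) _.
  rewrite /C1 mulrDl mul1r; apply: lerD; last exact: ltW.
  by rewrite cdist_embed// (pm_sym drP).
have [W hW] := choice hw.
exists W; split.
- move=> xi bx ex; have [_ _ _ h] := hW xi bx ex.
  by apply: le_trans h; exact: enorm_le_int_dist.
- by move=> xi eta bx sxe; have [_ + _ _] := hW xi bx (ex_intro _ _ sxe); apply.
- move=> xi xi' bx bx' ex ex' ww.
  have [w1 w2 w3 _] := hW xi bx ex; have [_ _ w3' _] := hW xi' bx' ex'.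
  have [eta sxe] := ex; have [xb hx] := bx.
  have eb := same_point_bdry Omega_domain rho_density xb sxe.
  have re3 : 3 * r < e1 by rewrite mulrC.
  have := near_points eb (hx _ sxe) r0 re3 w1 (w2 _ sxe) ww.
  move=> h; apply: le_trans (cdist_tri drP (Er (W xi')) _ _) _.
  rewrite /C 2!mulrDl; apply: lerD => //.
  apply: le_trans (cdist_tri drP (Er (W xi)) _ _) _; apply: lerD.
    by rewrite (cdist_sym drP).
  by rewrite cdist_embed.
Qed.

Lemma upper_holder_labels :
  holder_labels (@cdist _ _ di) (@cdist _ _ dr) (fun eta xi => same_point xi eta)
    bounded_bdry (1 + beta).
Proof.
have [C [r0 [C0 r00 hC]]] := john_points.
(* Chosen so that M delta >= 5 r: if [xi] and [xi'] come from a set of diameter r, then [W xi] and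
   [W xi'] are within 2 r + r + 2 r. M does not depend on r, hence neither does the number of
   labels; [n.+1] keeps the mesh meaningful for n = 0. *)
pose M := (Num.truncn (10 * n.+1%:R / alpha)).+1.
have [N0 _ _] := @grid_labels R n 1 M ltr01.
pose N := (((M.*2).+1 ^ n)%N).-1.
exists N, C, r0; split => // r U hr hU.
have /andP[r_gt0 _] := hr.
have [W [_ W2 W3]] := hC r hr.
pose delta := alpha * r / 2 / n.+1%:R.
have d0 : 0 < delta by rewrite !divr_gt0// mulr_gt0.
have [N' N'E [c hc]] := @grid_labels R n delta M d0.
have NE : N = N' by rewrite /N -N'E.
rewrite NE.
have [[xi0 [bx0 [eta0' Ue0 s0]]]|hn] :=
    pselect (exists xi, (bounded_bdry `&` rel_image (fun eta xi => same_point xi eta) U) xi);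
    last first.
  exists (fun=> ord0) => x y [bx ux]; exfalso; apply: hn; exists x; split => //.
exists (fun xi => c (val (W xi) - val (W xi0))).
have M5 : 5 * r <= M%:R * delta.
  rewrite /delta; have := truncnS_gt (10 * n.+1%:R / alpha); rewrite -/M ltr_pdivrMr// => h.
  rewrite !mulrA ler_pdivlMr// ler_pdivlMr//.
  apply: (@le_trans _ _ (10 * n.+1%:R * r)); last by rewrite ler_wpM2r ?ltW.
  by rewrite le_eqVlt; apply/orP; left; apply/eqP; ring.
have hb xi : (bounded_bdry `&` rel_image (fun eta xi => same_point xi eta) U) xi ->
    forall i, `|(val (W xi) - val (W xi0)) 0 i| <= M%:R * delta.
  move=> [bx [eta Ue se]] i; apply: le_trans (ler_coord_enorm _ _) _; apply: le_trans M5.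
  apply: le_trans (enorm_le_int_dist Omega_domain _ _) _; rewrite -(cdist_embed diP).
  apply: le_trans (cdist_tri diP eta0' _ _) _.
  rewrite (_ : 5 * r = 2 * r + 3 * r); last by ring.
  apply: lerD; first exact: W2.
  apply: le_trans (cdist_tri diP eta _ _) _.
  rewrite (_ : 3 * r = r + 2 * r); last by ring.
  by apply: lerD; [exact: hU|rewrite (cdist_sym diP); exact: W2].
move=> xi xi' h h' cc; have [bx [eta _ se]] := h; have [bx' [eta' _ se']] := h'.
apply: W3 => //; [by exists eta|by exists eta'|].
have := hc _ _ (hb _ h') (hb _ h) (esym cc).
rewrite opprB addrA subrK => /le_trans; apply.
rewrite /delta mulrCA ler_piMr ?divr_ge0 ?mulr_ge0 ?(ltW alpha_gt0) ?(ltW r_gt0)//.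
by rewrite ler_pdivrMr// mul1r ler_nat.
Qed.

(** All the points [W xi] lie within [L] of [x0], so of the order of r^(-n) cells suffice, each
    giving a class of rho-diameter s = C r^(1+beta). The resulting exponent n / (1 + beta) is small
    for large beta, which is how points with large or infinite i^- are treated. *)
Lemma upper_small_labels : exists K R0 : R, [/\ 0 < K, 0 < R0 & forall r, 0 < r < R0 ->
  exists2 N : nat, N.+1%:R <= K * r `^ (- (n%:R / (1 + beta))) &
    small_labels (@cdist _ _ dr)
      (bounded_bdry `&` [set xi | exists eta, same_point xi eta]) N r].
Proof.
have [C [r0 [C0 r00 hC]]] := john_points.
have be0 : 0 < 1 + beta by rewrite -ltrBlDl sub0r.
pose L := bd (Ei x0) / alpha.
have L0 : 0 <= L by rewrite divr_ge0// ?(ltW alpha_gt0)// ltW//; exact: bd_gt0 eta0_bdry _.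
(* An upper bound for r times the number [M.*2.+1] of cells per coordinate. *)
pose K1 := 4 * L * n.+1%:R / alpha * 2 + 3 * r0.
have K10 : 0 < K1.
  have h : 0 <= 4 * L * n.+1%:R / alpha * 2.
    apply: mulr_ge0 => //; apply: divr_ge0; last exact: ltW.
    by apply: mulr_ge0 => //; apply: mulr_ge0.
  by rewrite ltr_wpDl// mulr_gt0.
pose K := K1 ^+ n * C `^ (n%:R / (1 + beta)).
exists K, (C * r0 `^ (1 + beta)); split.
- by rewrite mulr_gt0 ?exprn_gt0 ?powR_gt0.
- by rewrite mulr_gt0 ?powR_gt0.
move=> s /andP[s0 sr0].
pose r := (s / C) `^ (1 + beta)^-1.
have r_gt0 : 0 < r by rewrite powR_gt0// divr_gt0.
have sE : C * r `^ (1 + beta) = s.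
  rewrite /r -powRrM mulVf ?(lt0r_neq0 be0)// powRr1 ?divr_ge0 ?(ltW s0) ?(ltW C0)//.
  by field; exact: lt0r_neq0.
have rr0 : r < r0.
  rewrite ltNge; apply/negP => h; move: sr0; rewrite ltNge => /negP; apply.
  by rewrite -sE ler_pM2l//; apply: powR_le => //; exact: ltW.
have hr : 0 < r < r0 by rewrite r_gt0.
have [W [W1 _ W3]] := hC r hr.
pose delta := alpha * r / 2 / n.+1%:R.
have d0 : 0 < delta by rewrite !divr_gt0// mulr_gt0.
pose M := (Num.truncn (L / delta)).+1.
have [N NE [c hc]] := @grid_labels R n delta M d0.
have ML : L <= M%:R * delta by rewrite -ler_pdivrMr// ltW// truncnS_gt.
exists N.
  rewrite NE natrX /K.
  apply: (@le_trans _ _ ((K1 / r) ^+ n)).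
    apply: lerXn2r; rewrite ?nnegrE// ?divr_ge0 ?(ltW K10) ?(ltW r_gt0)//.
    have /andP[h _] := truncn_itv (divr_ge0 L0 (ltW d0)).
    rewrite -addnn -addSn natrD ler_pdivlMr// /M -!natr1.
    have : L / delta * r = 2 * L * n.+1%:R / alpha.
      rewrite /delta; field.
      by rewrite !lt0r_neq0.
    move=> E; have := ler_wpM2r (ltW r_gt0) h; rewrite E => h'.
    rewrite /K1; move: h' rr0 r_gt0.
    set a := (Num.truncn _)%:R.
    rewrite (_ : 4 * L * n.+1%:R / alpha * 2 = 4 * (2 * L * n.+1%:R / alpha)); last by ring.
    have : 0 <= 2 * L * n.+1%:R / alpha.
      apply: divr_ge0; [|exact: ltW].
      by apply: mulr_ge0 => //; apply: mulr_ge0.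
    move: (2 * L * n.+1%:R / alpha) a => b a b0 ab h1 h2; lra.
  rewrite exprMn -mulrA ler_pM2l ?exprn_gt0//.
  rewrite -powR_mulrn ?invr_ge0 ?(ltW r_gt0)// powRV ?(ltW r_gt0)// /r -powRrM.
  rewrite powRN powRM ?invr_ge0 ?(ltW s0) ?(ltW C0)// powRV ?(ltW C0)//.
  rewrite (mulrC _^-1 n%:R) invfM invrK mulrC.
  by rewrite [leLHS]mulrC.
exists (fun xi => c (val (W xi) - val x0)) => xi xi' [bx ex] [bx' ex'] cc.
have hb z : bounded_bdry z -> (exists eta, same_point z eta) ->
    forall i, `|(val (W z) - val x0) 0 i| <= M%:R * delta.
  move=> bz ez i; apply: le_trans (ler_coord_enorm _ _) _; apply: le_trans ML.
  exact: W1.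
rewrite -sE; apply: W3 => //.
have := hc _ _ (hb _ bx' ex') (hb _ bx ex) (esym cc).
rewrite opprB addrA subrK => /le_trans; apply.
rewrite /delta mulrCA ler_piMr ?divr_ge0 ?mulr_ge0 ?(ltW alpha_gt0) ?(ltW r_gt0)//.
by rewrite ler_pdivrMr// mul1r ler_nat.
Qed.

End upper.

(** * Comparison of dimensions *)

Section dimension_of_measures.
Context {R : realType}.
Local Open Scope ereal_scope.

(* [hausdorff_dim] and [packing_dim] are [critical_exponent] of the corresponding
   families of measures. *)
Definition critical_exponent (m : R -> \bar R) : \bar R :=
  ereal_inf [set s%:E | s in [set s : R | (0 <= s)%R /\ m s = 0]].

Lemma critical_exponent_ge0 m : 0 <= critical_exponent m.
Proof. by apply: le_ereal_inf_tmp => _ [s [s0 _] <-]; rewrite lee_fin. Qed.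

Lemma critical_exponent_le m (s : R) : (0 <= s)%R -> (forall t : R, (s < t)%R -> m t = 0) ->
  critical_exponent m <= s%:E.
Proof.
move=> s0 h; apply/lee_addgt0Pr => e e0; rewrite -EFinD.
apply: ereal_inf_lbound; exists (s + e)%R => //; split; first by rewrite addr_ge0// ltW.
by apply: h; rewrite ltrDl.
Qed.

Lemma critical_exponent_lt m (c : R) : critical_exponent m < c%:E ->
  exists s : R, [/\ (0 <= s)%R, (s < c)%R & m s = 0].
Proof. by move=> /ereal_inf_lt[_ [s [s0 ms] <-]]; rewrite lte_fin; exists s. Qed.

Lemma sup_quotient_le (m1 : R -> \bar R) (m2 : R -> R -> \bar R) :
  (forall s beta t : R, (0 <= s)%R -> m1 s = 0 -> (-1 < beta)%R -> (s * (1 + beta) < t)%R ->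
    m2 beta t = 0) ->
  sup_quotient (fun beta => critical_exponent (m2 beta)) <= critical_exponent m1.
Proof.
move=> h; apply: ge_ereal_sup => _ [beta /= be1 <-].
apply: le_ereal_inf_tmp => _ [s [s0 m1s] <-].
have be0 : (0 < 1 + beta)%R by rewrite -ltrBlDl sub0r.
rewrite lee_pdivrMr//; apply: critical_exponent_le; first by rewrite mulr_ge0// ltW.
by move=> t; exact: h.
Qed.

Lemma le_sup_quotient (m1 : R -> \bar R) (m2 : R -> R -> \bar R) :
  (forall M t : R, (0 < M)%R -> (M < t)%R ->
    (forall beta : R, (-1 < beta)%R -> forall c : R, (M * (1 + beta) < c)%R ->
      exists s : R, [/\ (0 <= s)%R, (s < c)%R & m2 beta s = 0]) -> m1 t = 0) ->
  critical_exponent m1 <= sup_quotient (fun beta => critical_exponent (m2 beta)).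
Proof.
move=> h; set f := fun beta => _; have ub beta : (-1 < beta)%R ->
    f beta * ((1 + beta)^-1)%:E <= sup_quotient f.
  by move=> be1; apply: ereal_sup_ubound; exists beta.
(* The value at beta = 0 excludes a supremum equal to -oo. *)
have : 0 <= sup_quotient f.
  apply: le_trans (ub 0%R (ltrN10 _)).
  by apply: mule_ge0; [exact: critical_exponent_ge0|rewrite lee_fin addr0 invr1].
move: (sup_quotient f) ub => [sigma| |] ub // s0; last by rewrite leey.
rewrite lee_fin in s0; apply: critical_exponent_le => // t st.
(* A number strictly between the supremum and t: every quotient is strictly below it, so infima
   defining dimensions yield actual null exponents. *)
apply: (h ((sigma + t) / 2)%R t); [lra|lra|] => beta be1 c hc.
have be0 : (0 < 1 + beta)%R by rewrite -ltrBlDl sub0r.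
apply: critical_exponent_lt; apply: (@le_lt_trans _ _ (sigma * (1 + beta))%:E).
  by rewrite EFinM -lee_pdivrMr//; exact: ub.
rewrite lte_fin; apply: le_lt_trans hc; rewrite ler_pM2r//; lra.
Qed.

End dimension_of_measures.

(** * Exhaustion of the boundary by countably many pieces *)

Section assembly.
Context {R : realType} {n : nat} {Omega : set 'rV[R]_n}.
Variable rho : Omega -> {posnum R}.
Hypothesis Omega_domain : domain Omega.
Hypothesis rho_density : is_density rho.
Local Notation di := (int_dist Omega).
Local Notation dr := (rho_dist rho).
Let rho_cont : continuous (fun x : Omega => (rho x)%:num).
Proof. by case: rho_density. Qed.
Let diP := int_dist_pm Omega_domain.
Let drP := rho_dist_pm Omega_domain rho_cont.
Implicit Types (xi zeta : rho_completion rho) (eta y : int_completion Omega).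

Lemma exists_succ_gt (x : R) : exists k : nat, x < k.+1%:R.
Proof. by exists (Num.truncn x); exact: truncnS_gt. Qed.

Lemma exists_invn_lt (x : R) : 0 < x -> exists k : nat, k.+1%:R^-1 < x.
Proof.
by move=> x0; have [N _ hN] := near_infty_natSinv_lt (PosNum x0); exists N; exact: (hN N (leqnn N)).
Qed.

Section lower_null.
Variables (Z : R -> set (rho_completion rho) -> Prop)
  (null : R -> set (int_completion Omega) -> Prop).
Hypothesis transfer : forall A1 A2 S (p s t : R), 0 <= s -> 0 < t -> s < t * p -> 0 < p ->
  holder_labels (@cdist _ _ dr) (@cdist _ _ di) S A2 p -> Z s A1 ->
  A2 `<=` rel_image S A1 -> null t A2.
Hypothesis null_bigcup : forall A : nat -> set (int_completion Omega), forall t,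
  (forall k, null t (A k)) -> null t (\bigcup_k A k).
Hypothesis null_sub : forall A B t, A `<=` B -> null t B -> null t A.
Hypothesis rho_access : forall xi, rho_bdry rho xi -> forall eps : R, 0 < eps ->
  exists2 r : R, 0 < r & forall zeta, cdist zeta xi < r ->
  exists (g : curve Omega) (x y : int_completion Omega),
    [/\ same_point xi x, same_point zeta y, joins g x y,
      ((cdist x y `^ (1 + eps))%:E <= height g)%E
    & (rho_length rho g <= (cdist xi zeta `^ (1 - eps))%:E)%E].

(** [Z] and [null] abstract the two kinds of nullity so that one argument serves both dimensions.
    They differ for packing: the given set has measure zero, the result is [packing_null]. *)
Lemma lower_null (s beta t : R) : 0 <= s -> Z s (rho_bdry rho) -> -1 < beta ->
  s * (1 + beta) < t -> null t (sublevel rho (i_plus rho) beta).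
Proof.
move=> s0 Zs be1 st.
have be0 : 0 < 1 + beta by rewrite -ltrBlDl sub0r.
have t0 : 0 < t by apply: le_lt_trans st; rewrite mulr_ge0// ltW.
have s1 : 0 < s + 1 by rewrite ltr_wpDl.
(* Room to pass from i^+ <= beta to i^+ < beta + e while keeping s (1 + beta + e) < t. *)
pose e := (t - s * (1 + beta)) / (s + 1).
have e0 : 0 < e by rewrite divr_gt0// subr_gt0.
pose beta' := beta + e.
have bb : beta < beta' by rewrite ltrDl.
have be'0 : 0 < 1 + beta' by rewrite (lt_trans be0)// ltrD2l.
have sb' : s * (1 + beta') < t.
  have eE : e * (s + 1) = t - s * (1 + beta) by rewrite divfK ?gt_eqF.
  by move: e e0 eE @beta' bb be'0 => e e0 eE beta' _ _; rewrite /beta'; lra.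
(* Any p strictly between s / t and 1 / (1 + beta') works: the first bound is needed for the
   transfer, the second for [lower_holder]. *)
have [p [p0 sp pb]] : exists p : R, [/\ 0 < p, s < t * p & p * (1 + beta') < 1].
  have h : s / t < (1 + beta')^-1 by rewrite ltr_pdivrMr// mulrC ltr_pdivlMr.
  have := midf_lt h; set p := (_ + _) / 2 => -[h1 h2].
  have st0 : 0 <= s / t by rewrite divr_ge0// ltW.
  exists p; split; first exact: le_lt_trans h1.
    by rewrite mulrC -ltr_pdivrMr.
  by rewrite -ltr_pdivlMr// mul1r.
(* The radius and the constant of [lower_holder] depend on the point; on [E k] they are fixed to 1 /
   (k + 1) and k + 1. *)
pose E k := [set eta | sublevel rho (i_plus rho) beta eta /\
  forall xi zeta y, rho_bdry rho xi -> same_point xi eta -> same_point zeta y ->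
    cdist zeta xi < k.+1%:R^-1 -> cdist eta y <= k.+1%:R * cdist xi zeta `^ p].
apply: (@null_sub _ (\bigcup_k E k)).
  move=> eta sub; have [[xi xb sxe] ieta] := sub.
  have [|r [C [r0 C0 hC]]] := lower_holder Omega_domain rho_density rho_access xb sxe
    (beta := beta') _ (lt_trans be1 bb) p0 pb.
    by apply: le_lt_trans ieta _; rewrite lte_fin.
  have [k1 hk1] := exists_invn_lt r0; have [k2 hk2] := exists_succ_gt C.
  exists (maxn k1 k2) => //; split => // xi' zeta y xb' sxe' sz zr.
  rewrite (same_point_inj Omega_domain rho_density xb' xb sxe' sxe) in zr *.
  apply: le_trans (hC zeta y sz _) _.
    apply: lt_trans zr _; apply: le_lt_trans hk1.
    by rewrite lef_pV2 ?posrE// ler_nat ltnS leq_maxl.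
  apply: ler_wpM2r; first exact: powR_ge0.
  by apply: ltW; apply: lt_le_trans hk2 _; rewrite ler_nat ltnS leq_maxr.
apply: null_bigcup => k.
apply: (transfer (S := fun xi eta => rho_bdry rho xi /\ same_point xi eta) s0 t0 sp p0 _ Zs).
  (* On [E k] the estimate is a true Hölder bound, so a single label suffices. *)
  exists 0%N, k.+1%:R, k.+1%:R^-1; split=> [//|//|r U /andP[r0 rk] hU].
  exists (fun=> ord0) => y z [[_ hy] [xi Uxi [xb sxy]]] [_ [zeta Uz [_ szz]]] _.
  apply: le_trans (hy xi zeta z xb sxy szz _) _; first exact: le_lt_trans (hU _ _ Uz Uxi) rk.
  apply: ler_wpM2l => //; apply: powR_le; [exact: ltW|exact: cdist_ge0|exact: hU].
by move=> eta [[[xi xb sxe] _] _]; exists xi.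
Qed.

End lower_null.

Section upper_null.
Variables (Z : R -> set (int_completion Omega) -> Prop)
  (null : R -> set (rho_completion rho) -> Prop).
Hypothesis transfer : forall A1 A2 S (p s t : R), 0 <= s -> 0 < t -> s < t * p -> 0 < p ->
  holder_labels (@cdist _ _ di) (@cdist _ _ dr) S A2 p -> Z s A1 ->
  A2 `<=` rel_image S A1 -> null t A2.
Hypothesis null_bigcup : forall (I : countType) (A : I -> set (rho_completion rho)) t,
  (forall k, null t (A k)) -> null t (\bigcup_k A k).
Hypothesis null_sub : forall A B t, A `<=` B -> null t B -> null t A.
Hypothesis null_labels : forall A (K a t r0 : R), 0 < K -> 0 <= a -> a < t -> 0 < r0 ->
  (forall r, 0 < r < r0 -> exists2 N : nat, N.+1%:R <= K * r `^ (- a) &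
     small_labels (@cdist _ _ dr) A N r) -> null t A.
Hypothesis Omega_john : john Omega.

(** For rationals a < i^- <= b with M (1 + b) < t (1 + a), the sublevel set at b is null for some s
    < t (1 + a), while the upper estimate at a has exponent 1 + a; transfer then gives nullity at t.
    Points with i^- > b0 are left to box counting. *)
Lemma upper_null (M t : R) : 0 < M -> M < t ->
  (forall beta : R, -1 < beta -> forall c, M * (1 + beta) < c ->
    exists s, [/\ 0 <= s, s < c & Z s (sublevel rho (i_minus rho) beta)]) ->
  null t (rho_bdry_i_minus_gtN1 rho).
Proof.
move=> M0 Mt hZ; have t0 := lt_trans M0 Mt.
have [alpha [/andP[al0 al1] [x0 hj]]] := Omega_john.
have [_ [xi0 xb0] A1 _] := rho_density.
have [|eta0 ueta0] := A1 (rep xi0); first by exists xi0; exact: rep_converges drP _.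
have e0b : int_bdry eta0.
  apply: (same_point_bdry Omega_domain rho_density xb0).
  by exists (rep xi0); split => //; exact: rep_converges drP _.
pose B (b e : R) : set (rho_completion rho) := @bounded_bdry R n Omega rho b e.
(* With this threshold n / (1 + b0) < t, so box counting alone gives nullity at t. *)
pose b0 : R := n%:R / t.
have b00 : 0 <= b0 by rewrite divr_ge0// ltW.
have b0t : n%:R / (1 + b0) < t.
  by rewrite ltr_pdivrMr ?ltr_pwDl// mulrDr mulr1 mulrCA divff ?lt0r_neq0// mulr1 ltrDr.
have b0N1 : -1 < b0 by apply: lt_le_trans b00; rewrite ltrN10.
have k0 k : 0 < (k.+1%:R : R)^-1 by rewrite invr_gt0.
pose good (ab : rat * rat) := [/\ -1 < ratr ab.1 :> R, -1 < ratr ab.2 :> R &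
  M * (1 + ratr ab.2) < t * (1 + ratr ab.1)].
pose A (i : option (rat * rat) * nat) := if i.1 is Some ab then
    [set xi | good ab /\ B (ratr ab.1) i.2.+1%:R^-1 xi /\ exists2 eta,
      sublevel rho (i_minus rho) (ratr ab.2) eta & same_point xi eta]
  else B b0 i.2.+1%:R^-1 `&` [set xi | exists eta, same_point xi eta].
have Binc b e e' xi : e <= e' -> B b e' xi -> B b e xi.
  move=> ee [xb h]; split => // eta sxe z ze; apply: (h eta sxe).
  exact: lt_le_trans ze ee.
have Bi xi eta b : rho_bdry rho xi -> same_point xi eta -> (b%:E < i_minus rho eta)%E ->
    exists k : nat, B b k.+1%:R^-1 xi.
  move=> xb sxe be; have eb := same_point_bdry Omega_domain rho_density xb sxe.
  have [e e_gt0 he] := i_minus_gt Omega_domain eb be.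
  have [k hk] := exists_invn_lt e_gt0; exists k.
  apply: (Binc _ _ _ _ (ltW hk)); split => // eta' sxe'.
  by rewrite (same_point_fun Omega_domain rho_density sxe' sxe).
apply: (@null_sub _ (\bigcup_i A i)).
  move=> xi [xb [eta sxe im]].
  have [ib|bi] := ltP (b0%:E) (i_minus rho eta).
    by have [k Bk] := Bi _ _ _ xb sxe ib; exists (None, k) => //; split => //; exists eta.
  have [i iE] : exists i : R, i_minus rho eta = i%:E.
    by case: (i_minus rho eta) im bi => [i _ _| |]//; exists i.
  have i1 : -1 < i by rewrite -lte_fin -iE.
  have i0 : 0 < 1 + i by rewrite -ltrBlDl sub0r.
  (* The lower bound on [a] says M (1 + i) < t (1 + a) and lies below i because M < t; the same
     inequality then leaves room for a rational b above i. *)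
  have [a] : exists a : rat, ratr a \in `]Num.max (-1) ((1 + i) * M / t - 1), i[.
    apply: rat_in_itvoo; rewrite gt_max i1 ltrBlDr ltr_pdivrMr// (addrC i).
    by rewrite ltr_pM2l.
  rewrite in_itv/= gt_max => /andP[/andP[a1 a2] ai].
  have ta : (1 + i) * M < t * (1 + ratr a).
    by rewrite ltrBlDr ltr_pdivrMr// in a2; rewrite [ltRHS]mulrC (addrC 1 (ratr a)).
  have [b] : exists b : rat, ratr b \in `]i, t * (1 + ratr a) / M - 1[.
    by apply: rat_in_itvoo; rewrite ltrBrDr ltr_pdivlMr// (addrC i).
  rewrite in_itv/= => /andP[ib bb].
  have aim : ((ratr a)%:E < i_minus rho eta)%E by rewrite iE lte_fin.
  have [k Bk] := Bi xi eta (ratr a) xb sxe aim.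
  exists (Some (a, b), k) => //=; split; last first.
    split => //; exists eta => //; split; first by exists xi.
    by rewrite iE lee_fin ltW.
  split => //=; first exact: lt_trans ib.
  by rewrite ltrBrDr ltr_pdivlMr// in bb; rewrite [ltLHS]mulrC (addrC 1 (ratr b)).
have hb0 k : null t (B b0 k.+1%:R^-1 `&` [set xi | exists eta, same_point xi eta]).
  have [K [R0 [K0 R00 hK]]] := upper_small_labels Omega_domain rho_density al0 al1 e0b hj
    b0N1 (k0 k).
  by apply: (null_labels K0 _ b0t R00) => //; rewrite divr_ge0// addr_ge0.
apply: null_bigcup => -[[ab|] k]; last exact: hb0.
(* A pair that is not good yields an empty piece, which is null as a subset of a null set. *)
rewrite /A /=; have [[g1 g2 g3]|ng] := pselect (good ab); last first.
  by apply: (null_sub _ (hb0 k)) => xi [].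
have [s [s0 st Zs]] := hZ _ g2 _ g3.
have be0 : 0 < 1 + ratr ab.1 :> R by rewrite -ltrBlDl sub0r.
have [N [C [r0 [C0 r00 hl]]]] := upper_holder_labels Omega_domain rho_density al0 al1 e0b hj
  g1 (k0 k).
apply: (transfer (S := fun eta xi => same_point xi eta) s0 t0 st be0 _ Zs).
  exists N, C, r0; split => // r U hr hU; have [c hc] := hl r U hr hU.
  by exists c => x y [[_ [Bx _]] Sx] [[_ [By _]] Sy]; apply: hc.
by move=> xi [_ [_ [eta sub sxe]]]; exists eta.
Qed.

End upper_null.

End assembly.

Theorem theorem4p2 (R : realType) (n : nat) (Omega : set 'rV[R]_n)
    (rho : Omega -> {posnum R})
    (Omega_domain : domain Omega) (Omega_john : john Omega)
    (rho_density : is_density rho)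
    (rho_access : forall xi : rho_completion rho, rho_bdry rho xi ->
      forall eps : R, 0 < eps ->
      exists2 r : R, 0 < r &
      forall zeta : rho_completion rho, cdist zeta xi < r ->
      exists (g : curve Omega) (x y : int_completion Omega),
        [/\ same_point xi x, same_point zeta y, joins g x y,
            ((cdist x y `^ (1 + eps))%:E <= height g)%E
          & (rho_length rho g <= (cdist xi zeta `^ (1 - eps))%:E)%E]) :
  [/\ (sup_quotient (d_plus rho) <= rho_dimH (rho_bdry rho))%E,
      (sup_quotient (D_plus rho) <= rho_dimP (rho_bdry rho))%E,
      (rho_dimH (rho_bdry_i_minus_gtN1 rho)
        <= sup_quotient (d_minus rho))%E
    & (rho_dimP (rho_bdry_i_minus_gtN1 rho)
        <= sup_quotient (D_minus rho))%E].
Proof.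
have rho_cont : continuous (fun x : Omega => (rho x)%:num) by case: rho_density.
have diP := cdist_pm (int_dist_pm Omega_domain).
have drP := cdist_pm (rho_dist_pm Omega_domain rho_cont).
have dixx := @cdistxx R Omega (int_dist Omega).
have drxx := @cdistxx R Omega (rho_dist rho).
split.
- apply: sup_quotient_le => s beta t s0 Zs be1 st.
  apply: (lower_null Omega_domain rho_density
    (Z := fun s A => hausdorff_measure (@cdist _ _ (rho_dist rho)) s A = 0%E)
    (null := fun t A => hausdorff_measure (@cdist _ _ (int_dist Omega)) t A = 0%E)
    _ _ _ rho_access s0 Zs be1 st).
  + move=> A1 A2 S p s' t' s'0 t'0 st' p0 hl Z1 A21.
    exact: (hausdorff_null_transfer drxx dixx s'0 t'0 (ltW st') p0 hl Z1 A21).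
  + by move=> A t' hA; exact: hausdorff_null_bigcup.
  + by move=> A B t'; exact: sub_hausdorff_null.
- apply: sup_quotient_le => s beta t s0 Zs be1 st; apply: packing_null_measure.
  apply: (lower_null Omega_domain rho_density
    (Z := fun s A => packing_measure (@cdist _ _ (rho_dist rho)) s A = 0%E)
    _ _ _ rho_access s0 Zs be1 st).
  + move=> A1 A2 S p s' t' s'0 t'0 st' p0 hl Z1 A21.
    exact: (packing_null_transfer drP drxx diP dixx s'0 p0 st' hl Z1 A21).
  + by move=> A t' hA; exact: packing_null_bigcup.
  + by move=> A B t'; exact: sub_packing_null.
- apply: le_sup_quotient => M t M0 Mt hZ.
  apply: (upper_null Omega_domain rho_density
    (Z := fun s A => hausdorff_measure (@cdist _ _ (int_dist Omega)) s A = 0%E)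
    (null := fun t A => hausdorff_measure (@cdist _ _ (rho_dist rho)) t A = 0%E)
    _ _ _ _ Omega_john M0 Mt hZ).
  + move=> A1 A2 S p s' t' s'0 t'0 st' p0 hl Z1 A21.
    exact: (hausdorff_null_transfer dixx drxx s'0 t'0 (ltW st') p0 hl Z1 A21).
  + by move=> I A t' hA; exact: hausdorff_null_bigcup.
  + by move=> A B t'; exact: sub_hausdorff_null.
  + move=> A K a t' r0 K0 a0 at' r00 hl.
    exact: (hausdorff_null_labels drxx K0 a0 at' r00 hl).
- apply: le_sup_quotient => M t M0 Mt hZ; apply: packing_null_measure.
  apply: (upper_null Omega_domain rho_density
    (Z := fun s A => packing_measure (@cdist _ _ (int_dist Omega)) s A = 0%E)
    _ _ _ _ Omega_john M0 Mt hZ).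
  + move=> A1 A2 S p s' t' s'0 t'0 st' p0 hl Z1 A21.
    exact: (packing_null_transfer diP dixx drP drxx s'0 p0 st' hl Z1 A21).
  + by move=> I A t' hA; exact: packing_null_bigcup.
  + by move=> A B t'; exact: sub_packing_null.
  (* The counting bound makes the premeasure of [A] itself vanish, so [A] serves as its own
     cover. *)
  + move=> A K a t' r0 K0 a0 at' r00 hl; exists (fun=> A); split.
      by move=> x Ax; exists 0%N.
    move=> _; apply: (packing_premeasure_few drP drxx _ a0 at' r00
      (few_separated_labels K0 a0 hl)).
    by rewrite mulr_ge0 ?powR_ge0// ltW.
Qed.
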